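(* Let $T\subset Sp(W)$ be a maximal elliptic torus. The restriction of the Weil representation $S_\psi$ to $T$ is a direct sum of characters, all occurring with multiplicity $1$.
   Context: $k$ is a non-archimedean local field of characteristic $0$ and residue characteristic $p\ne2$; $\psi$ is a non-trivial unitary character of $(k,+)$; $(W,\beta)$ is a non-zero finite-dimensional symplectic $k$-space. $H(W)=W\times k$ with $(w,t)(w',t')=(w+w',t+t'+\frac12\beta(w,w'))$ is the Heisenberg group, $\rho_\psi$ its unique irreducible unitary representation with central character $\psi$, on a Hilbert space $\mathcal{H}_\psi$. $\widehat{Sp(W)}_\psi$ is the group of pairs $(g,U)\in Sp(W)\times U(\mathcal{H}_\psi)$ with $U\rho_\psi(w,t)U^{-1}=\rho_\psi(gw,t)$ for all $(w,t)\in H(W)$; $Mp(W)$ is its unique subgroup on which the projection to $Sp(W)$ is surjective with kernel of order $2$; the Weil representation $S_\psi$ of $Mp(W)$ is $(g,U)\mapsto U$. A torus (meaning the group of $k$-points of a torus of $Sp(W)$ defined over $k$) is elliptic if it contains no non-central split subtorus; for $Sp(W)$ this means it is anisotropic, i.e. compact. The cover $Mp(W)\to Sp(W)$ splits over a maximal elliptic torus $T$, and $T$ is identified with a subgroup of $Mp(W)$ by the choice of a section (a group homomorphism $T\to Mp(W)$ lifting the inclusion). *)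

(* Defs.v *)
From HB Require Import structures.
From mathcomp Require Import all_boot all_order all_algebra.
From mathcomp Require Import all_classical all_reals topology normedtype.
From mathcomp Require Import complex.
From mathcomp Require mpoly.

Set Implicit Arguments.
Unset Strict Implicit.
Unset Printing Implicit Defensive.

Import Order.TTheory GRing.Theory Num.Theory.
Import numFieldNormedType.Exports.

Local Open Scope classical_set_scope.
Local Open Scope ring_scope.

(** * Non-archimedean local fields *)

(* A field with a non-trivial ultrametric absolute value whose topology is
   locally compact; the absolute value need not be the normalized one. *)
HB.mixin Record isNonarchLocal (R : realType) (k : Type)
    & GRing.Field k & Topological k := {
  absv : k -> R;
  absv_ge0 : forall x, 0 <= absv x;
  absv_eq0 : forall x, (absv x == 0) = (x == 0);
  absvM : forall x y, absv (x * y) = absv x * absv y;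
  absvD_max : forall x y, absv (x + y) <= Num.max (absv x) (absv y);
  absv_nontrivial : exists x, x != 0 /\ absv x != 1;
  nbhs_absv : forall x : k, nbhs x = nbhs_ball_ (ball_ absv) x;
  absv_locally_compact : locally_compact [set: k]
}.

#[short(type="nonarchLocalFieldType")]
HB.structure Definition NonarchLocalField (R : realType) :=
  {k of GRing.Field k & Topological k & isNonarchLocal R k}.

(* [p] vanishes in the residue field, the quotient of the valuation ring
   [absv x <= 1] by its maximal ideal [absv x < 1]. *)
Definition residue_char (R : realType) (k : nonarchLocalFieldType R)
    (p : nat) : Prop :=
  prime p /\ absv (p%:R : k) < 1.

Definition unitary_character (R : realType) (k : nonarchLocalFieldType R)
    (psi : k -> R[i]^o) : Prop :=
  [/\ forall x y, psi (x + y) = psi x * psi y,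
      forall x, `|psi x| = 1
    & continuous psi].

(** * The Heisenberg group *)

Definition heis_mul (k : fieldType) (W : vectType k) (beta : W -> W -> k)
    (x y : W * k) : W * k :=
  (x.1 + y.1, x.2 + y.2 + 2%:R^-1 * beta x.1 y.1).

(** * Hilbert spaces and unitary representations *)

(* [H] being complete, this makes it a Hilbert space; the inner product is
   linear in its first argument. *)
Definition hilbert_dot (R : realType) (H : completeNormedModType R[i])
    (dot : {dot H for Num.conj}) : Prop :=
  forall v : H, `|v| ^+ 2 = dot v v.

Definition unitary_op (R : realType) (H : completeNormedModType R[i])
    (dot : {dot H for Num.conj}) (U : H -> H) : Prop :=
  [/\ linear U, bijective U & forall v w, dot (U v) (U w) = dot v w].

Definition linear_subspace (R : realType) (H : completeNormedModType R[i])
    (V : set H) : Prop :=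
  V 0 /\ forall (a : R[i]) (v w : H), V v -> V w -> V (a *: v + w).

(* [W] carries no topology of its own: it is identified with k^n through the
   coordinates in a basis. *)
Definition heis_unitary_rep (R : realType) (k : nonarchLocalFieldType R)
    (W : vectType k) (beta : W -> W -> k) (H : completeNormedModType R[i])
    (dot : {dot H for Num.conj}) (rho : W * k -> H -> H) : Prop :=
  [/\ forall x, unitary_op dot (rho x),
      forall x y v, rho (heis_mul beta x y) v = rho x (rho y v)
    & forall v : H, continuous (fun x : 'rV[k]_(\dim {:W}) * k =>
        rho (passmx.vecof (vbasis {:W}) x.1, x.2) v)].

Definition heis_irreducible (R : realType) (k : fieldType)
    (W : vectType k) (H : completeNormedModType R[i])
    (rho : W * k -> H -> H) : Prop :=
  (exists v : H, v != 0) /\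
  forall V : set H, linear_subspace V -> closed V ->
    (forall x v, V v -> V (rho x v)) -> V = [set 0] \/ V = [set: H].

Definition central_character (R : realType) (k : fieldType)
    (W : vectType k) (H : completeNormedModType R[i])
    (rho : W * k -> H -> H) (psi : k -> R[i]^o) : Prop :=
  forall t v, rho (0, t) v = psi t *: v.

(** * The symplectic and metaplectic groups *)

Definition Sp (k : fieldType) (W : vectType k) (beta : W -> W -> k) :
    set 'End(W) :=
  [set g | forall w w', beta (g w) (g w') = beta w w'].

Definition mp_one (k : fieldType) (W : vectType k) (H : Type) :
    'End(W) * (H -> H) := (\1%VF, id).

Definition mp_mul (k : fieldType) (W : vectType k) (H : Type)
    (x y : 'End(W) * (H -> H)) : 'End(W) * (H -> H) :=
  ((x.1 \o y.1)%VF, x.2 \o y.2).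

Definition Sp_hat (R : realType) (k : fieldType) (W : vectType k)
    (beta : W -> W -> k) (H : completeNormedModType R[i])
    (dot : {dot H for Num.conj}) (rho : W * k -> H -> H) :
    set ('End(W) * (H -> H)) :=
  [set x | [/\ Sp beta x.1, unitary_op dot x.2
    & forall w t v, x.2 (rho (w, t) v) = rho (x.1 w, t) (x.2 v)]].

(* Such a subgroup is unique. *)
Definition is_Mp (R : realType) (k : fieldType) (W : vectType k)
    (beta : W -> W -> k) (H : completeNormedModType R[i])
    (dot : {dot H for Num.conj}) (rho : W * k -> H -> H)
    (Mp : set ('End(W) * (H -> H))) : Prop :=
  [/\ Mp `<=` Sp_hat beta dot rho,
      [/\ Mp (mp_one W H),
          forall x y, Mp x -> Mp y -> Mp (mp_mul x y)
        & forall x, Mp x -> exists2 y, Mp y & mp_mul x y = mp_one W H],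
      forall g, Sp beta g -> exists U, Mp (g, U)
    & ([set x | Mp x /\ x.1 = \1%VF] #= `I_2)%card].

Definition weil_rep (k : fieldType) (W : vectType k) (H : Type)
    (x : 'End(W) * (H -> H)) : H -> H := x.2.

(** * Linear algebraic groups and tori

   [K] is an algebraic closure of [k] and [iota] the inclusion. An algebraic
   group is given by its [K]-points. The coordinate ring of GL_n is generated
   by the entries and the inverse of the determinant. In characteristic 0, a
   subset defined by equations over [k] is defined over [k]. *)

Definition algebraic_closure (k : fieldType) (K : closedFieldType)
    (iota : {rmorphism k -> K}) : Prop :=
  forall x : K, algebraicOver iota x.

Definition GL_coord (K : fieldType) (n : nat) (A : 'M[K]_n) :
    'I_(n * n + 1) -> K :=
  fun i => row_mx (mxvec A) ((\det A)^-1)%:M 0 i.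

(* The value at [A] of a regular function on GL_n with coefficients in [F]. *)
Definition GL_eval (F K : fieldType) (iota : F -> K) (n : nat)
    (p : mpoly.mpoly (n * n + 1) F) (A : 'M[K]_n) : K :=
  mpoly.mmap iota (GL_coord A) p.

Definition lin_alg_group (k K : fieldType) (iota : k -> K) (n : nat)
    (G : set 'M[K]_n) : Prop :=
  (exists P : set (mpoly.mpoly (n * n + 1) k),
    G = [set A | A \in unitmx /\ forall p, P p -> GL_eval iota p A = 0]) /\
  [/\ G 1%:M, forall A B, G A -> G B -> G (A *m B)
    & forall A, G A -> G (invmx A)].

Definition regular_map (F K : fieldType) (iota : F -> K) (m n : nat)
    (G : set 'M[K]_m) (f : 'M[K]_m -> 'M[K]_n) : Prop :=
  exists q : 'I_n -> 'I_n -> mpoly.mpoly (m * m + 1) F,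
    forall A i j, G A -> f A i j = GL_eval iota (q i j) A.

(* Isomorphism of algebraic groups over [F]. *)
Definition alg_isom (F K : fieldType) (iota : F -> K) (m n : nat)
    (G : set 'M[K]_m) (G' : set 'M[K]_n) : Prop :=
  exists (f : 'M[K]_m -> 'M[K]_n) (f' : 'M[K]_n -> 'M[K]_m),
    [/\ regular_map iota G f, regular_map iota G' f',
        forall A, G A -> G' (f A) /\ f' (f A) = A,
        forall B, G' B -> G (f' B) /\ f (f' B) = B
      & forall A B, G A -> G B -> f (A *m B) = f A *m f B].

(* The r-th power of the multiplicative group. *)
Definition Gm_pow (K : fieldType) (r : nat) : set 'M[K]_r :=
  [set A | is_diag_mx A /\ A \in unitmx].

Definition is_torus (k K : fieldType) (iota : k -> K) (n : nat)
    (T : set 'M[K]_n) : Prop :=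
  lin_alg_group iota T /\ exists r, alg_isom (@idfun K) (@Gm_pow K r) T.

Definition is_split_torus (k K : fieldType) (iota : k -> K) (n : nat)
    (T : set 'M[K]_n) : Prop :=
  lin_alg_group iota T /\ exists r, alg_isom iota (@Gm_pow K r) T.

(* [passmx.mxof] acts on row vectors, hence the transpose. *)
Definition mx_of_end (k : fieldType) (W : vectType k) (g : 'End(W)) :
    'M[k]_(\dim {:W}) :=
  (passmx.mxof (vbasis {:W}) (vbasis {:W}) g)^T.

Definition end_of_mx (k : fieldType) (W : vectType k)
    (A : 'M[k]_(\dim {:W})) : 'End(W) :=
  passmx.hommx (vbasis {:W}) (vbasis {:W}) A^T.

Definition gram (k : fieldType) (W : vectType k) (beta : W -> W -> k) :
    'M[k]_(\dim {:W}) :=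
  \matrix_(i, j) beta (vbasis {:W})`_i (vbasis {:W})`_j.

Definition SpK (k K : fieldType) (iota : k -> K) (W : vectType k)
    (beta : W -> W -> k) : set 'M[K]_(\dim {:W}) :=
  [set A | A^T *m map_mx iota (gram beta) *m A = map_mx iota (gram beta)].

Definition Sp_torus (k K : fieldType) (iota : k -> K) (W : vectType k)
    (beta : W -> W -> k) (T : set 'M[K]_(\dim {:W})) : Prop :=
  is_torus iota T /\ T `<=` SpK iota beta.

Definition maximal_torus (k K : fieldType) (iota : k -> K) (W : vectType k)
    (beta : W -> W -> k) (T : set 'M[K]_(\dim {:W})) : Prop :=
  Sp_torus iota beta T /\
  forall T', Sp_torus iota beta T' -> T `<=` T' -> T' = T.

Definition elliptic_torus (k K : fieldType) (iota : k -> K) (W : vectType k)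
    (beta : W -> W -> k) (T : set 'M[K]_(\dim {:W})) : Prop :=
  forall S, is_split_torus iota S -> S `<=` T ->
    forall A B, S A -> SpK iota beta B -> A *m B = B *m A.

Definition kpoints (k K : fieldType) (iota : k -> K) (W : vectType k)
    (T : set 'M[K]_(\dim {:W})) : set 'End(W) :=
  [set g | T (map_mx iota (mx_of_end g))].

Definition mp_section (k : fieldType) (W : vectType k) (H : Type)
    (Mp : set ('End(W) * (H -> H))) (Tk : set 'End(W))
    (s : 'End(W) -> 'End(W) * (H -> H)) : Prop :=
  (forall g, Tk g -> Mp (s g) /\ (s g).1 = g) /\
  forall g h, Tk g -> Tk h -> s (g \o h)%VF = mp_mul (s g) (s h).

(** * Decomposition into characters *)

(* The values of [chi] outside [Tk] are irrelevant. *)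
Definition torus_character (R : realType) (k : nonarchLocalFieldType R)
    (W : vectType k) (Tk : set 'End(W)) (chi : 'End(W) -> R[i]^o) : Prop :=
  [/\ forall g h, Tk g -> Tk h -> chi (g \o h)%VF = chi g * chi h,
      forall g, Tk g -> `|chi g| = 1
    & {within [set A : 'M[k]_(\dim {:W}) | Tk (end_of_mx A)],
        continuous (fun A => chi (end_of_mx A))}].

Definition isotypic (R : realType) (k : fieldType) (W : vectType k)
    (H : completeNormedModType R[i]) (Tk : set 'End(W))
    (pi : 'End(W) -> H -> H) (chi : 'End(W) -> R[i]^o) : set H :=
  [set v | forall g, Tk g -> pi g v = chi g *: v].

Definition orthonormal_basis (R : realType) (H : completeNormedModType R[i])
    (dot : {dot H for Num.conj}) (I : Type) (e : I -> H) : Prop :=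
  [/\ forall i, dot (e i) (e i) = 1,
      forall i j, i <> j -> dot (e i) (e j) = 0
    & dense [set v : H | exists (s : seq I) (c : I -> R[i]),
                           v = \sum_(i <- s) c i *: e i]].

(* Hilbert direct sum of the lines spanned by the [e i]. *)
Definition direct_sum_of_characters (R : realType)
    (k : nonarchLocalFieldType R) (W : vectType k)
    (H : completeNormedModType R[i]) (dot : {dot H for Num.conj})
    (Tk : set 'End(W)) (pi : 'End(W) -> H -> H) : Prop :=
  exists (I : Type) (chi : I -> 'End(W) -> R[i]^o) (e : I -> H),
    [/\ forall i, torus_character Tk (chi i),
        orthonormal_basis dot e
      & forall i, isotypic Tk pi (chi i) (e i)].

(* Every character that occurs has a one-dimensional isotypic space. *)
Definition multiplicity_one (R : realType)
    (k : nonarchLocalFieldType R) (W : vectType k)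
    (H : completeNormedModType R[i])
    (Tk : set 'End(W)) (pi : 'End(W) -> H -> H) : Prop :=
  forall chi, torus_character Tk chi ->
    (exists2 v, isotypic Tk pi chi v & v != 0) ->
    exists2 v : H, v != 0 &
      isotypic Tk pi chi = [set w | exists a : R[i], w = a *: v].

(* Main.v *)
Require Import Defs.
From HB Require Import structures.
From mathcomp Require Import all_boot all_order all_algebra.
From mathcomp Require Import separable.
From mathcomp Require Import all_classical all_reals topology normedtype sequences.
From mathcomp Require Import complex ring lra.
From mathcomp Require mpoly.
Import (canonicals) mpoly.
Set Implicit Arguments.
Unset Strict Implicit.
Unset Printing Implicit Defensive.
Import Order.TTheory GRing.Theory Num.Theory.
Import numFieldNormedType.Exports.
Local Open Scope classical_set_scope.
Local Open Scope ring_scope.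

(** Over [k], the algebra centralizing the Lie algebra of [T] is commutative, [W] is free of
    rank one over it, and [T(k)] is its group of elements [g] with [g^* g = 1], where [^*] is
    the adjoint for the symplectic form. Ellipticity makes [b b^*] anisotropic; hence [T(k)]
    is compact, and [^*] transports to an antisymplectic involution [S] of [W] such that
    [S w] lies in the [T(k)]-orbit of [w] for every [w].

    For a small [T(k)]-stable lattice [L] with dual lattice [L^perp], the space [V] of the
    vectors fixed by [L] is finite dimensional and irreducible under [L^perp]. For two
    eigenvectors of [T(k)] in [V] with the same character the matrix coefficients are constant
    on [T(k)]-orbits, hence invariant under [S], and as [S] reverses the twisted convolution
    the two eigenvectors are proportional (Gelfand's trick). The elements of [T(k)] near 1 are
    products of commutators of symplectic elements near 1, whose lifts are scalar on [V];
    thus the section of the cover maps such an element to an operator of square 1 on [V],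
    and to 1 because the element has a square root near 1 in [T(k)]. So [T(k)] acts on [V]
    through a finite abelian quotient, and the spaces [V] exhaust a dense subspace. *)

(** * Tori as algebraic groups *)

(** [T] is known only through its [K]-points and an isomorphism with a power of the multiplicative
    group over [K], so a regular element of its Lie algebra is at first available over [K] only. It
    is brought down to [k] without Galois theory: its entries are expanded in powers of a primitive
    element, and the coefficients of the expansion are specialized to natural numbers in such a way
    that the eigenvalues stay distinct. Maximality of [T] identifies it with the symplectic
    centralizer of the resulting matrix [Y]. Ellipticity is used only on idempotents of the
    centralizer algebra: one that differs from its adjoint would produce a split torus that fails to
    commute with some transvection.

    The other obstacle is that the section is a bare homomorphism into a group without topology. The
    continuity of the characters has to be extracted from the group law; this is the purpose of the
    commutators. The oddness of [p] enters through [|2| = 1] and through the extraction of square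
    roots near 1. *)

Section GLCoord.
Variables (K : fieldType) (n : nat).

Lemma GL_coordE (A : 'M[K]_n) i j : GL_coord A (lshift 1 (mxvec_index i j)) = A i j.
Proof. by rewrite /GL_coord row_mxEl mxvecE. Qed.

Lemma GL_coord_det (A : 'M[K]_n) : GL_coord A (rshift (n * n) 0) = (\det A)^-1.
Proof. by rewrite /GL_coord row_mxEr mxE. Qed.

Lemma GL_coord_eq (A : 'M[K]_n) (c : 'I_(n * n + 1) -> K) :
    (forall i j, c (lshift 1 (mxvec_index i j)) = A i j) ->
    c (rshift (n * n) 0) = (\det A)^-1 -> GL_coord A = c.
Proof.
move=> cA cd; apply/funext => l.
rewrite -[l]splitK; case: (fintype.split l) => [l'|l'] /=.
  by case/mxvec_indexP: l' => i j; rewrite GL_coordE cA.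
by rewrite ord1 GL_coord_det.
Qed.

End GLCoord.

(** * Descent of points and of commuting matrices to the base field *)

Section PrimitiveElement.
Variables (k : fieldType) (K : closedFieldType) (iota : {rmorphism k -> K}).
Hypothesis k_char0 : [pchar k] =i pred0.
Hypothesis K_alg : algebraic_closure iota.

(** For algebraic [z] the image is the field [k(z)]. Its elements are carried as polynomials over
    [k], so that passing to a conjugate of [z] means evaluating the same polynomial at another
    root. *)
Definition evp (z : K) (g : {poly k}) : K := (map_poly iota g).[z].

Lemma evp_is_additive z : additive (evp z).
Proof. by move=> g h; rewrite /evp rmorphB hornerD hornerN. Qed.
Lemma evp_is_multiplicative z : multiplicative (evp z).
Proof.
by split=> [g h|]; rewrite /evp ?rmorphM ?hornerM// rmorph1 hornerC.
Qed.
HB.instance Definition _ z := GRing.isAdditive.Build _ _ (evp z) (evp_is_additive z).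
HB.instance Definition _ z :=
  GRing.isMultiplicative.Build _ _ (evp z) (evp_is_multiplicative z).

Lemma evpC z c : evp z c%:P = iota c.
Proof. by rewrite /evp map_polyC hornerC. Qed.

Lemma evp_comp z g h : evp z (g \Po h) = evp (evp z h) g.
Proof. by rewrite /evp map_comp_poly horner_comp. Qed.

Lemma primitive_element (s : seq K) :
  exists z, forall x, x \in s -> exists g, evp z g = x.
Proof.
elim: s => [|x s [z zP]]; first by exists 0.
have [p p0 px] := K_alg x; have [q q0 qz] := K_alg z.
have [n [[gx gxE] [gz gzE]]] := pchar0_PET q0 qz p0 px k_char0.
(* In terms of the new generator, [gx] expresses the former [z] and [gz] expresses [x]; earlier
   elements are reached by composing with [gx]. *)
exists (x *+ n - z) => y; rewrite inE => /orP[/eqP->|ys].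
  by exists gz.
have [g <-] := zP y ys; exists (g \Po gx).
by rewrite evp_comp; congr evp.
Qed.

(** This is the minimal polynomial of [z]. Its gcd [g] with its derivative splits [q = h * g]; by
    minimality [q] divides [h] or [g]. In the first case [g] is constant, in the second [q] divides
    its derivative, which is non-zero of smaller degree in characteristic 0. *)
Lemma minimal_annihilator z : exists q : {poly k},
  [/\ q != 0, evp z q = 0, forall g, evp z g = 0 -> q %| g & separable_poly q].
Proof.
have ex : exists m, `[< exists2 q : {poly k}, q != 0 /\ evp z q = 0 & size q = m >].
  have [q q0 /rootP qz] := K_alg z.
  by exists (size q); apply/asboolP; exists q.
case: (ex_minnP ex) => m /asboolP[q [q0 qz] sq] minm.
have qdiv g : evp z g = 0 -> q %| g.
  move=> gz; rewrite /dvdp; apply/negPn/negP => r0.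
  have rz : evp z (g %% q) = 0.
    by have := gz; rewrite {1}(divp_eq g q) rmorphD rmorphM /= qz mulr0 add0r.
  have : (m <= size (g %% q)%R)%N by apply: minm; apply/asboolP; exists (g %% q).
  by rewrite -sq leqNgt ltn_modp q0.
exists q; split=> //.
have sq_gt1 : (1 < size q)%N.
  rewrite ltnNge; apply/negP => /size1_polyC qC; move: qz q0.
  by rewrite qC evpC => /eqP; rewrite fmorph_eq0 polyC_eq0 => ->.
have q'0 : q^`() != 0.
  have := lead_coef_eq0 q; rewrite (negbTE q0) lead_coefE => /negbT lq.
  apply/eqP => /(congr1 (fun g : {poly k} => g`_((size q).-2))).
  rewrite coef_deriv coef0 prednK; last by case: (size q) sq_gt1 => [|[]].
  apply/eqP; rewrite -mulr_natr mulf_neq0 //.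
  rewrite ((pcharf0P _).1 k_char0) -lt0n; by case: (size q) sq_gt1 => [|[]].
rewrite unlock /= coprimep_def.
have [g gq gq'] : exists2 g, g = gcdp q q^`() & g %| q by exists (gcdp q q^`()); rewrite ?dvdp_gcdl.
have [h hE] := dvdpP _ _ gq'; rewrite -gq.
have := qz; rewrite hE rmorphM /= => /eqP; rewrite mulf_eq0 => /orP[/eqP|/eqP].
  move=> /qdiv /dvdp_leq.
  have h0 : h != 0 by apply/eqP => h0; move: q0; rewrite hE h0 mul0r eqxx.
  have g0 : g != 0 by apply/eqP => g0; move: q0; rewrite hE g0 mulr0 eqxx.
  move=> /(_ h0); rewrite {1}hE size_mul //.
  have := g0; rewrite -size_poly_gt0; move: (size g) => [//|[//|a]] _.
  by rewrite !addnS succnK ltnNge leq_addr.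
move=> /qdiv; rewrite gq => qg; have /dvdp_leq := dvdp_trans qg (dvdp_gcdr q q^`()).
by move=> /(_ q'0); rewrite leqNgt lt_size_deriv.
Qed.

Lemma minimal_annihilator_roots z (q : {poly k}) :
    q != 0 -> evp z q = 0 -> separable_poly q ->
  exists rs : seq K, [/\ uniq rs, size rs = (size q).-1 & forall x, x \in rs -> evp x q = 0].
Proof.
move=> q0 qz sq.
have q'0 : map_poly iota q != 0 by rewrite map_poly_eq0.
have [rs rsE] := closed_field_poly_normal (map_poly iota q).
have lc : lead_coef (map_poly iota q) != 0 by rewrite lead_coef_eq0.
exists rs; split.
- have : separable_poly (map_poly iota q) by rewrite separable_map.
  rewrite rsE -mul_polyC separable_mul => /and3P[_ + _].
  by rewrite separable_prod_XsubC.
- by rewrite -(size_map_poly iota) rsE size_scale // size_prod_XsubC.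
- move=> x xrs; rewrite /evp rsE hornerZ; apply/eqP; rewrite mulf_eq0.
  by apply/orP; right; rewrite -[_ == 0]/(root _ _) root_prod_XsubC.
Qed.

(** The bound on the sizes makes the polynomials [g i] unique, and [q] has as many roots as its
    degree; these two counts turn relations at [z] into relations between coefficients. *)
Lemma generated_coords N (c : 'I_N -> K) :
  exists (z : K) (q : {poly k}) (g : 'I_N -> {poly k}),
    [/\ q != 0, forall i, evp z (g i) = c i, forall i, (size (g i) < size q)%N,
        forall h, evp z h = 0 -> q %| h
      & exists rs : seq K, [/\ uniq rs, size rs = (size q).-1
                             & forall x, x \in rs -> evp x q = 0]].
Proof.
have [z zP] := primitive_element (codom c).
have [q [q0 qz qdiv sq]] := minimal_annihilator z.
have /(@boolp.choice _ _)[g gP] : forall i, exists h, evp z h = c i /\ (size h < size q)%N.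
  move=> i; have [h hE] := zP (c i) (codom_f c i); exists (h %% q); split.
    by rewrite -hE [in RHS](divp_eq h q) rmorphD rmorphM /= qz mulr0 add0r.
  by rewrite ltn_modp.
exists z, q, g; split=> //; try by move=> i; have [] := gP i.
exact: minimal_annihilator_roots qz sq.
Qed.

Lemma evp_dvd x (q h : {poly k}) : evp x q = 0 -> q %| h -> evp x h = 0.
Proof. by move=> qx /dvdpP[r ->]; rewrite rmorphM /= qx mulr0. Qed.

Section Points.
Variable n : nat.

Lemma GL_eval_evp (p : mpoly.mpoly (n * n + 1) k) (A : 'M[K]_n) z
    (g : 'I_(n * n + 1) -> {poly k}) :
  GL_coord A = evp z \o g -> GL_eval iota p A = evp z (mpoly.mmap (@polyC k) g p).
Proof.
move=> AE; rewrite /GL_eval AE /mpoly.mmap rmorph_sum; apply: eq_bigr => m _.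
rewrite rmorphM /= evpC; congr (_ * _).
by rewrite /mpoly.mmap1 rmorph_prod; apply: eq_bigr => i _; rewrite rmorphXn.
Qed.

(* A point of [T] has coordinates [g_i(z)] with [g_i] over [k]; the points with
   coordinates [g_i(x)], for the conjugates [x] of [z], again lie in [T]. *)
Lemma point_conjugates (T : set 'M[K]_n) (A : 'M[K]_n) :
    lin_alg_group iota T -> T A ->
  exists (z : K) (q : {poly k}) (MP : 'M[{poly k}]_n),
    [/\ map_mx (evp z) MP = A, forall i j, (size (MP i j) < size q)%N
      & exists rs : seq K, [/\ uniq rs, size rs = (size q).-1
                             & forall x, x \in rs -> T (map_mx (evp x) MP)]].
Proof.
move=> [[P TE] _] TA.
have [z [q [g [q0 gE gs qdiv [rs [urs srs rsq]]]]]] := generated_coords (GL_coord A).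
pose MP := \matrix_(i, j) g (lshift 1 (mxvec_index i j)).
have MPE : map_mx (evp z) MP = A by apply/matrixP => i j; rewrite !mxE gE GL_coordE.
exists z, q, MP; split=> //; first by move=> i j; rewrite mxE.
exists rs; split=> // x /rsq qx; move: TA; rewrite TE => -[Au PA].
(* Divisibility by [q] carries the relation between the determinant and its inverse, which holds at
   [z], over to the conjugate [x]. *)
have dx : evp x (\det MP * g (rshift (n * n) 0)) = 1.
  apply/eqP; rewrite -subr_eq0 -(rmorph1 (evp x)) -rmorphB /=; apply/eqP.
  apply: evp_dvd qx _; apply: qdiv; rewrite rmorphB rmorphM rmorph1 /= gE GL_coord_det.
  by rewrite -det_map_mx MPE divff ?subrr // -unitfE -unitmxE.
have dx' : \det (map_mx (evp x) MP) != 0.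
  apply/eqP => d0; move: dx; rewrite rmorphM /= -det_map_mx d0 mul0r => /esym/eqP.
  by rewrite oner_eq0.
split=> [|p Pp]; first by rewrite unitmxE unitfE.
rewrite (@GL_eval_evp p _ x g); last first.
  apply: GL_coord_eq => [i j|]; rewrite ?mxE //=.
  by apply: (mulfI dx'); rewrite divff // -dx rmorphM /= -det_map_mx.
apply: evp_dvd qx _; apply: qdiv; rewrite -(@GL_eval_evp p A z g) ?PA //.
by apply: GL_coord_eq => [i j|] /=; rewrite gE ?GL_coordE ?GL_coord_det.
Qed.

(** Two expansions are compared. The conjugates of a point [t] of [T] still commute with [Y], so [Y]
    commutes with each coefficient of [t] in powers of [z]. These coefficients are matrices over
    [k], so each coefficient [Z i] of [Y] in powers of [y] commutes with them as well. Skewness is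
    linear over [k] and passes to the [Z i] in the same way. *)
Lemma descent_commuting_skew (T : set 'M[K]_n) (J : 'M[k]_n) (Y : 'M[K]_n) :
    lin_alg_group iota T -> (forall t, T t -> Y *m t = t *m Y) ->
    Y^T *m map_mx iota J = - (map_mx iota J *m Y) ->
  exists N (c : 'I_N -> K) (Z : 'I_N -> 'M[k]_n),
    [/\ Y = \sum_i c i *: map_mx iota (Z i),
        forall i t, T t -> map_mx iota (Z i) *m t = t *m map_mx iota (Z i)
      & forall i, (Z i)^T *m J = - (J *m Z i)].
Proof.
move=> Tk YT Yskew.
have [y [q [g [q0 gE gs qdiv _]]]] := generated_coords (mxvec Y 0).
pose YP := \matrix_(i, j) g (mxvec_index i j).
have YPE : map_mx (evp y) YP = Y by apply/matrixP => i j; rewrite !mxE gE mxvecE.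
have sYP i j : (size (YP i j) < size q)%N by rewrite mxE.
have small (h : {poly k}) : (size h < size q)%N -> evp y h = 0 -> h = 0.
  move=> sh /qdiv /dvdp_leq; case: (eqVneq h 0) => // h0 /(_ isT).
  by rewrite leqNgt sh.
pose Z (i : 'I_(size q)) := map_mx (coefp i) YP.
have size_lin (C D : 'M[k]_n) i j :
    (size ((map_mx (@polyC k) C *m YP + YP *m map_mx (@polyC k) D) i j)%R < size q)%N.
  have lt0 : (0 < size q)%N by rewrite size_poly_gt0.
  have lt h : ((size (h : {poly k}) < size q) = (size h <= (size q).-1))%N.
    by case: (size q) lt0.
  rewrite !mxE lt; apply: leq_trans (size_polyD _ _) _; rewrite geq_max.
  apply/andP; split; apply: leq_trans (size_sum _ _ _) _; apply/bigmax_leqP => l _.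
    by rewrite !mxE mul_polyC; apply: leq_trans (size_scale_leq _ _) _; rewrite -lt.
  by rewrite !mxE mulrC mul_polyC; apply: leq_trans (size_scale_leq _ _) _; rewrite -lt.
have evC x (C : 'M[k]_n) : map_mx (evp x) (map_mx (@polyC k) C) = map_mx iota C.
  by apply/matrixP => i j; rewrite !mxE evpC.
(* Multiplication by constant matrices does not raise degrees, so a relation that holds at [y] holds
   identically in the polynomial matrix [YP]. *)
have lin0 (C D : 'M[k]_n) : map_mx iota C *m Y + Y *m map_mx iota D = 0 ->
    forall i, C *m Z i + Z i *m D = 0.
  move=> CD0 i; have P0 : map_mx (@polyC k) C *m YP + YP *m map_mx (@polyC k) D = 0.
    apply/matrixP => a b; rewrite [RHS]mxE; apply: small (size_lin _ _ _ _) _.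
    have /matrixP/(_ a b) := CD0.
    by rewrite -{1 2}YPE -!(evC y) -!map_mxM -map_mxD !mxE.
  apply/matrixP => a b; have /matrixP/(_ a b)/(congr1 (coefp i)) := P0.
  rewrite !mxE /= coefD !coef_sum coef0 => eq0; rewrite -[RHS]eq0.
  by congr (_ + _); apply: eq_bigr => l _; rewrite !mxE ?coefCM ?coefMC.
exists (size q), (fun i => y ^+ i), Z; split.
- apply/matrixP => i j; rewrite -{1}YPE mxE summxE /evp.
  rewrite (@horner_coef_wide _ (size q)); last by rewrite size_map_poly ltnW.
  by apply: eq_bigr => l _; rewrite !mxE coef_map mulrC.
- move=> i t Tt; have [z [r [MP [MPE sMP [rs [urs srs rsT]]]]]] := point_conjugates Tk Tt.
  pose f (l : nat) := map_mx (coefp l) MP.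
  have evf x : map_mx (evp x) MP = \sum_(l < size r) x ^+ l *: map_mx iota (f l).
    apply/matrixP => a b; rewrite mxE summxE /evp.
    rewrite (@horner_coef_wide _ (size r)); last by rewrite size_map_poly ltnW.
    by apply: eq_bigr => l _; rewrite !mxE coef_map mulrC.
  have Yf (l : 'I_(size r)) : Y *m map_mx iota (f l) = map_mx iota (f l) *m Y.
    apply/matrixP => a b; apply/eqP; rewrite -subr_eq0; apply/eqP.
    pose D l := (Y *m map_mx iota (f l)) a b - (map_mx iota (f l) *m Y) a b.
    (* The entries of [MP] have size less than [size r], so the last of the [size r] coefficients
       vanishes. Hence [h] has at most as many coefficients as there are conjugates, and it vanishes
       at all of them. *)
    pose h := \poly_(l < (size r).-1) D l.
    have Dbig l' : ((size r).-1 <= l')%N -> D l' = 0.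
      move=> ll'; rewrite /D; suff -> : f l' = 0 by rewrite map_mx0 mulmx0 mul0mx !mxE subrr.
      apply/matrixP => a' b'; rewrite !mxE /= nth_default //.
      by have := sMP a' b'; case: (size r) ll' => // m /= ll'; rewrite ltnS => /leq_trans; apply.
    suff h0 : h = 0.
      case: (ltnP l (size r).-1) => [ll|/Dbig //].
      by have := congr1 (fun p : {poly K} => p`_l) h0; rewrite coef_poly ll coef0.
    apply: (@roots_geq_poly_eq0 _ _ rs) => //; last by rewrite srs size_poly.
    apply/allP => x xrs; apply/rootP.
    have := YT _ (rsT x xrs); rewrite evf mulmx_suml mulmx_sumr => /matrixP/(_ a b)/eqP.
    rewrite !summxE -subr_eq0 -sumrB => /eqP eq0; rewrite -[RHS]eq0.
    rewrite horner_poly.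
    have -> : \sum_(l0 < (size r).-1) D l0 * x ^+ l0 = \sum_(l0 < size r) D l0 * x ^+ l0.
      rewrite (big_ord_widen (size r) (fun l0 => D l0 * x ^+ l0)) ?leq_pred //.
      rewrite [RHS](bigID (fun l0 : 'I__ => (l0 < (size r).-1)%N)) /= [X in _ + X]big1 ?addr0 //.
      by move=> l0; rewrite -leqNgt => /Dbig ->; rewrite mul0r.
    apply: eq_bigr => l0 _; rewrite /D mulrBl -scalemxAr -scalemxAl !mxE.
    by rewrite ![_ * x ^+ _]mulrC.
  have Zf (l : 'I_(size r)) : Z i *m f l = f l *m Z i.
    have /lin0/(_ i)/eqP : map_mx iota (- f l) *m Y + Y *m map_mx iota (f l) = 0.
      by rewrite map_mxN mulNmx Yf addNr.
    by rewrite mulNmx addrC subr_eq0 => /eqP.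
  rewrite -MPE evf mulmx_suml mulmx_sumr; apply: eq_bigr => l _.
  by rewrite -scalemxAr -scalemxAl -!map_mxM Zf.
(* The transpose keeps this relation outside the form of [lin0], so the degree argument is
   repeated. *)
- move=> i; have skewP : YP^T *m map_mx (@polyC k) J = - (map_mx (@polyC k) J *m YP).
    apply/eqP; rewrite -subr_eq0 opprK; apply/eqP/matrixP => a b; rewrite [RHS]mxE.
    apply: small; last first.
      have /eqP := Yskew; rewrite -subr_eq0 opprK => /eqP/matrixP/(_ a b).
      by rewrite -{1 2}YPE -!(evC y) map_trmx -!map_mxM -map_mxD !mxE.
    have lt0 : (0 < size q)%N by rewrite size_poly_gt0.
    have lt h : ((size (h : {poly k}) < size q) = (size h <= (size q).-1))%N.
      by case: (size q) lt0.
    rewrite !mxE lt; apply: leq_trans (size_polyD _ _) _; rewrite geq_max.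
    apply/andP; split; apply: leq_trans (size_sum _ _ _) _; apply/bigmax_leqP => l _.
      by rewrite !mxE mulrC mul_polyC; apply: leq_trans (size_scale_leq _ _) _; rewrite -lt.
    by rewrite !mxE mul_polyC; apply: leq_trans (size_scale_leq _ _) _; rewrite -lt.
  apply/matrixP => a b; have /matrixP/(_ a b)/(congr1 (coefp i)) := skewP.
  rewrite !mxE /= coefN !coef_sum => eqab.
  transitivity (\sum_j ((YP^T a j * map_mx polyC J j b)%R)`_i).
    by apply: eq_bigr => l _; rewrite !mxE coefMC.
  by rewrite eqab; congr (- _); apply: eq_bigr => l _; rewrite !mxE coefCM.
Qed.

End Points.
End PrimitiveElement.

Lemma char0_poly_nonroot (F : fieldType) (p : {poly F}) :
  [pchar F] =i pred0 -> p != 0 -> exists m, p.[m%:R] != 0.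
Proof.
move=> /pcharf0P F0 p0; apply: contrapT => /forallNP pz.
suff : (size (mkseq (fun m => m%:R : F) (size p)) < size p)%N by rewrite size_mkseq ltnn.
apply: max_poly_roots => //.
  by apply/allP => x /mapP[m _ ->]; apply/negPn/negP/pz.
apply/mkseq_uniqP => a b _ _ /eqP; wlog ab : a b / (a <= b)%N.
  by move=> h; case/orP: (leq_total a b) => [/h//|/h]; rewrite eq_sym => h' /h'.
by rewrite eq_sym -subr_eq0 -natrB // F0 subn_eq0 => ba; apply/anti_leq; rewrite ab.
Qed.

(** * Specialization of coefficients and distinct eigenvalues *)

Section Generic.
Variables (k K : fieldType) (iota : {rmorphism k -> K}).
Hypothesis k_char0 : [pchar k] =i pred0.

(** Dependence along affine lines suffices when coefficients are specialized one at a time; no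
    polynomial in several variables is needed. *)
Definition poly_on_lines m n (F : 'M[K]_(m, n) -> K) : Prop :=
  forall A B, exists p : {poly K}, forall c, F (A + c *: B) = p.[c].

Lemma iota_char0 : [pchar K] =i pred0.
Proof. by move=> p; rewrite (fmorph_pchar iota). Qed.

(** In the direction of one [Z i] the function is a non-zero polynomial, hence non-zero at some
    natural number, which replaces [c i]. In the induction, [A] collects the coefficients already
    replaced. *)
Lemma generic_point m n (F : 'M[K]_(m, n) -> K) N (c : 'I_N -> K)
    (Z : 'I_N -> 'M[k]_(m, n)) :
    poly_on_lines F -> F (\sum_i c i *: map_mx iota (Z i)) != 0 ->
  exists d : 'I_N -> k, F (map_mx iota (\sum_i d i *: Z i)) != 0.
Proof.
move=> Fpoly FZ.
suff gen A : F (A + \sum_i c i *: map_mx iota (Z i)) != 0 ->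
    exists d : 'I_N -> k, F (A + map_mx iota (\sum_i d i *: Z i)) != 0.
  by have [|d] := gen 0; rewrite add0r //; exists d.
elim: N c Z A {FZ} => [|N IH] c Z A.
  by rewrite big_ord0 => FA; exists (fun=> 0); rewrite big_ord0 map_mx0.
rewrite big_ord_recl addrCA addrC => FA.
have [p pE] := Fpoly (A + \sum_(i < N) c (lift ord0 i) *: map_mx iota (Z (lift ord0 i)))
                     (map_mx iota (Z ord0)).
have p0 : p != 0 by apply/eqP => p0; move: FA; rewrite pE p0 horner0 eqxx.
have [a pa] := char0_poly_nonroot iota_char0 p0.
move: pa; rewrite -pE addrAC => /IH[d Fd].
exists (fun i => if unlift ord0 i is Some j then d j else a%:R).
rewrite big_ord_recl unlift_none.
rewrite (eq_bigr (fun i => d i *: Z (lift ord0 i))); last by move=> i _; rewrite liftK.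
by rewrite map_mxD map_mxZ rmorph_nat addrA.
Qed.

End Generic.

Section SeparableChar.
Variable F : fieldType.

(** Up to sign this is the discriminant of the characteristic polynomial: the product of the values
    of its derivative at the eigenvalues. As a determinant it is visibly polynomial in the
    entries. *)
Definition mxdisc (R : comNzRingType) n (A : 'M[R]_n.+1) : R :=
  \det (horner_mx A (char_poly A)^`()).

Lemma map_mxdisc (R S : comNzRingType) (f : {rmorphism R -> S}) n (A : 'M[R]_n.+1) :
  f (mxdisc A) = mxdisc (map_mx f A).
Proof. by rewrite /mxdisc -det_map_mx map_horner_mx -deriv_map map_char_poly. Qed.

Lemma mxdisc_poly n : @poly_on_lines F _ _ (@mxdisc F n).
Proof.
move=> A B; exists (mxdisc (map_mx polyC A + 'X *: map_mx polyC B)) => c.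
rewrite -[RHS]/(horner_eval c _) map_mxdisc; congr mxdisc.
by apply/matrixP => i j; rewrite !mxE /= /horner_eval !hornerE.
Qed.

(** By Cayley-Hamilton, a Bezout relation between the characteristic polynomial and its derivative
    exhibits an inverse of the derivative evaluated at [A]. *)
Lemma separable_mxdisc n (A : 'M[F]_n.+1) :
  separable_poly (char_poly A) -> mxdisc A != 0.
Proof.
rewrite unlock /= => /Bezout_eq1_coprimepP[[u v] /= uv].
have : horner_mx A (u * char_poly A + v * (char_poly A)^`()) = 1 by rewrite uv rmorph1.
rewrite rmorphD !rmorphM /= Cayley_Hamilton mulr0 add0r => /(congr1 determinant).
rewrite det_mulmx det1 => d1; apply/eqP => d0; move: d1; rewrite /mxdisc in d0.
by rewrite d0 mulr0 => /eqP; rewrite eq_sym oner_eq0.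
Qed.

End SeparableChar.

(** A common root would be an eigenvalue, and its eigenvector would be killed by the derivative
    evaluated at [A]. *)
Lemma mxdisc_separable (K : closedFieldType) n (A : 'M[K]_n.+1) :
  mxdisc A != 0 -> separable_poly (char_poly A).
Proof.
move=> dA; rewrite unlock /=; apply/negPn/negP => ncop; move/negP: dA; apply.
set p := char_poly A in ncop *.
have p0 : p != 0 by rewrite monic_neq0 // char_poly_monic.
have /closed_rootP[x] : size (gcdp p p^`()) != 1 by rewrite -coprimep_def.
rewrite root_gcd => /andP[px p'x].
have : eigenvalue A x by rewrite eigenvalue_root_char.
case/eigenvalueP => v vA v0; rewrite /mxdisc.
have vq (q : {poly K}) : v *m horner_mx A q = q.[x] *: v.
  elim/poly_ind: q => [|q c IH]; first by rewrite rmorph0 mulmx0 horner0 scale0r.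
  rewrite rmorphD rmorphM /= horner_mx_X horner_mx_C mulmxDr mulmxA IH -scalemxAl vA.
  by rewrite scalerA mul_mx_scalar !hornerE scalerDl.
apply/det0P; exists v => //; rewrite vq.
by rewrite (rootP p'x) scale0r.
Qed.

Lemma char_poly_conj (F : fieldType) n (P A : 'M[F]_n) :
  P \in unitmx -> char_poly (P *m A *m invmx P) = char_poly A.
Proof.
move=> Pu; rewrite /char_poly.
have -> : char_poly_mx (P *m A *m invmx P) =
    map_mx polyC P *m char_poly_mx A *m map_mx polyC (invmx P).
  rewrite /char_poly_mx mulmxBr mulmxBl -!map_mxM; congr (_ - _).
  by rewrite scalar_mxC -mulmxA -map_mxM mulmxV // map_mx1 mulmx1.
rewrite !det_mulmx mulrC mulrA -det_mulmx -map_mxM mulVmx //.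
by rewrite map_mx1 det1 mul1r.
Qed.

Lemma char_poly_diag (F : fieldType) n (d : 'rV[F]_n) :
  char_poly (diag_mx d) = \prod_(i < n) ('X - (d 0 i)%:P).
Proof.
rewrite char_poly_trig ?diag_mx_is_trig //.
by apply: eq_bigr => i _; rewrite mxE eqxx.
Qed.

Lemma separable_char_poly_diag (F : fieldType) n (P : 'M[F]_n) (d : 'rV[F]_n) :
  P \in unitmx ->
  separable_poly (char_poly (P *m diag_mx d *m invmx P)) = injectiveb (d 0).
Proof.
move=> Pu; rewrite char_poly_conj // char_poly_diag.
transitivity (separable_poly (\prod_(x <- [seq d 0 i | i <- enum 'I_n]) ('X - x%:P))).
  by rewrite big_map big_enum.
by rewrite separable_prod_XsubC.
Qed.

Lemma generic_separable (k : fieldType) (K : closedFieldType)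
    (iota : {rmorphism k -> K}) n N (c : 'I_N -> K) (Z : 'I_N -> 'M[k]_n) :
    [pchar k] =i pred0 ->
    separable_poly (char_poly (\sum_i c i *: map_mx iota (Z i))) ->
  exists d : 'I_N -> k, separable_poly (char_poly (\sum_i d i *: Z i)).
Proof.
move=> k0; case: n Z => [|n] Z; last first.
  move=> /separable_mxdisc /(generic_point k0 (@mxdisc_poly _ _))[d].
  by move/mxdisc_separable; rewrite -map_char_poly separable_map; exists d.
move=> _; exists (fun=> 0); rewrite [X in char_poly X]flatmx0 /char_poly.
by rewrite det_mx00 unlock /= coprime1p.
Qed.

Lemma separable_eigenbasis (K : closedFieldType) n (A : 'M[K]_n) :
    separable_poly (char_poly A) ->
  exists2 P, P \in unitmx & exists d, A *m P = P *m diag_mx d.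
Proof.
case: n A => [|n] A; first by exists 1%:M; rewrite ?unitmx1 //; exists 0; apply/matrixP => -[].
move=> sA; have [rs rsE] := closed_field_poly_normal (char_poly A).
have mo : lead_coef (char_poly A) = 1 by apply/eqP/char_poly_monic.
move: rsE; rewrite mo scale1r => rsE.
have urs : uniq rs by rewrite -separable_prod_XsubC -rsE.
have [P Pu] : exists2 P : 'M_n.+1, P \in unitmx & similar_diag P A.
  by apply/diagonalizableP; exists rs => //; rewrite -rsE mxminpoly_dvd_char.
case/(similar_diagLR Pu) => d Ad; exists (invmx P); rewrite ?unitmx_inv //; exists d.
by rewrite Ad conjVmx // mulmxK.
Qed.

(** * Symplectic bases of joint eigenvectors *)

Section Darboux.
Variables (K : fieldType) (n : nat) (J : 'M[K]_n) (F : set 'M[K]_n).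
Hypothesis two_neq0 : 2%:R != 0 :> K.
Hypothesis Jskew : J^T = - J.
Hypothesis Junit : J \in unitmx.
Hypothesis Fadj : forall t, F t -> exists2 t', F t' & t^T *m J = J *m t'.

Definition eigencolumns r (V : 'M[K]_(n, r)) :=
  forall t, F t -> exists d, t *m V = V *m diag_mx d.

Definition isotropic_pair r (V V' : 'M[K]_(n, r)) :=
  [/\ V^T *m J *m V = 0, V'^T *m J *m V' = 0, V^T *m J *m V' = 1%:M,
      eigencolumns V & eigencolumns V'].

Lemma isotropic_pair_sym r (V V' : 'M[K]_(n, r)) :
  V^T *m J *m V' = 1%:M -> V'^T *m J *m V = - 1%:M.
Proof.
move=> /(congr1 trmx); rewrite !trmx_mul trmxK trmx1 Jskew => h.
by rewrite -h mulNmx mulmxN opprK mulmxA.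
Qed.

Lemma skew_swap r (u : 'M[K]_(n, 1)) (V : 'M[K]_(n, r)) :
  V^T *m J *m u = 0 -> u^T *m J *m V = 0.
Proof.
move=> /(congr1 trmx); rewrite !trmx_mul trmxK trmx0 Jskew mulNmx mulmxN.
by move=> /eqP; rewrite oppr_eq0 mulmxA => /eqP.
Qed.

Lemma skew_self (u : 'cV[K]_n) : u^T *m J *m u = 0.
Proof.
have : (u^T *m J *m u)^T = - (u^T *m J *m u).
  by rewrite !trmx_mul trmxK Jskew mulNmx mulmxN mulmxA.
move=> /matrixP/(_ 0 0); rewrite [LHS]mxE [RHS]mxE => /eqP.
rewrite -subr_eq0 opprK -mulr2n -mulr_natl mulf_eq0 (negbTE two_neq0) /= => /eqP h.
by apply/matrixP => i j; rewrite !ord1 h mxE.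
Qed.

(* Symplectic Gram-Schmidt within the joint eigenspaces: the complement of a
   maximal isotropic pair of eigenvectors is stable, hence contains a further
   pair unless it is zero. *)
Lemma darboux_eigenbasis (P : 'M[K]_n) : P \in unitmx -> eigencolumns P ->
  exists r (V V' : 'M[K]_(n, r)), n = (r + r)%N /\ isotropic_pair V V'.
Proof.
move=> Pu Peig.
have ex : exists r, `[< exists V V' : 'M[K]_(n, r), isotropic_pair V V' >].
  exists 0%N; apply/asboolP; exists 0, 0.
  have eig0 : eigencolumns (0 : 'M[K]_(n, 0)) by move=> t Ft; exists 0; rewrite mulmx0 mul0mx.
  by split=> //; apply/matrixP => -[].
have bd r (V V' : 'M[K]_(n, r)) : isotropic_pair V V' -> (r <= n)%N.
  by case=> _ _ VV' _ _; rewrite -(mxrank1 K r) -VV'; apply: mulmx_max_rank.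
have exbd r : `[< exists V V' : 'M[K]_(n, r), isotropic_pair V V' >] -> (r <= n)%N.
  by move=> /asboolP[V [V' /bd]].
case: (ex_maxnP ex exbd) => r /asboolP[V [V' VVP]] rmax {ex exbd}.
have [V0 V'0 VV' Ve V'e] := VVP.
have V'V := isotropic_pair_sym VV'.
exists r, V, V'; split=> //.
(* The projection onto the orthogonal complement of the columns of [V] and [V'], which form
   hyperbolic pairs. *)
pose Pi := 1%:M + V *m (V'^T *m J) - V' *m (V^T *m J).
have VPi : V^T *m J *m Pi = 0.
  rewrite /Pi mulmxBr mulmxDr mulmx1 !mulmxA.
  by rewrite V0 VV' mul1mx !mul0mx addr0 subrr.
have V'Pi : V'^T *m J *m Pi = 0.
  rewrite /Pi mulmxBr mulmxDr mulmx1 !mulmxA V'0 V'V.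
  by rewrite mulNmx mul1mx mulNmx !mul0mx subr0 subrr.
have PiT t : F t -> Pi *m t = t *m Pi.
  move=> Ft; have [t' Ft' tt'] := Fadj Ft.
  have Jt : J *m t = t'^T *m J.
    by have /(congr1 trmx) := tt'; rewrite !trmx_mul trmxK Jskew mulNmx mulmxN => /oppr_inj.
  have [d td] := Ve t Ft; have [d' td'] := V'e t Ft.
  have [e te] := Ve t' Ft'; have [e' te'] := V'e t' Ft'.
  have VJt : V^T *m J *m t = diag_mx e *m V^T *m J.
    by rewrite -mulmxA Jt mulmxA -trmx_mul te trmx_mul tr_diag_mx.
  have V'Jt : V'^T *m J *m t = diag_mx e' *m V'^T *m J.
    by rewrite -mulmxA Jt mulmxA -trmx_mul te' trmx_mul tr_diag_mx.
  (* Pairing [V] with [V'] shows that the adjoint [t'] has on [V] the eigenvalues that [t] has on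
     [V'], and conversely; this is what makes the projection commute with [t]. *)
  have ed' : diag_mx e = diag_mx d'.
    have : V^T *m J *m t *m V' = V^T *m J *m (t *m V') by rewrite !mulmxA.
    by rewrite VJt td' mulmxA VV' mul1mx -!mulmxA (mulmxA _ J) VV' mulmx1.
  have e'd : diag_mx e' = diag_mx d.
    have : V'^T *m J *m t *m V = V'^T *m J *m (t *m V) by rewrite !mulmxA.
    rewrite V'Jt td mulmxA V'V mulNmx mul1mx -!mulmxA (mulmxA _ J) V'V mulmxN mulmx1.
    by move/oppr_inj.
  rewrite /Pi mulmxBr mulmxBl mulmxDl mulmxDr mulmx1 mul1mx; congr (_ + _ - _).
    by rewrite -mulmxA V'Jt e'd [RHS]mulmxA td !mulmxA.
  by rewrite -mulmxA VJt ed' [RHS]mulmxA td' !mulmxA.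
have Pieig i : eigencolumns (Pi *m col i P).
  move=> t Ft; have [d td] := Peig t Ft; exists (const_mx (d 0 i)).
  rewrite mulmxA -PiT // -!mulmxA; congr (Pi *m _).
  have -> : t *m col i P = col i (t *m P) by rewrite !colE mulmxA.
  rewrite td; apply/matrixP => a b; rewrite !mxE !big_ord1 !mxE.
  rewrite (bigD1 i) //= big1 => [|j ji]; last by rewrite !mxE (negbTE ji) mulr0.
  by rewrite (ord1 b) !mxE !eqxx addr0 mulr1n.
(* When the projection vanishes, the identity of size [n] factors through dimension [r + r];
   conversely the pairing matrix, of rank [r + r], factors through dimension [n]. *)
suff Pi0 : Pi = 0.
  apply/eqP; rewrite eqn_leq; apply/andP; split.
    have : 1%:M = row_mx V' (- V) *m col_mx (V^T *m J) (V'^T *m J).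
      rewrite mul_row_col mulNmx; apply/eqP; rewrite -subr_eq0 opprD opprK addrA.
      by rewrite addrAC -/Pi Pi0.
    by move/(congr1 mxrank); rewrite mxrank1 => ->; apply: mulmx_max_rank.
  have : col_mx (V^T *m J) (- (V'^T *m J)) *m row_mx V' V = 1%:M.
    by rewrite mul_col_row !mulNmx VV' V0 V'0 V'V oppr0 opprK -scalar_mx_block.
  by move/(congr1 mxrank); rewrite mxrank1 => <-; apply: mulmx_max_rank.
apply: contrapT => /eqP Pi0.
have [i Pii] : exists i, Pi *m col i P != 0.
  apply: contrapT => /forallNP h; move/eqP: Pi0; apply.
  rewrite -[Pi](mulmxK Pu); suff -> : Pi *m P = 0 by rewrite mul0mx.
  apply/matrixP => a i; have := h i => /negP/negPn/eqP/matrixP/(_ a 0).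
  have -> : (Pi *m P) a i = (Pi *m col i P) a 0.
    by rewrite [LHS]mxE [RHS]mxE; apply: eq_bigr => j _; rewrite [col i P j 0]mxE.
  by move=> ->; rewrite !mxE.
pose w := Pi *m col i P.
have Vw : V^T *m J *m w = 0 by rewrite mulmxA VPi mul0mx.
have V'w : V'^T *m J *m w = 0 by rewrite mulmxA V'Pi mul0mx.
(* Non-degeneracy of [J] provides a partner of [w], again among the projected eigenvectors; after
   rescaling, the two extend the maximal pair. *)
have [j wj] : exists j, w^T *m J *m (Pi *m col j P) != 0.
  apply: contrapT => /forallNP h; move/eqP: Pii; apply.
  rewrite -/w; apply: trmx_inj; rewrite trmx0.
  suff h0 : w^T *m J *m P = 0 by rewrite -[w^T](mulmxK Junit) -[w^T *m J](mulmxK Pu) h0 !mul0mx.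
  apply/matrixP => a l; have /negP/negPn/eqP := h l.
  rewrite mulmxA /Pi mulmxBr mulmxDr mulmx1 !mulmxA.
  rewrite (skew_swap Vw) (skew_swap V'w) !mul0mx addr0 subr0.
  have -> : (w^T *m J *m P) a l = (w^T *m J *m col l P) a 0.
    by rewrite [LHS]mxE [RHS]mxE; apply: eq_bigr => m _; rewrite [col l P m 0]mxE.
  by move=> /matrixP/(_ a 0) ->; rewrite !mxE.
pose c := (w^T *m J *m (Pi *m col j P)) 0 0.
have c0 : c != 0.
  by apply: contra wj => /eqP c0; apply/eqP/matrixP => a b; rewrite !ord1 [LHS]c0 mxE.
pose w' := c^-1 *: (Pi *m col j P).
have Vw' : V^T *m J *m w' = 0 by rewrite -scalemxAr mulmxA VPi mul0mx scaler0.
have V'w' : V'^T *m J *m w' = 0 by rewrite -scalemxAr mulmxA V'Pi mul0mx scaler0.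
have ww' : w^T *m J *m w' = 1%:M.
  rewrite -scalemxAr; apply/matrixP => a b; rewrite !ord1 [LHS]mxE -/c mulVf //.
  by rewrite mxE eqxx.
suff /rmax : `[< exists V V' : 'M[K]_(n, r + 1), isotropic_pair V V' >].
  by rewrite addn1 ltnn.
have row_eig (A : 'M[K]_(n, r)) (u : 'cV[K]_n) : eigencolumns A -> eigencolumns u ->
    eigencolumns (row_mx A u).
  move=> Ae ue t Ft; have [d td] := Ae t Ft; have [e te] := ue t Ft.
  exists (row_mx d e); rewrite mul_mx_row td te.
  by rewrite diag_mx_row mul_row_block !mulmx0 addr0 add0r.
apply/asboolP; exists (row_mx V w), (row_mx V' w'); split.
- by rewrite tr_row_mx mul_col_mx mul_col_row V0 Vw skew_swap // skew_self block_mx0.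
- by rewrite tr_row_mx mul_col_mx mul_col_row V'0 V'w' skew_swap // skew_self block_mx0.
- by rewrite tr_row_mx mul_col_mx mul_col_row VV' Vw' (skew_swap V'w) ww' -scalar_mx_block.
- by apply: row_eig => //; apply: Pieig.
- apply: row_eig => // t Ft; have [d td] := Pieig j t Ft; exists d.
  by rewrite -scalemxAr td -scalemxAl.
Qed.

End Darboux.

Section GenericMatrix.
Variables (F K : fieldType) (iota : {rmorphism F -> K}) (m : nat).
Local Notation MP := (mpoly.mpoly (m * m + 1) F).

(** The universal matrix. Regular maps are written as matrix expressions in it and evaluated through
    [map_mx], which avoids handling polynomials entry by entry. *)
Definition GLX : 'M[MP]_m :=
  \matrix_(i, j) mpoly.mpolyX F (mpoly.mnm1 (lshift 1 (mxvec_index i j))).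
Definition GLinvdet : MP := mpoly.mpolyX F (mpoly.mnm1 (rshift (m * m) 0)).
Definition GLC a b (A : 'M[F]_(a, b)) : 'M[MP]_(a, b) := map_mx (mpoly.mpolyC (m * m + 1) (R:=F)) A.

Lemma map_GLX (A : 'M[K]_m) : map_mx (mpoly.mmap iota (GL_coord A)) GLX = A.
Proof. by apply/matrixP => i j; rewrite !mxE mpoly.mmapX mpoly.mmap1U GL_coordE. Qed.

Lemma GL_eval_invdet (A : 'M[K]_m) : mpoly.mmap iota (GL_coord A) GLinvdet = (\det A)^-1.
Proof. by rewrite mpoly.mmapX mpoly.mmap1U GL_coord_det. Qed.

Lemma map_GLC (A : 'M[K]_m) a b (B : 'M[F]_(a, b)) :
  map_mx (mpoly.mmap iota (GL_coord A)) (GLC B) = map_mx iota B.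
Proof. by apply/matrixP => i j; rewrite !mxE mpoly.mmapC. Qed.

Lemma regular_mapP n (G : set 'M[K]_m) (f : 'M[K]_m -> 'M[K]_n) (Q : 'M[MP]_n) :
    (forall A, G A -> f A = map_mx (mpoly.mmap iota (GL_coord A)) Q) ->
  regular_map iota G f.
Proof. by move=> fQ; exists Q => A i j /fQ ->; rewrite mxE. Qed.

End GenericMatrix.

Definition sympl_centralizer (K : fieldType) n (J Y : 'M[K]_n) : set 'M[K]_n :=
  [set g | g *m Y = Y *m g /\ g^T *m J *m g = J].

Section Centralizer.
Variables (k K : fieldType) (iota : {rmorphism k -> K}) (n : nat) (J Y : 'M[k]_n).
Hypothesis Junit : J \in unitmx.

Lemma sympl_unitmx (F : fieldType) (J0 g : 'M[F]_n) :
  J0 \in unitmx -> g^T *m J0 *m g = J0 -> g \in unitmx.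
Proof. by move=> Ju gJ; have := Ju; rewrite -{1}gJ unitmx_mul => /andP[]. Qed.

Lemma sympl_inv (F : fieldType) (J0 g : 'M[F]_n) :
  J0 \in unitmx -> g^T *m J0 *m g = J0 -> (invmx g)^T *m J0 *m invmx g = J0.
Proof.
move=> Ju gJ; have gu := sympl_unitmx Ju gJ.
by rewrite -{1}gJ trmx_inv !mulmxA mulVmx ?unitmx_tr // mul1mx mulmxK.
Qed.

Lemma sympl_centralizer_lin_alg_group :
  lin_alg_group iota (sympl_centralizer (map_mx iota J) (map_mx iota Y)).
Proof.
have JKu : map_mx iota J \in unitmx by rewrite map_unitmx.
pose P1 : 'M[mpoly.mpoly (n * n + 1) k]_n := GLX k n *m GLC n Y - GLC n Y *m GLX k n.
pose P2 : 'M[mpoly.mpoly (n * n + 1) k]_n := (GLX k n)^T *m GLC n J *m GLX k n - GLC n J.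
have P1E A : map_mx (mpoly.mmap iota (GL_coord A)) P1 =
    A *m map_mx iota Y - map_mx iota Y *m A by rewrite map_mxB !map_mxM map_GLX map_GLC.
have P2E A : map_mx (mpoly.mmap iota (GL_coord A)) P2 =
    A^T *m map_mx iota J *m A - map_mx iota J.
  by rewrite map_mxB !map_mxM -map_trmx map_GLX map_GLC.
split; last split.
- exists [set q : mpoly.mpoly (n * n + 1) k | exists i j, q = P1 i j \/
                              q = P2 i j].
  apply/seteqP; split=> A.
    move=> [AY AJ]; split; first exact: sympl_unitmx JKu AJ.
    move=> q [i [j []]] ->; rewrite /GL_eval.
      by have /matrixP/(_ i j) := P1E A; rewrite AY subrr [LHS]mxE [RHS]mxE.
    by have /matrixP/(_ i j) := P2E A; rewrite AJ subrr [LHS]mxE [RHS]mxE.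
  move=> [Au Aq]; split; apply/eqP; rewrite -subr_eq0; apply/eqP.
    rewrite -P1E; apply/matrixP => i j; rewrite [LHS]mxE [RHS]mxE.
    by apply: Aq; exists i, j; left.
  rewrite -P2E; apply/matrixP => i j; rewrite [LHS]mxE [RHS]mxE.
  by apply: Aq; exists i, j; right.
- by split; rewrite ?mulmx1 ?mul1mx // trmx1 mul1mx.
- move=> A B [AY AJ] [BY BJ]; split; first by rewrite -mulmxA BY mulmxA AY mulmxA.
  by rewrite trmx_mul !mulmxA -(mulmxA B^T) -(mulmxA B^T) AJ BJ.
- move=> A [AY AJ]; split; last exact: sympl_inv.
  have Au := sympl_unitmx JKu AJ.
  by rewrite -[LHS](mulmxK Au) -(mulmxA (invmx A)) -AY mulKmx.
Qed.

End Centralizer.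

(** * Centralizers of regular elements and diagonalization of tori *)

Section CentralizerTorus.
Variables (K : closedFieldType) (r : nat) (J Y Q : 'M[K]_(r + r)) (dd : 'rV[K]_(r + r)).
Hypothesis Qunit : Q \in unitmx.
Hypothesis QJ : Q^T *m J *m Q = block_mx 0 1%:M (- 1%:M) 0.
Hypothesis YQ : Y *m Q = Q *m diag_mx dd.
Hypothesis dd_inj : injective (dd 0).

Definition torus_point (e : 'rV[K]_r) : 'M[K]_(r + r) :=
  Q *m diag_mx (row_mx e (map_mx GRing.inv e)) *m invmx Q.

Lemma diag_inv (e : 'rV[K]_r) : (forall i, e 0 i != 0) ->
  diag_mx e *m diag_mx (map_mx GRing.inv e) = 1%:M.
Proof.
move=> e0; rewrite mulmx_diag; apply/matrixP => i j; rewrite !mxE.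
by rewrite divff.
Qed.

(** The eigenvalues of [Y] being distinct, what commutes with [Y] is diagonal in the basis [Q]; the
    symplectic condition then makes the eigenvalues at a vector and at its partner inverse to each
    other. *)
Lemma sympl_centralizerP g : sympl_centralizer J Y g <->
  exists2 e : 'rV[K]_r, (forall i, e 0 i != 0) & g = torus_point e.
Proof.
have JE : J = (invmx Q)^T *m block_mx 0 1%:M (- 1%:M) 0 *m invmx Q.
  by rewrite -QJ trmx_inv !mulmxA mulVmx ?unitmx_tr // mul1mx mulmxK.
have YE : Y = Q *m diag_mx dd *m invmx Q by rewrite -YQ mulmxK.
split=> [[gY gJ]|[e e0 ->]].
  pose h := invmx Q *m g *m Q.
  have hd : h *m diag_mx dd = diag_mx dd *m h.
    rewrite /h -!mulmxA -YQ (mulmxA g) gY -(mulmxA Y) (mulmxA Y) YE -!mulmxA.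
    by rewrite mulKmx.
  have /diag_mxP[e' hE] : is_diag_mx h.
    apply/is_diag_mxP => i j ij; have /matrixP/(_ i j) := hd.
    rewrite mul_mx_diag mul_diag_mx !mxE mulrC => /eqP.
    rewrite -subr_eq0 -mulrBl mulf_eq0 subr_eq0 => /orP[/eqP/dd_inj ji|/eqP->//].
    by rewrite ji eqxx in ij.
  have gE : g = Q *m h *m invmx Q by rewrite /h !mulmxA mulmxV // mul1mx mulmxK.
  have hJ : h^T *m block_mx 0 1%:M (- 1%:M) 0 *m h = block_mx 0 1%:M (- 1%:M) 0.
    rewrite -QJ /h !trmx_mul trmx_inv !mulmxA.
    rewrite -(mulmxA _ (invmx Q^T)) mulVmx ?unitmx_tr // mulmx1.
    rewrite -(mulmxA _ Q) mulmxV // mulmx1.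
    by rewrite -[in RHS]gJ !mulmxA.
  have e'E : e' = row_mx (lsubmx e') (rsubmx e') by rewrite hsubmxK.
  move: hJ; rewrite hE e'E diag_mx_row tr_block_mx !trmx0 !tr_diag_mx !mulmx_block.
  rewrite !(mulmx0, mul0mx, addr0, add0r, mulmx1, mulmxN, mulNmx).
  move=> /eq_block_mx[_ e12 _ _].
  have e12E i : lsubmx e' 0 i * rsubmx e' 0 i = 1.
    by have /matrixP/(_ i i) := e12; rewrite mulmx_diag !mxE eqxx.
  have l0 i : lsubmx e' 0 i != 0.
    by apply/eqP => l0; have /eqP := e12E i; rewrite l0 mul0r eq_sym oner_eq0.
  exists (lsubmx e') => //; rewrite gE hE /torus_point {1}e'E; congr (_ *m diag_mx (row_mx _ _) *m _).
  apply/rowP => i; rewrite [RHS]mxE; apply: (mulfI (l0 i)).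
  by rewrite e12E divff.
split.
  rewrite YE /torus_point !mulmxA -(mulmxA _ (invmx Q)) mulVmx // mulmx1.
  rewrite -(mulmxA _ (invmx Q) Q) mulVmx // mulmx1 -!(mulmxA Q); congr (Q *m _).
  by rewrite !mulmx_diag; congr (diag_mx _ *m _); apply/rowP => i; rewrite !mxE mulrC.
rewrite {1}JE /torus_point !trmx_mul trmx_inv.
rewrite !mulmxA -(mulmxA _ Q^T) mulmxV ?unitmx_tr // mulmx1.
rewrite -(mulmxA _ (invmx Q) Q) mulVmx // mulmx1 [RHS]JE trmx_inv.
congr (_ *m _); rewrite -!mulmxA; congr (_ *m _); rewrite !mulmxA.
rewrite tr_diag_mx diag_mx_row !mulmx_block.
rewrite !(mulmx0, mul0mx, addr0, add0r, mulmx1, mulmxN, mulNmx).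
rewrite diag_inv // [X in block_mx _ _ (- X) _](_ : _ = 1%:M) //.
by rewrite -diag_mxC diag_inv.
Qed.

Lemma sympl_centralizer_Gm : alg_isom (@idfun K) (@Gm_pow K r) (sympl_centralizer J Y).
Proof.
have diagP (D : 'M[K]_r) : Gm_pow D <-> exists2 e : 'rV[K]_r, (forall i, e 0 i != 0) & D = diag_mx e.
  split=> [[/diag_mxP[e ->] Du]|[e e0 ->]].
    exists e => // i; move: Du; rewrite unitmxE det_diag unitfE prodf_seq_neq0.
    by move=> /allP/(_ i); rewrite mem_index_enum => /(_ isT).
  split; first exact: diag_mx_is_diag.
  by rewrite unitmxE det_diag unitfE prodf_seq_neq0; apply/allP => i _; apply/implyP.
pose f (D : 'M[K]_r) := Q *m block_mx D 0 0 (invmx D) *m invmx Q.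
pose f' (B : 'M[K]_(r + r)) := ulsubmx (invmx Q *m B *m Q).
have fE (e : 'rV[K]_r) : (forall i, e 0 i != 0) -> f (diag_mx e) = torus_point e.
  move=> e0; rewrite /f /torus_point diag_mx_row; congr (_ *m block_mx _ _ _ _ *m _).
  have de : diag_mx e \in unitmx by have [] := (diagP (diag_mx e)).2 (ex_intro2 _ _ e e0 erefl).
  by rewrite -[RHS](mulKmx de) diag_inv // mulmx1.
have f'E (e : 'rV[K]_r) : f' (torus_point e) = diag_mx e.
  rewrite /f' /torus_point !mulmxA mulVmx // mul1mx mulmxKV // diag_mx_row.
  by rewrite block_mxKul.
exists f, f'; split.
(* The inverse of the diagonal block is the adjugate times the inverse of the determinant, which is
   itself a coordinate of the general linear group. *)
- apply: (@regular_mapP K K idfun r _ _ f (GLC r Q *m block_mx (GLX K r) 0 0 (GLinvdet K r *: \adj (GLX K r)) *m GLC r (invmx Q))).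
  move=> A [_ Au]; rewrite !map_mxM !map_GLC map_block_mx !map_mx0 map_GLX map_mxZ.
  rewrite /= GL_eval_invdet map_mx_adj map_GLX !map_mx_id // /f.
  by rewrite {1}/invmx Au.
- apply: (@regular_mapP K K idfun (r + r) _ _ f' (ulsubmx (GLC (r + r) (invmx Q) *m GLX K (r + r) *m GLC (r + r) Q))).
  by move=> A _; rewrite map_ulsubmx !map_mxM !map_GLC map_GLX !map_mx_id.
- move=> A /diagP[e e0 ->]; rewrite fE // f'E; split=> //.
  by apply/sympl_centralizerP; exists e.
- move=> B /sympl_centralizerP[e e0 ->]; rewrite f'E fE //; split=> //.
  by apply/diagP; exists e.
- move=> A B /diagP[e e0 ->] /diagP[e1 e10 ->]; rewrite !fE // mulmx_diag fE; last first.
    by move=> i; rewrite mxE mulf_neq0.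
  rewrite /torus_point !mulmxA -(mulmxA _ (invmx Q)) mulVmx // mulmx1; congr (_ *m _).
  rewrite -(mulmxA Q) mulmx_diag; congr (Q *m diag_mx _); apply/rowP => l; rewrite [RHS]mxE.
  rewrite -[l]splitK; case: (fintype.split l) => j /=; rewrite ?row_mxEl ?row_mxEr !mxE //.
  by rewrite invfM.
Qed.

End CentralizerTorus.

Section Laurent.
Variable K : fieldType.

(** Laurent polynomials with the denominator cleared; the value at 0 is left free. *)
Definition laurent (g : K -> K) :=
  exists N (p : {poly K}), forall x, x != 0 -> x ^+ N * g x = p.[x].

Lemma laurent_cst c : laurent (fun=> c).
Proof. by exists 0%N, c%:P => x _; rewrite mul1r hornerC. Qed.

Lemma laurent_id : laurent id.
Proof. by exists 0%N, 'X => x _; rewrite mul1r hornerX. Qed.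

Lemma laurent_inv : laurent GRing.inv.
Proof. by exists 1%N, 1 => x x0; rewrite expr1 hornerC divff. Qed.

Lemma laurentD f g : laurent f -> laurent g -> laurent (fun x => f x + g x).
Proof.
move=> [N [p fp]] [M [q gq]]; exists (N + M)%N, ('X^M * p + 'X^N * q) => x x0.
rewrite !hornerE -fp // -gq // exprD mulrDr.
by congr (_ + _); rewrite !mulrA // [_ * x ^+ M]mulrC.
Qed.

Lemma laurentM f g : laurent f -> laurent g -> laurent (fun x => f x * g x).
Proof.
move=> [N [p fp]] [M [q gq]]; exists (N + M)%N, (p * q) => x x0.
by rewrite hornerM -fp // -gq // exprD mulrACA.
Qed.

Lemma laurent_sum (I : Type) (s : seq I) (f : I -> K -> K) :
  (forall i, laurent (f i)) -> laurent (fun x => \sum_(i <- s) f i x).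
Proof.
move=> fl; elim: s => [|i s IH].
  by have := laurent_cst 0; congr laurent; apply/funext => x; rewrite big_nil.
have := laurentD (fl i) IH; congr laurent; apply/funext => x; rewrite big_cons.
by [].
Qed.

Lemma laurent_prod (I : Type) (s : seq I) (f : I -> K -> K) :
  (forall i, laurent (f i)) -> laurent (fun x => \prod_(i <- s) f i x).
Proof.
move=> fl; elim: s => [|i s IH].
  by have := laurent_cst 1; congr laurent; apply/funext => x; rewrite big_nil.
by have := laurentM (fl i) IH; congr laurent; apply/funext => x; rewrite big_cons.
Qed.

Lemma laurentX f n : laurent f -> laurent (fun x => f x ^+ n).
Proof.
move=> fl; elim: n => [|n IH].
  by have := laurent_cst 1; congr laurent; apply/funext => x; rewrite expr0.
by have := laurentM fl IH; congr laurent; apply/funext => x; rewrite exprS.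
Qed.

Variable r : nat.

Definition Gm_coord (i : 'I_r) (x : K) : 'M[K]_r :=
  diag_mx (\row_j (if j == i then x else 1)).

Lemma det_Gm_coord i x : \det (Gm_coord i x) = x.
Proof.
rewrite det_diag (bigD1 i) //= mxE eqxx big1 ?mulr1 // => j ji.
by rewrite mxE (negbTE ji).
Qed.

Lemma Gm_coord_mul i x y : Gm_coord i x *m Gm_coord i y = Gm_coord i (x * y).
Proof.
rewrite mulmx_diag; congr diag_mx; apply/rowP => j; rewrite !mxE.
by case: ifP; rewrite ?mulr1.
Qed.

Lemma Gm_coordP i x : x != 0 -> Gm_pow (Gm_coord i x).
Proof. by move=> x0; split; rewrite ?diag_mx_is_diag // unitmxE det_Gm_coord unitfE. Qed.

Lemma GL_eval_laurent i (q : mpoly.mpoly (r * r + 1) K) :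
  laurent (fun x => GL_eval (@idfun K) q (Gm_coord i x)).
Proof.
apply: laurent_sum => m; apply: laurentM; first exact: laurent_cst.
apply: laurent_prod => l; apply: laurentX.
rewrite -[l]splitK; case: (fintype.split l) => [l'|l'] /=; last first.
  rewrite ord1; have := laurent_inv; congr laurent; apply/funext => x.
  by rewrite GL_coord_det det_Gm_coord.
case/mxvec_indexP: l' => a b; case: (eqVneq a b) => [<-|ab]; last first.
  have := laurent_cst 0; congr laurent; apply/funext => x.
  by rewrite GL_coordE !mxE (negbTE ab).
case: (eqVneq a i) => [ai|ai].
  have := laurent_id; congr laurent; apply/funext => x.
  by rewrite GL_coordE !mxE eqxx ai eqxx.
have := laurent_cst 1; congr laurent; apply/funext => x.
by rewrite GL_coordE !mxE eqxx (negbTE ai).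
Qed.

End Laurent.

Lemma unity_roots (K : closedFieldType) N : [pchar K] =i pred0 -> (0 < N)%N ->
  exists2 zs : seq K, uniq zs /\ size zs = N & forall z, z \in zs -> z ^+ N = 1.
Proof.
move=> /pcharf0P K0 N0; have [zs zsE] := closed_field_poly_normal ('X^N - 1 : {poly K}).
move: zsE; rewrite (eqP (monicXnsubC _ N0)) scale1r => zsE.
exists zs; first split.
- rewrite -separable_prod_XsubC -zsE unlock /= derivB derivC subr0 derivXn.
  apply/Bezout_eq1_coprimepP; exists (- 1, N%:R^-1 *: 'X) => /=.
  have NK : N%:R != 0 :> K by rewrite K0 -lt0n.
  rewrite mulN1r opprB -scaler_nat -scalerAl -scalerAr scalerA mulVf // scale1r.
  by rewrite -exprS prednK // subrK.
- by apply/succn_inj; rewrite -(size_prod_XsubC zs id) -zsE size_XnsubC.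
- move=> z zz; have : root ('X^N - 1 : {poly K}) z by rewrite zsE root_prod_XsubC.
  by rewrite rootE !hornerE subr_eq0 => /eqP.
Qed.

(** The polynomial [X^N - 1] annihilates [A] and has simple roots in characteristic 0. *)
Lemma finite_order_diagonalizable (K : closedFieldType) n N (A : 'M[K]_n.+1) :
    [pchar K] =i pred0 -> (0 < N)%N -> A ^+ N = 1 ->
  exists2 P, P \in unitmx & similar_diag P A.
Proof.
move=> K0 N0 AN; apply/diagonalizableP.
have [zs [uzs szs] zs1] := unity_roots K0 N0.
exists zs => //; apply: mxminpoly_min.
have -> : \prod_(z <- zs) ('X - z%:P) = 'X^N - 1.
  apply/esym/eqP; rewrite -subr_eq0; apply/eqP.
  apply: (@roots_geq_poly_eq0 _ _ zs) => //.
    apply/allP => z zz; rewrite rootE !hornerE (zs1 z zz) subrr sub0r oppr_eq0.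
    by rewrite -rootE root_prod_XsubC.
  have mo : 'X^N - 1 \is @monic K by apply: monicXnsubC.
  have sP : size (\prod_(z <- zs) ('X - z%:P)) = N.+1 by rewrite size_prod_XsubC szs.
  rewrite szs; apply/leq_sizeP => j; rewrite leq_eqVlt => /orP[/eqP<-|Nj].
    rewrite coefB; have := eqP mo; rewrite lead_coefE size_XnsubC //= => ->.
    have : \prod_(z <- zs) ('X - z%:P) \is monic by apply: monic_prod_XsubC.
    by rewrite monicE lead_coefE sP /= => /eqP ->; rewrite subrr.
  by rewrite coefB !nth_default ?subrr // ?sP // size_XnsubC.
by rewrite rmorphB rmorphXn rmorph1 /= horner_mx_X AN subrr.
Qed.

(* The images of the coordinate subgroups are Laurent in one variable, and the
   roots of unity, being of finite order, are mapped to diagonalizable matrices. *)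
Lemma torus_eigenbasis (k : fieldType) (K : closedFieldType) (iota : k -> K) n
    (T : set 'M[K]_n) : [pchar K] =i pred0 -> is_torus iota T ->
  exists2 P, P \in unitmx & eigencolumns T P.
Proof.
move=> K0 [[_ [T1 TM TV]] [r [f [f' [freg _ fT f'G fM]]]]].
case: n T T1 TM TV f f' freg fT f'G fM => [|n] T T1 TM TV f f' freg fT f'G fM.
  by exists 1%:M; rewrite ?unitmx1 // => t _; exists 0; apply/matrixP => -[].
have [q qE] := freg.
have comm A B : Gm_pow A -> Gm_pow B -> f A *m f B = f B *m f A.
  move=> GA GB; rewrite -!fM //; congr f.
  by have [/diag_mxP[a ->] _] := GA; have [/diag_mxP[b ->] _] := GB; rewrite diag_mxC.
have G1 : @Gm_pow K r 1%:M by split; rewrite ?scalar_mx_is_diag ?unitmx1.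
have f1 : f 1%:M = 1%:M.
  have [/f'G[Gf' ff'] _] : T 1%:M /\ True by [].
  by have := fM _ _ G1 Gf'; rewrite mul1mx ff' mulmx1 => <-.
have [N NP] : exists N : 'I_r -> 'I_n.+1 -> 'I_n.+1 -> nat, forall i a b,
    exists p : {poly K}, forall x, x != 0 -> x ^+ N i a b * f (Gm_coord i x) a b = p.[x].
  have h (t : 'I_r * 'I_n.+1 * 'I_n.+1) : exists N, exists p : {poly K},
      forall x, x != 0 -> x ^+ N * f (Gm_coord t.1.1 x) t.1.2 t.2 = p.[x].
    have [N [p Np]] := GL_eval_laurent t.1.1 (q t.1.2 t.2); exists N, p => x x0.
    by rewrite -Np // qE //; apply: Gm_coordP.
  have [N NP] := boolp.choice h; exists (fun i a b => N (i, a, b)) => i a b.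
  exact: NP (i, a, b).
pose M := (\sum_i \sum_a \sum_b N i a b)%N.
have NM i a b : (N i a b <= M)%N.
  rewrite /M (bigD1 i) //= (bigD1 a) //= (bigD1 b) //= -!addnA.
  exact: leq_addr.
have [p pP] : exists p : 'I_r -> 'I_n.+1 -> 'I_n.+1 -> {poly K}, forall i a b x,
    x != 0 -> x ^+ M * f (Gm_coord i x) a b = (p i a b).[x].
  have h (t : 'I_r * 'I_n.+1 * 'I_n.+1) : exists p : {poly K}, forall x,
      x != 0 -> x ^+ M * f (Gm_coord t.1.1 x) t.1.2 t.2 = p.[x].
    have [p pP] := NP t.1.1 t.1.2 t.2; exists ('X^(M - N t.1.1 t.1.2 t.2) * p) => x x0.
    by rewrite !hornerE -pP // mulrA -exprD subnK.
  have [p pP] := boolp.choice h; exists (fun i a b => p (i, a, b)) => i a b.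
  exact: pP (i, a, b).
pose D := (\sum_i \sum_a \sum_b size (p i a b))%N.
have pD i a b : (size (p i a b) <= D)%N.
  rewrite /D (bigD1 i) //= (bigD1 a) //= (bigD1 b) //= -!addnA.
  exact: leq_addr.
(* [D] bounds the sizes of all the cleared entries, so a combination of them that vanishes at [D.+1]
   roots of unity is zero. *)
have [zs [uzs szs] zs1] := unity_roots K0 (ltn0Sn D).
have z0 z : z \in zs -> z != 0.
  by move=> /zs1 zD; apply/eqP => z0; have /eqP := zD; rewrite z0 expr0n eq_sym oner_eq0.
pose fs := [seq f (Gm_coord i z) | i <- enum 'I_r, z <- zs].
have [P Pu Pdiag] : exists2 P : 'M[K]_n.+1, P \in unitmx & all [pred A | similar_diag P A] fs.
  apply/codiagonalizableP; split.
    move=> _ _ /allpairsP[[i z] /= [_ zz ->]] /allpairsP[[j y] /= [_ yy ->]].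
    by apply: comm; apply: Gm_coordP; apply: z0.
  move=> _ /allpairsP[[i z] /= [_ zz ->]].
  apply: (@finite_order_diagonalizable K n D.+1) => //.
  have powE m : f (Gm_coord i z) ^+ m = f (Gm_coord i (z ^+ m)).
    elim: m => [|m IH].
      rewrite !expr0 (_ : Gm_coord i 1 = 1%:M) ?f1 //.
      by apply/matrixP => a b; rewrite !mxE; case: (a =P b) => // ->; rewrite if_same.
    rewrite !exprS IH -Gm_coord_mul fM //; first exact/Gm_coordP/z0.
    by apply: Gm_coordP; rewrite expf_neq0 // z0.
  rewrite powE zs1 // (_ : Gm_coord i 1 = 1%:M) ?f1 //.
  by apply/matrixP => a b; rewrite !mxE; case: (a =P b) => // ->; rewrite if_same.
have Pcoord i x : x != 0 -> is_diag_mx (P *m f (Gm_coord i x) *m invmx P).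
  move=> x0; apply/is_diag_mxP => a b ab.
  have ent y : (P *m f (Gm_coord i y) *m invmx P) a b =
      \sum_c \sum_d P a d * f (Gm_coord i y) d c * invmx P c b.
    by rewrite mxE; apply: eq_bigr => c _; rewrite mxE big_distrl.
  pose g := \sum_c \sum_d (P a d * invmx P c b) *: p i d c.
  have gE y : y != 0 -> g.[y] = y ^+ M * (P *m f (Gm_coord i y) *m invmx P) a b.
    move=> y0; rewrite ent big_distrr horner_sum; apply: eq_bigr => c _ /=.
    rewrite big_distrr horner_sum; apply: eq_bigr => d _ /=.
    by rewrite hornerZ -pP // mulrCA [_ * f _ d c * _]mulrAC.
  suff g0 : g = 0.
    have /eqP := gE x x0; rewrite g0 horner0 eq_sym mulf_eq0 expf_eq0 (negbTE x0) andbF.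
    by move=> /eqP.
  apply: (@roots_geq_poly_eq0 _ _ zs) => //.
    apply/allP => z zz; apply/rootP; rewrite gE ?z0 //.
    have : f (Gm_coord i z) \in fs by apply/allpairsP; exists (i, z); rewrite mem_enum.
    move/(allP Pdiag) => /=; case/(similar_diagLR Pu) => d ->.
    have -> : P *m conjmx (invmx P) (diag_mx d) *m invmx P = diag_mx d.
      by rewrite conjVmx // !mulmxA mulmxV // mul1mx mulmxK.
    by rewrite (is_diag_mxP (diag_mx_is_diag d) _ _ ab) mulr0.
  rewrite szs; apply: leq_trans (leqnSn _).
  apply: leq_trans (size_sum _ _ _) _; apply/bigmax_leqP => c _.
  apply: leq_trans (size_sum _ _ _) _; apply/bigmax_leqP => d _.
  exact: leq_trans (size_scale_leq _ _) (pD _ _ _).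
exists (invmx P); first by rewrite unitmx_inv.
move=> t Tt; have [Gt ft] := f'G t Tt.
suff /diag_mxP[d dE] : is_diag_mx (P *m t *m invmx P).
  by exists d; rewrite -dE !mulmxA mulVmx // mul1mx.
rewrite -ft; have [/diag_mxP[u uE] uu] := Gt; rewrite uE in uu *.
have u0 i : u 0 i != 0.
  move: uu; rewrite unitmxE det_diag unitfE prodf_seq_neq0.
  by move=> /allP/(_ i); rewrite mem_index_enum => /(_ isT).
(* The coordinates of a point are multiplied in one at a time, each factor having a diagonal image
   in the common eigenbasis. *)
pose Dm m := diag_mx (\row_j (if (j < m)%N then u 0 j else 1)) : 'M[K]_r.
have GD m : Gm_pow (Dm m).
  split; first exact: diag_mx_is_diag.
  rewrite unitmxE det_diag unitfE prodf_seq_neq0; apply/allP => j _; rewrite implyTb mxE.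
  by case: ifP; rewrite ?oner_eq0.
suff Dmd m : (m <= r)%N -> is_diag_mx (P *m f (Dm m) *m invmx P).
  have -> : diag_mx u = Dm r by congr diag_mx; apply/rowP => j; rewrite mxE ltn_ord.
  exact: Dmd.
elim: m => [_|m IH mr].
  have -> : Dm 0%N = 1%:M.
    by apply/matrixP => a b; rewrite !mxE.
  by rewrite f1 mulmx1 mulmxV // scalar_mx_is_diag.
have -> : Dm m.+1 = Dm m *m Gm_coord (Ordinal mr) (u 0 (Ordinal mr)).
  rewrite mulmx_diag; congr diag_mx; apply/rowP => j; rewrite !mxE ltnS leq_eqVlt.
  case: (eqVneq j (Ordinal mr)) => [->|jm] /=; first by rewrite eqxx ltnn mul1r.
  rewrite (_ : (nat_of_ord j == m) = false) ?mulr1 //.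
  by apply/negbTE; apply: contra jm => /eqP jm; apply/eqP/val_inj.
rewrite fM //; last exact: Gm_coordP.
have /diag_mxP[d1 E1] := IH (ltnW mr).
have /diag_mxP[d2 E2] := Pcoord (Ordinal mr) _ (u0 (Ordinal mr)).
have -> : P *m (f (Dm m) *m f (Gm_coord (Ordinal mr) (u 0 (Ordinal mr)))) *m invmx P =
    (P *m f (Dm m) *m invmx P) *m (P *m f (Gm_coord (Ordinal mr) (u 0 (Ordinal mr))) *m invmx P).
  by rewrite !mulmxA mulmxKV.
by rewrite E1 E2 mulmx_diag diag_mx_is_diag.
Qed.

(** * The centralizer algebra of an elliptic torus *)

Section SplitTorus.
Variables (k K : fieldType) (iota : {rmorphism k -> K}) (n : nat) (e1 e2 : 'M[k]_n).
Hypothesis e1e1 : e1 *m e1 = e1.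
Hypothesis e2e2 : e2 *m e2 = e2.
Hypothesis e1e2 : e1 *m e2 = 0.
Hypothesis e2e1 : e2 *m e1 = 0.
Hypothesis e1_neq0 : e1 != 0.
Hypothesis e2_neq0 : e2 != 0.

Let E1 := map_mx iota e1.
Let E2 := map_mx iota e2.
Let E0 := map_mx iota (1%:M - e1 - e2).

Definition idem_torus_point (a b : K) : 'M[K]_n := a *: E1 + b *: E2 + E0.

Lemma idem_torus_pointM a b c d :
  idem_torus_point a b *m idem_torus_point c d = idem_torus_point (a * c) (b * d).
Proof.
have E11 : E1 *m E1 = E1 by rewrite -map_mxM e1e1.
have E22 : E2 *m E2 = E2 by rewrite -map_mxM e2e2.
have E12 : E1 *m E2 = 0 by rewrite -map_mxM e1e2 map_mx0.
have E21 : E2 *m E1 = 0 by rewrite -map_mxM e2e1 map_mx0.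
have E0E : E0 = 1%:M - E1 - E2 by rewrite /E0 !map_mxB map_mx1.
have E10 : E1 *m E0 = 0 by rewrite E0E !mulmxBr mulmx1 E11 E12 subrr subr0.
have E20 : E2 *m E0 = 0 by rewrite E0E !mulmxBr mulmx1 E21 E22 subr0 subrr.
have E01 : E0 *m E1 = 0 by rewrite E0E !mulmxBl mul1mx E11 E21 subrr subr0.
have E02 : E0 *m E2 = 0 by rewrite E0E !mulmxBl mul1mx E12 E22 subr0 subrr.
have E00 : E0 *m E0 = E0 by rewrite {1}E0E !mulmxBl mul1mx E10 E20 !subr0.
rewrite /idem_torus_point !mulmxDl !mulmxDr -!scalemxAl -!scalemxAr.
by rewrite E11 E12 E10 E21 E22 E20 E01 E02 E00 !scaler0 !addr0 !add0r !scalerA.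
Qed.

Lemma idem_torus_point1 : idem_torus_point 1 1 = 1%:M.
Proof.
rewrite /idem_torus_point !scale1r -!map_mxD -(map_mx1 iota n); congr map_mx.
by rewrite -[1%:M - e1 - e2]addrA -opprD [LHS]addrC subrK.
Qed.

(** The parameters are inverse to each other because [e1] and [e2] will be exchanged by the adjoint,
    which makes these points symplectic. *)
Definition idem_torus : set 'M[K]_n :=
  [set A | exists2 a, a != 0 & A = idem_torus_point a a^-1].

Lemma idem_torus_split : is_split_torus iota idem_torus.
Proof.
have [i1 [j1 e1ij]] : exists i j, e1 i j != 0.
  apply: contrapT => h; move/eqP: e1_neq0; apply; apply/matrixP => i j; rewrite mxE.
  by apply: contrapT => /eqP hij; apply: h; exists i, j.
have [i2 [j2 e2ij]] : exists i j, e2 i j != 0.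
  apply: contrapT => h; move/eqP: e2_neq0; apply; apply/matrixP => i j; rewrite mxE.
  by apply: contrapT => /eqP hij; apply: h; exists i, j.
(* Each parameter is recovered from one non-zero entry of its idempotent. The torus is then cut out
   by [al A * bl A = 1] and by [A] being the point with these parameters. *)
pose al (A : 'M[K]_n) := (A *m E1) i1 j1 * iota (e1 i1 j1)^-1.
pose bl (A : 'M[K]_n) := (A *m E2) i2 j2 * iota (e2 i2 j2)^-1.
have alE a b : al (idem_torus_point a b) = a.
  have : idem_torus_point a b *m E1 = a *: E1.
    rewrite /idem_torus_point !mulmxDl -!scalemxAl -!map_mxM !mulmxBl mul1mx e1e1 e2e1.
    by rewrite subrr subr0 map_mx0 scaler0 !addr0.
  by rewrite /al => ->; rewrite mxE mxE -mulrA -rmorphM divff // rmorph1 mulr1.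
have blE a b : bl (idem_torus_point a b) = b.
  have : idem_torus_point a b *m E2 = b *: E2.
    rewrite /idem_torus_point !mulmxDl -!scalemxAl -!map_mxM !mulmxBl mul1mx e1e2 e2e2.
    by rewrite subr0 subrr map_mx0 scaler0 addr0 add0r.
  by rewrite /bl => ->; rewrite mxE mxE -mulrA -rmorphM divff // rmorph1 mulr1.
pose X := GLX k n.
pose a1 := (X *m GLC n e1) i1 j1 * mpoly.mpolyC _ (e1 i1 j1)^-1.
pose a2 := (X *m GLC n e2) i2 j2 * mpoly.mpolyC _ (e2 i2 j2)^-1.
pose ev A := mpoly.mmap iota (GL_coord A) : mpoly.mpoly (n * n + 1) k -> K.
have a1E A : ev A a1 = al A.
  rewrite /ev /a1 rmorphM /= mpoly.mmapC; congr (_ * _).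
  by rewrite -[LHS](mxE (map_mx_key) (fun i j => mpoly.mmap iota (GL_coord A) ((X *m GLC n e1) i j))) -/(map_mx _ _) map_mxM map_GLX map_GLC.
have a2E A : ev A a2 = bl A.
  rewrite /ev /a2 rmorphM /= mpoly.mmapC; congr (_ * _).
  by rewrite -[LHS](mxE (map_mx_key) (fun i j => mpoly.mmap iota (GL_coord A) ((X *m GLC n e2) i j))) -/(map_mx _ _) map_mxM map_GLX map_GLC.
pose PM : 'M[mpoly.mpoly (n * n + 1) k]_n :=
  X - (a1 *: GLC n e1 + a2 *: GLC n e2 + GLC n (1%:M - e1 - e2)).
have PME A : map_mx (ev A) PM = A - idem_torus_point (al A) (bl A).
  rewrite map_mxB !map_mxD !map_mxZ /= map_GLX !map_GLC.
  by rewrite -/(ev A) a1E a2E.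
have unit_pt a : a != 0 -> idem_torus_point a a^-1 \in unitmx.
  move=> a0; apply: (proj1 (@mulmx1_unit _ _ _ (idem_torus_point a^-1 a) _)).
  by rewrite idem_torus_pointM divff // mulVf // idem_torus_point1.
have inv_pt a : a != 0 -> invmx (idem_torus_point a a^-1) = idem_torus_point a^-1 a.
  move=> a0; rewrite -[RHS](mulKmx (unit_pt a a0)) idem_torus_pointM divff // mulVf //.
  by rewrite idem_torus_point1 mulmx1.
split; first split.
- exists [set q : mpoly.mpoly (n * n + 1) k | q = a1 * a2 - 1 \/ exists i j, q = PM i j].
  apply/seteqP; split=> A.
    move=> [a a0 ->]; split=> [|q]; first exact: unit_pt.
    case=> [->|[i [j ->]]]; rewrite /GL_eval -/(ev _).
      by rewrite /ev rmorphB rmorphM rmorph1 /= -/(ev _) a1E a2E alE blE divff // subrr.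
    have /matrixP/(_ i j) := PME (idem_torus_point a a^-1).
    by rewrite alE blE subrr [LHS]mxE [RHS]mxE.
  move=> [Au Aq].
  have AE : A = idem_torus_point (al A) (bl A).
    apply/eqP; rewrite -subr_eq0 -PME; apply/eqP/matrixP => i j.
    by rewrite [LHS]mxE [RHS]mxE; apply: Aq; right; exists i, j.
  have ab : al A * bl A = 1.
    apply/eqP; rewrite -subr_eq0 -a1E -a2E -(rmorph1 (mpoly.mmap iota (GL_coord A))).
    by rewrite -rmorphM -rmorphB /=; apply/eqP; apply: Aq; left.
  have al0 : al A != 0.
    by apply/eqP => al0; have /eqP := ab; rewrite al0 mul0r eq_sym oner_eq0.
  exists (al A) => //; rewrite {1}AE; congr idem_torus_point.
  by apply: (mulfI al0); rewrite ab divff.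
- split.
  + by exists 1; rewrite ?oner_eq0 // invr1 idem_torus_point1.
  + move=> A B [a a0 ->] [b b0 ->]; exists (a * b); first by rewrite mulf_neq0.
    by rewrite idem_torus_pointM invfM.
  + move=> A [a a0 ->]; exists a^-1; first by rewrite invr_eq0.
    by rewrite inv_pt // invrK.
- exists 1%N, (fun D : 'M[K]_1 => idem_torus_point (D 0 0) (\det D)^-1),
    (fun A : 'M[K]_n => (al A)%:M : 'M[K]_1).
  split.
  + apply: (@regular_mapP k K iota 1 _ _ _
      (GLX k 1 0 0 *: GLC 1 e1 + GLinvdet k 1 *: GLC 1 e2 + GLC 1 (1%:M - e1 - e2))).
    move=> A _; rewrite !map_mxD !map_mxZ /= !map_GLC GL_eval_invdet.
    by rewrite mxE mpoly.mmapX mpoly.mmap1U GL_coordE.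
  + apply: (@regular_mapP k K iota n _ _ _ a1%:M) => A _.
    by rewrite map_scalar_mx /= -/(ev A) a1E.
  + move=> A [_ Au]; rewrite (_ : \det A = A 0 0) ?det_mx11 //.
    have A0 : A 0 0 != 0 by rewrite -det_mx11 -unitfE -unitmxE.
    split; first by exists (A 0 0).
    by rewrite alE; apply/matrixP => i j; rewrite !ord1 mxE eqxx.
  + move=> _ [a a0 ->]; rewrite alE det_scalar1 mxE eqxx mulr1n; split=> //.
    by split; rewrite ?scalar_mx_is_diag // unitmxE det_scalar1 unitfE.
  + move=> A B _ _; rewrite idem_torus_pointM det_mulmx invfM; congr idem_torus_point.
    by rewrite mxE big_ord1.
Qed.

End SplitTorus.

(** This holds because [u] is isotropic. Transvections are the elements against which a split torus
    is tested for centrality. *)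
Lemma transvection_sympl (K : fieldType) n (J : 'M[K]_n) (u : 'cV[K]_n) :
    2%:R != 0 :> K -> J^T = - J ->
  (1%:M + u *m u^T *m J)^T *m J *m (1%:M + u *m u^T *m J) = J.
Proof.
move=> two Jskew; have uJu := skew_self two Jskew u.
have -> : (1%:M + u *m u^T *m J)^T = 1%:M - J *m u *m u^T.
  by rewrite linearD /= trmx1 !trmx_mul trmxK Jskew mulNmx mulmxA.
rewrite mulmxBl mul1mx mulmxDr mulmx1 mulmxBl !mulmxA.
rewrite -(mulmxA (J *m u) u^T J) -(mulmxA (J *m u) (u^T *m J) u) uJu mulmx0 !mul0mx subr0.
by rewrite !mulmxA subrK.
Qed.

(* If [e] and its adjoint [es] differ, then [a |-> a e(1-es) + a^-1 es(1-e) + ...]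
   is a non-central split subtorus. *)
Lemma elliptic_idempotent (k : fieldType) (K : closedFieldType) (iota : {rmorphism k -> K})
    n (J : 'M[k]_n) (T : set 'M[K]_n) (C : set 'M[k]_n) (e : 'M[k]_n) :
    [pchar k] =i pred0 -> J^T = - J -> J \in unitmx ->
    (forall S, is_split_torus iota S -> S `<=` T -> forall A B, S A ->
      B^T *m map_mx iota J *m B = map_mx iota J -> A *m B = B *m A) ->
    (forall e1 e2 a, C e1 -> C e2 -> e1^T *m J = J *m e2 -> e2^T *m J = J *m e1 ->
       e1 *m e1 = e1 -> e2 *m e2 = e2 -> e1 *m e2 = 0 -> e2 *m e1 = 0 ->
       a != 0 -> T (idem_torus_point iota e1 e2 a a^-1)) ->
    C (e *m (1%:M - invmx J *m e^T *m J)) -> C (invmx J *m e^T *m J *m (1%:M - e)) ->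
    e *m e = e -> e *m (invmx J *m e^T *m J) = (invmx J *m e^T *m J) *m e ->
  e^T *m J = J *m e.
Proof.
move=> k0 Jskew Ju ell CT; set es := invmx J *m e^T *m J => C1 C2 ee ees.
have Jes : e^T *m J = J *m es by rewrite /es !mulmxA mulmxV // mul1mx.
have eseE : es^T *m J = J *m e.
  by have /(congr1 trmx) := Jes; rewrite !trmx_mul trmxK Jskew mulNmx mulmxN => /oppr_inj ->.
have eses : es *m es = es.
  have : J *m (es *m es) = J *m es by rewrite mulmxA -Jes -mulmxA -Jes mulmxA -trmx_mul ee.
  by move/(congr1 (mulmx (invmx J))); rewrite !mulKmx.
(* What remains of [e] and of its adjoint outside their common part: orthogonal idempotents
   exchanged by the adjoint. *)
pose e1 := e *m (1%:M - es); pose e2 := es *m (1%:M - e).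
have e1E : e1 = e - e *m es by rewrite /e1 mulmxBr mulmx1.
have e2E : e2 = es - e *m es by rewrite /e2 mulmxBr mulmx1 ees.
have e_ees : e *m (e *m es) = e *m es by rewrite mulmxA ee.
have es_ees : es *m (e *m es) = e *m es by rewrite mulmxA -ees -mulmxA eses.
have ees_e : e *m es *m e = e *m es by rewrite -mulmxA -ees e_ees.
have ees_es : e *m es *m es = e *m es by rewrite -mulmxA eses.
have ees_ees : e *m es *m (e *m es) = e *m es by rewrite -mulmxA es_ees e_ees.
have e11 : e1 *m e1 = e1.
  by rewrite e1E mulmxBl !mulmxBr ee e_ees ees_e ees_ees subrr subr0.
have e22 : e2 *m e2 = e2.
  by rewrite e2E mulmxBl !mulmxBr eses es_ees ees_es ees_ees subrr subr0.
have e12 : e1 *m e2 = 0.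
  by rewrite e1E e2E mulmxBl !mulmxBr e_ees ees_es ees_ees !subrr.
have e21 : e2 *m e1 = 0.
  by rewrite e1E e2E mulmxBl !mulmxBr -ees es_ees ees_e ees_ees !subrr.
have e1J : e1^T *m J = J *m e2.
  rewrite e1E e2E linearB /= mulmxBl mulmxBr Jes; congr (_ - _).
  by rewrite trmx_mul -mulmxA Jes mulmxA eseE -mulmxA.
have e2J : e2^T *m J = J *m e1.
  rewrite e1E e2E linearB /= mulmxBl mulmxBr eseE; congr (_ - _).
  by rewrite trmx_mul -mulmxA Jes mulmxA eseE -mulmxA.
case: (eqVneq e1 0) => [e10|e1n0].
  have e20 : e2 = 0.
    have : J *m e2 = 0 by rewrite -e1J e10 trmx0 mul0mx.
    by move/(congr1 (mulmx (invmx J))); rewrite mulKmx // mulmx0.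
  rewrite Jes; congr (J *m _); apply/eqP; rewrite -subr_eq0; apply/eqP.
  have -> : es - e = e2 - e1 by rewrite e1E e2E opprB addrA subrK.
  by rewrite e10 e20 subrr.
have e2n0 : e2 != 0.
  apply: contra e1n0 => /eqP e20.
  have : J *m e1 = 0 by rewrite -e2J e20 trmx0 mul0mx.
  by move/(congr1 (mulmx (invmx J))); rewrite mulKmx // mulmx0 => /eqP.
exfalso.
have K0 : [pchar K] =i pred0 by apply: iota_char0 iota k0.
have natK m : (m%:R == 0 :> K) = (m == 0%N) by apply: (pcharf0P K).1.
have two : 2%:R != 0 :> K by rewrite natK.
have := ell _ (idem_torus_split iota e11 e22 e12 e21 e1n0 e2n0).
have sub : idem_torus iota e1 e2 `<=` T by move=> _ [a a0 ->]; apply: CT.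
have JKskew : (map_mx iota J)^T = - map_mx iota J by rewrite map_trmx Jskew map_mxN.
have JKu : map_mx iota J \in unitmx by rewrite map_unitmx.
have col0 (e' : 'M[k]_n) : e' != 0 -> exists x : 'cV[K]_n, map_mx iota e' *m x != 0.
  move=> e'0; apply: contrapT => h; move/eqP: e'0; apply.
  apply: (map_mx_inj (f := iota)); rewrite map_mx0 -[LHS]mulmx1; apply/matrixP => i j.
  have : map_mx iota e' *m col j 1%:M = 0 by apply: contrapT => /eqP h'; apply: h; eexists; exact: h'.
  move=> /matrixP/(_ i 0); rewrite colE mulmxA -colE mxE => ->; by rewrite !mxE.
have [x x0] := col0 _ e1n0; have [y y0] := col0 _ e2n0.
move=> /(_ sub (idem_torus_point iota e1 e2 2%:R 2%:R^-1)).
(* The vector [u] will have non-zero components in both images. If [g] commuted with the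
   transvection along [u], the row [rw] would be an eigenvector with both eigenvalues 2 and 1/2,
   forcing [4 = 1]. *)
pose g := idem_torus_point iota e1 e2 2%:R 2%:R^-1.
pose u1 := map_mx iota e1 *m x; pose u2 := map_mx iota e2 *m y.
pose u := u1 + u2.
have Sg : idem_torus iota e1 e2 g by exists 2%:R.
move=> /(_ _ Sg (transvection_sympl u two JKskew)).
rewrite -/g (mulmxDr g) (mulmxDl 1%:M _ g) mulmx1 mul1mx => /addrI; rewrite !mulmxA => gu.
have E1g : map_mx iota e1 *m g = 2%:R *: map_mx iota e1.
  rewrite /g /idem_torus_point !mulmxDr -!scalemxAr -!map_mxM !mulmxBr mulmx1 e11 e12.
  by rewrite subrr subr0 map_mx0 scaler0 !addr0.
have E2g : map_mx iota e2 *m g = 2%:R^-1 *: map_mx iota e2.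
  rewrite /g /idem_torus_point !mulmxDr -!scalemxAr -!map_mxM !mulmxBr mulmx1 e21 e22.
  by rewrite subr0 subrr map_mx0 scaler0 addr0 add0r.
have E1u : map_mx iota e1 *m u = u1.
  by rewrite mulmxDr !mulmxA -!map_mxM e11 e12 map_mx0 mul0mx addr0.
have E2u : map_mx iota e2 *m u = u2.
  by rewrite mulmxDr !mulmxA -!map_mxM e21 e22 map_mx0 mul0mx add0r.
pose rw := u^T *m map_mx iota J.
have rw0 : rw != 0.
  apply: contra x0 => /eqP rw0; have : u^T = 0 by rewrite -[u^T](mulmxK JKu) -/rw rw0 mul0mx.
  by move/(congr1 trmx); rewrite trmxK trmx0 => u0; rewrite -/u1 -E1u u0 mulmx0.
have cancel (v : 'cV[K]_n) c : v != 0 -> c *: (v *m rw) = v *m (rw *m g) -> c *: rw = rw *m g.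
  move=> v0 vE; have [i vi] : exists i, v i 0 != 0.
    apply: contrapT => h; move/eqP: v0; apply; apply/matrixP => i j; rewrite ord1 mxE.
    by apply: contrapT => /eqP hi; apply: h; exists i.
  apply/rowP => j; have /matrixP/(_ i j) := vE.
  rewrite mxE [in LHS]mxE big_ord1 [in RHS]mxE big_ord1 mulrCA => /(mulfI vi) <-.
  by rewrite mxE.
have c1 : 2%:R *: rw = rw *m g.
  apply: (cancel u1) => //; have := congr1 (mulmx (map_mx iota e1)) gu.
  by rewrite !mulmxA E1g -!scalemxAl E1u -!mulmxA.
have c2 : 2%:R^-1 *: rw = rw *m g.
  apply: (cancel u2) => //; have := congr1 (mulmx (map_mx iota e2)) gu.
  by rewrite !mulmxA E2g -!scalemxAl E2u -!mulmxA.
move: c1; rewrite -c2 => /eqP; rewrite -subr_eq0 -scalerBl scaler_eq0 (negbTE rw0) orbF.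
rewrite subr_eq0 => /eqP h; have : 4%:R == 1 :> K.
  by rewrite (natrM K 2 2) {1}h mulVf.
by rewrite -subr_eq0 -(natrB K (isT : (1 <= 4)%N)) natK.
Qed.

Lemma std_sympl_unitmx (K : fieldType) r (J Q : 'M[K]_(r + r)) :
  Q^T *m J *m Q = block_mx 0 1%:M (- 1%:M) 0 -> Q \in unitmx.
Proof.
move=> QJ; apply: (proj2 (@mulmx1_unit _ _ (block_mx 0 (- 1%:M) 1%:M 0 *m (Q^T *m J)) Q _)).
rewrite -mulmxA QJ mulmx_block !(mul0mx, mulmx0, add0r, addr0, mulNmx, mulmxN, mul1mx, opprK, oppr0).
by rewrite -scalar_mx_block.
Qed.

Lemma isotropic_pair_std (K : fieldType) r (J : 'M[K]_(r + r)) (F : set 'M[K]_(r + r))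
    (V V' : 'M[K]_(r + r, r)) : J^T = - J -> isotropic_pair J F V V' ->
  (row_mx V V')^T *m J *m row_mx V V' = block_mx 0 1%:M (- 1%:M) 0.
Proof.
move=> Jskew [V0 V'0 VV' _ _].
by rewrite tr_row_mx mul_col_mx mul_col_row V0 V'0 VV' (isotropic_pair_sym Jskew VV').
Qed.

(** The pair [Y], [-Y] is stable under the adjoint, so over [K] there is a symplectic eigenbasis
    with eigenvalues [d] and [-d]. Their distinctness makes the centralizer diagonal, and also
    excludes the eigenvalue 0, which would coincide with its opposite. *)
Lemma sympl_centralizer_torus (k : fieldType) (K : closedFieldType)
    (iota : {rmorphism k -> K}) n (J Y : 'M[k]_n) :
    [pchar k] =i pred0 -> J^T = - J -> J \in unitmx -> Y^T *m J = - (J *m Y) ->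
    separable_poly (char_poly Y) ->
  is_torus iota (sympl_centralizer (map_mx iota J) (map_mx iota Y)) /\ Y \in unitmx.
Proof.
move=> k0 Jskew Ju Yskew sepY.
have two : 2%:R != 0 :> K by rewrite ((pcharf0P K).1 (iota_char0 iota k0)).
pose JK := map_mx iota J; pose YK := map_mx iota Y.
have JKskew : JK^T = - JK by rewrite /JK map_trmx Jskew map_mxN.
have JKu : JK \in unitmx by rewrite map_unitmx.
have YKskew : YK^T *m JK = - (JK *m YK).
  by rewrite /YK /JK map_trmx -!map_mxM Yskew map_mxN.
have sepYK : separable_poly (char_poly YK) by rewrite -map_char_poly separable_map.
have [P Pu [dP Pd]] := separable_eigenbasis sepYK.
pose F := [set YK; - YK].
have Fadj t : F t -> exists2 t', F t' & t^T *m JK = JK *m t'.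
  move=> [] ->; first by exists (- YK); [right|rewrite YKskew mulmxN].
  by exists YK; [left|rewrite linearN /= mulNmx YKskew opprK].
have Feig : eigencolumns F P.
  move=> t [] ->; first by exists dP.
  by exists (- dP); rewrite mulNmx Pd linearN /= mulmxN.
have [r [V [V' [nE VV']]]] := darboux_eigenbasis two JKskew JKu Fadj Pu Feig.
have lin := sympl_centralizer_lin_alg_group iota Y Ju.
subst n.
have QJ := isotropic_pair_std JKskew VV'.
have Qu := std_sympl_unitmx QJ.
have [V0 V'0 VV1 Ve V'e] := VV'.
have FY : F YK by left.
have [d Vd] := Ve YK FY; have [d' V'd'] := V'e YK FY.
have YQ : YK *m row_mx V V' = row_mx V V' *m diag_mx (row_mx d d').
  by rewrite mul_mx_row Vd V'd' diag_mx_row mul_row_block !mulmx0 addr0 add0r.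
have YKE : YK = row_mx V V' *m diag_mx (row_mx d d') *m invmx (row_mx V V').
  by rewrite -YQ mulmxK.
have dinj : injective (row_mx d d' 0).
  by apply/injectiveP; rewrite -(separable_char_poly_diag _ Qu) -YKE.
have d'E : d' = - d.
  have : V^T *m JK *m (YK *m V') = - (V^T *m YK^T *m JK *m V').
    by rewrite -(mulmxA V^T YK^T) YKskew !mulmxA mulmxN mulNmx opprK !mulmxA.
  rewrite V'd' mulmxA VV1 mul1mx -trmx_mul Vd trmx_mul tr_diag_mx -!mulmxA (mulmxA V^T) VV1 mulmx1.
  move=> /matrixP h; apply/rowP => i; have := h i i.
  by rewrite !mxE eqxx.
split.
  by split=> //; exists r; apply: (sympl_centralizer_Gm Qu QJ YQ dinj).
suff : YK \in unitmx by rewrite map_unitmx.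
rewrite YKE !unitmx_mul Qu unitmx_inv Qu andbT /= unitmxE det_diag unitfE.
rewrite prodf_seq_neq0; apply/allP => l _; rewrite implyTb; apply/eqP.
rewrite -[l]splitK; case: (fintype.split l) => j /=; rewrite ?row_mxEl ?row_mxEr => d0.
  have /dinj/eqP : row_mx d d' 0 (lshift r j) = row_mx d d' 0 (rshift r j).
    by rewrite row_mxEl row_mxEr d'E mxE d0 oppr0.
  by rewrite eq_lrshift.
have /dinj/eqP : row_mx d d' 0 (lshift r j) = row_mx d d' 0 (rshift r j).
  by move: d0; rewrite row_mxEl row_mxEr d'E mxE => /eqP; rewrite oppr_eq0 => /eqP->; rewrite oppr0.
by rewrite eq_lrshift.
Qed.

Lemma separable_centralizer_comm (k : fieldType) (K : closedFieldType)
    (iota : {rmorphism k -> K}) n (Y b c : 'M[k]_n) :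
  separable_poly (char_poly Y) -> b *m Y = Y *m b -> c *m Y = Y *m c -> b *m c = c *m b.
Proof.
move=> sepY bY cY; apply: (map_mx_inj (f := iota)).
have sepYK : separable_poly (char_poly (map_mx iota Y)) by rewrite -map_char_poly separable_map.
have [P Pu [d Pd]] := separable_eigenbasis sepYK.
have dinj : injective (d 0).
  by apply/injectiveP; rewrite -(separable_char_poly_diag _ Pu) -Pd mulmxK.
have diag (a : 'M[k]_n) : a *m Y = Y *m a ->
    exists e, map_mx iota a = P *m diag_mx e *m invmx P.
  move=> /(congr1 (map_mx iota)); rewrite !map_mxM => aY.
  pose h := invmx P *m map_mx iota a *m P.
  have hd : h *m diag_mx d = diag_mx d *m h.
    rewrite /h -!mulmxA -Pd (mulmxA (map_mx iota a)) aY -mulmxA (mulmxA (map_mx iota Y)).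
    by rewrite -[map_mx iota Y](mulmxK Pu) Pd -!mulmxA !mulKmx // (mulmxA (map_mx iota a)).
  have /diag_mxP[e hE] : is_diag_mx h.
    apply/is_diag_mxP => i j ij; have /matrixP/(_ i j) := hd.
    rewrite mul_mx_diag mul_diag_mx !mxE mulrC => /eqP.
    rewrite -subr_eq0 -mulrBl mulf_eq0 subr_eq0 => /orP[/eqP/dinj ji|/eqP->//].
    by rewrite ji eqxx in ij.
  by exists e; rewrite -hE /h !mulmxA mulmxV // mul1mx mulmxK.
have [e1 E1] := diag b bY; have [e2 E2] := diag c cY.
rewrite !map_mxM E1 E2 !mulmxA !mulmxKV // -!(mulmxA P) !mulmx_diag.
by congr (P *m (diag_mx _ *m _)); apply/rowP => i; rewrite !mxE mulrC.
Qed.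

(** Over [K], a vector whose coordinates in the eigenbasis are all non-zero is cyclic, by the
    Vandermonde determinant. The product of these coordinates is polynomial on lines, so such a
    vector also exists over [k]. *)
Lemma separable_cyclic (k : fieldType) (K : closedFieldType)
    (iota : {rmorphism k -> K}) n (Y : 'M[k]_n.+1) :
    [pchar k] =i pred0 -> separable_poly (char_poly Y) ->
  exists w0 : 'cV[k]_n.+1, forall w, exists f : {poly k}, horner_mx Y f *m w0 = w.
Proof.
move=> k0 sepY.
have sepYK : separable_poly (char_poly (map_mx iota Y)) by rewrite -map_char_poly separable_map.
have [P Pu [d Pd]] := separable_eigenbasis sepYK.
have dinj : injective (d 0).
  by apply/injectiveP; rewrite -(separable_char_poly_diag _ Pu) -Pd mulmxK.
pose F (w : 'cV[K]_n.+1) := \prod_i (invmx P *m w) i 0.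
have Fpoly : poly_on_lines F.
  move=> A B; exists (\prod_i (((invmx P *m A) i 0)%:P + ((invmx P *m B) i 0) *: 'X)) => c.
  rewrite horner_prod; apply: eq_bigr => i _.
  by rewrite mulmxDr -scalemxAr !mxE !hornerE mulrC.
pose w1 : 'cV[K]_n.+1 := P *m const_mx 1.
have : F (\sum_i w1 i 0 *: map_mx iota (delta_mx i 0 : 'cV[k]_n.+1)) != 0.
  have -> : \sum_i w1 i 0 *: map_mx iota (delta_mx i 0 : 'cV[k]_n.+1) = w1.
    apply/matrixP => i j; rewrite ord1 summxE (bigD1 i) //= big1 ?addr0 => [|l li].
      by rewrite !mxE !eqxx rmorph1 mulr1.
    by rewrite !mxE eq_sym (negbTE li) rmorph0 mulr0.
  rewrite /F /w1 mulKmx // prodf_seq_neq0; apply/allP => i _.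
  by rewrite mxE oner_eq0.
move=> /(generic_point k0 Fpoly)[c]; set w0 := \sum_i _ => Fw0.
exists w0 => w.
pose M := \matrix_(i, j < n.+1) (Y ^+ j *m w0) i 0.
have Mu : M \in unitmx.
  rewrite -(map_unitmx iota).
  pose x := invmx P *m map_mx iota w0.
  have powE j : map_mx iota (Y ^+ j) *m P = P *m diag_mx (map_mx (fun a => a ^+ j) d).
    elim: j => [|j IH].
      rewrite expr0 map_mx1 mul1mx -[LHS]mulmx1; congr (P *m _).
      by apply/matrixP => a b; rewrite !mxE expr0.
    rewrite exprS map_mxM -mulmxA IH mulmxA Pd -mulmxA mulmx_diag.
    by congr (P *m diag_mx _); apply/rowP => a; rewrite !mxE exprS.
  have -> : map_mx iota M = P *m (diag_mx x^T *m (Vandermonde n.+1 d)^T).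
    apply/matrixP => i j.
    have -> : map_mx iota M i j = (map_mx iota (Y ^+ j *m w0)) i 0.
      by rewrite mxE [M i j]mxE [RHS]mxE.
    rewrite map_mxM -[map_mx iota w0](mulKVmx Pu) -/x mulmxA powE -mulmxA mul_diag_mx.
    rewrite mul_diag_mx !mxE; apply: eq_bigr => l _; rewrite !mxE.
    by rewrite [d 0 l ^+ j * _]mulrC.
  rewrite !unitmx_mul Pu unitmx_tr /= !unitmxE det_diag det_Vandermonde !unitfE.
  apply/andP; split.
    by move: Fw0; rewrite /F (eq_bigr (fun i => x^T 0 i)) // => i _; rewrite [RHS]mxE.
  rewrite prodf_seq_neq0; apply/allP => i _ /=; rewrite prodf_seq_neq0.
  apply/allP => j _; apply/implyP => ij; rewrite subr_eq0.
  by apply: contraTneq ij => /dinj ->; rewrite ltnn.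
exists (\sum_(j < n.+1) (invmx M *m w) j 0 *: 'X^j).
rewrite rmorph_sum mulmx_suml /= -[RHS](mulKVmx Mu); apply/matrixP => i l; rewrite ord1 summxE.
rewrite [RHS]mxE; apply: eq_bigr => j _.
by rewrite linearZ /= rmorphXn /= horner_mx_X -scalemxAl [M i j]mxE [LHS]mxE mulrC.
Qed.

Lemma skew_adj_horner (k : fieldType) n (J Y : 'M[k]_n.+1) (f : {poly k}) :
    J \in unitmx -> Y^T *m J = - (J *m Y) ->
  (horner_mx Y f)^T *m J = J *m horner_mx Y (f \Po (- 'X)).
Proof.
move=> Ju Yskew; elim/poly_ind: f => [|f c IH].
  by rewrite comp_poly0 !rmorph0 trmx0 mul0mx mulmx0.
rewrite comp_polyD comp_polyM comp_polyX comp_polyC !rmorphD !rmorphM rmorphN /=.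
rewrite !horner_mx_X !horner_mx_C linearD /= mulmxDl mulmxDr tr_scalar_mx scalar_mxC.
congr (_ + _); rewrite -[horner_mx Y f * Y]/(horner_mx Y f *m Y) trmx_mul -mulmxA IH.
rewrite mulmxA Yskew mulNmx -mulmxA -mulmxN; congr (J *m _).
rewrite -[RHS]/(horner_mx Y (f \Po - 'X) *m - Y) mulmxN; congr (- _).
by have := congr1 (horner_mx Y) (mulrC 'X (f \Po - 'X)); rewrite !rmorphM /= horner_mx_X.
Qed.

Definition centralizes (k : fieldType) n (Y b : 'M[k]_n) : Prop := b *m Y = Y *m b.

(** All that is retained of the theory of algebraic groups: from here on the torus is a set of
    matrices over [k]. In the last clause [e] is the projection onto the kernel of [b], and
    ellipticity is what makes it self-adjoint. *)
Theorem elliptic_torus_structure (k : fieldType) (K : closedFieldType)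
    (iota : {rmorphism k -> K}) n (J : 'M[k]_n) (T : set 'M[K]_n)
    (SpJ := [set A : 'M[K]_n | A^T *m map_mx iota J *m A = map_mx iota J]) :
    [pchar k] =i pred0 -> algebraic_closure iota ->
    J^T = - J -> J \in unitmx -> is_torus iota T -> T `<=` SpJ ->
    (forall T', is_torus iota T' -> T' `<=` SpJ -> T `<=` T' -> T' = T) ->
    (forall S, is_split_torus iota S -> S `<=` T -> forall A B, S A -> SpJ B ->
       A *m B = B *m A) ->
  exists (Y : 'M[k]_n) (w0 : 'cV[k]_n),
    [/\ Y^T *m J = - (J *m Y), Y \in unitmx,
        forall b c, centralizes Y b -> centralizes Y c -> b *m c = c *m b,
        forall w, exists2 b, centralizes Y b & b *m w0 = w
      & forall g, T (map_mx iota g) <-> centralizes Y g /\ g^T *m J *m g = J] /\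
    forall b, centralizes Y b -> exists e,
      [/\ centralizes Y e, e *m e = e, e^T *m J = J *m e, b *m e = 0 & b + e \in unitmx].
Proof.
move=> k0 Kalg Jskew Ju Ttorus TSp Tmax Tell.
have K0 := iota_char0 iota k0.
have natK m : (m%:R == 0 :> K) = (m == 0%N) by apply: (pcharf0P K).1.
have two : 2%:R != 0 :> K by rewrite natK.
pose JK := map_mx iota J.
have JKskew : JK^T = - JK by rewrite /JK map_trmx Jskew map_mxN.
have JKu : JK \in unitmx by rewrite map_unitmx.
have [P Pu Peig] := torus_eigenbasis K0 Ttorus.
have [Tlin _] := Ttorus; have [_ [T1 TM TV]] := Tlin.
have Fadj t : T t -> exists2 t', T t' & t^T *m JK = JK *m t'.
  move=> Tt; exists (invmx t); first exact: TV.
  have tu := sympl_unitmx JKu (TSp t Tt).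
  by have := TSp t Tt; rewrite /SpJ /= -/JK => {2}<-; rewrite mulmxK.
have [YK [YKT YKskew YKsep]] : exists YK : 'M[K]_n, [/\ forall t, T t -> YK *m t = t *m YK,
    YK^T *m JK = - (JK *m YK) & separable_poly (char_poly YK)].
  have [r [V [V' [nE VV']]]] := darboux_eigenbasis two JKskew JKu Fadj Pu Peig.
  move: (T) (JK) V V' VV' JKskew.
  rewrite nE => T' JK' V V' VV' JKskew'.
  have QJ := isotropic_pair_std JKskew' VV'.
  have Qu := std_sympl_unitmx QJ.
  have [_ _ _ Ve V'e] := VV'.
  pose Q := row_mx V V'.
  (* The eigenvalues [1, ..., r] and their opposites are distinct in characteristic 0; being
     opposite on partners, they make the matrix skew for the form. *)
  pose lam : 'rV[K]_r := \row_i (i.+1)%:R.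
  pose D := diag_mx (row_mx lam (- lam)).
  exists (Q *m D *m invmx Q); split.
  - move=> t /[dup] /Ve[d Vd] /V'e[d' V'd'].
    have tQ : t *m Q = Q *m diag_mx (row_mx d d').
      by rewrite mul_mx_row Vd V'd' diag_mx_row mul_row_block !mulmx0 addr0 add0r.
    have -> : t = Q *m diag_mx (row_mx d d') *m invmx Q by rewrite -tQ mulmxK.
    rewrite !mulmxA !mulmxKV // -!(mulmxA Q) !mulmx_diag.
    by congr (Q *m (diag_mx _ *m _)); apply/rowP => i; rewrite !mxE mulrC.
  - have JE : JK' = (invmx Q)^T *m block_mx 0 1%:M (- 1%:M) 0 *m invmx Q.
      by rewrite -QJ trmx_inv !mulmxA mulVmx ?unitmx_tr // mul1mx mulmxK.
    rewrite JE !trmx_mul trmx_inv !mulmxA -(mulmxA _ Q^T) mulmxV ?unitmx_tr // mulmx1.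
    rewrite mulmxKV // -!(mulmxA (invmx Q^T)) -mulmxN; congr (_ *m _).
    rewrite -mulNmx; congr (_ *m _).
    rewrite tr_diag_mx /D diag_mx_row !mulmx_block !(mulmx0, mul0mx, addr0, add0r, mulmx1, mul1mx).
    have -> : diag_mx (- lam) = - diag_mx lam by apply/matrixP => a b; rewrite !mxE mulNrn.
    by rewrite opp_block_mx !(mulmxN, mulNmx, mulmx1, mul1mx, opprK, oppr0).
  - rewrite separable_char_poly_diag //; apply/injectiveP => l j.
    rewrite -[l]splitK -[j]splitK; case: (fintype.split l) => a /=; case: (fintype.split j) => b /=;
      rewrite ?row_mxEl ?row_mxEr !mxE.
    + move=> /eqP; wlog ab : a b / (a <= b)%N.
        by move=> h; case/orP: (leq_total a b) => [/h//|/h]; rewrite eq_sym => h' /h' ->.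
      rewrite eq_sym -subr_eq0 -natrB // natK subSS subn_eq0 => ba.
      by congr lshift; apply/val_inj/anti_leq; rewrite ab ba.
    + move=> /eqP; rewrite -subr_eq0 opprK -natrD natK //.
    + move=> /eqP; rewrite eq_sym -subr_eq0 opprK -natrD natK //.
    + move=> /oppr_inj/eqP; wlog ab : a b / (a <= b)%N.
        by move=> h; case/orP: (leq_total a b) => [/h//|/h]; rewrite eq_sym => h' /h' ->.
      rewrite eq_sym -subr_eq0 -natrB // natK subSS subn_eq0 => ba.
      by congr rshift; apply/val_inj/anti_leq; rewrite ab ba.
have [N [c [Z [YKE ZT Zskew]]]] := descent_commuting_skew k0 Kalg Tlin YKT YKskew.
move: YKsep; rewrite YKE => /(generic_separable k0)[d sepY].
set Y := \sum_i d i *: Z i in sepY.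
have Yskew : Y^T *m J = - (J *m Y).
  rewrite /Y linear_sum /= mulmx_suml mulmx_sumr -sumrN; apply: eq_bigr => i _.
  by rewrite linearZ /= -scalemxAl -scalemxAr Zskew scalerN.
have YT t : T t -> t *m map_mx iota Y = map_mx iota Y *m t.
  move=> Tt; rewrite /Y raddf_sum /= mulmx_suml mulmx_sumr; apply: eq_bigr => i _.
  by rewrite map_mxZ -scalemxAl -scalemxAr ZT.
have [torY Yu] := sympl_centralizer_torus iota k0 Jskew Ju Yskew sepY.
have TE : sympl_centralizer JK (map_mx iota Y) = T.
  apply: Tmax => //; first by move=> A [].
  by move=> t Tt; split; [apply: YT|apply: TSp].
have Tg g : T (map_mx iota g) <-> centralizes Y g /\ g^T *m J *m g = J.
  rewrite -TE; split=> [[gY gJ]|[gY gJ]].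
    split; apply: (map_mx_inj (f := iota)); rewrite !map_mxM //.
    by rewrite -map_trmx.
  by split; rewrite ?map_trmx -!map_mxM ?gY // gJ.
have Ycomm b c' : centralizes Y b -> centralizes Y c' -> b *m c' = c' *m b.
  exact: separable_centralizer_comm iota _ _ _ _ sepY.
have {}Tell S : is_split_torus iota S -> S `<=` T -> forall A B, S A ->
    B^T *m map_mx iota J *m B = map_mx iota J -> A *m B = B *m A := Tell S.
have {}TE : sympl_centralizer (map_mx iota J) (map_mx iota Y) = T := TE.
case: n J T SpJ Jskew Ju Ttorus TSp Tmax Tell JK JKskew JKu P Pu Peig Tlin T1 TM TV Fadj YK YKT YKskew
  Z YKE ZT Zskew Y sepY Yskew YT torY Yu TE Tg Ycomm => [|n] J T SpJ Jskew Ju Ttorus TSp Tmax Tell JK JKskew JKu P Pu Peig Tlin T1 TM TV Fadj YK YKT YKskew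
  Z YKE ZT Zskew Y sepY Yskew YT torY Yu TE Tg Ycomm.
  exists Y, 0; split; first split=> //.
    by move=> w; exists 0; [rewrite /centralizes mul0mx mulmx0|apply/matrixP => -[]].
  move=> b bY; exists 0; split; rewrite /centralizes ?mul0mx ?mulmx0 ?trmx0 ?mul0mx //.
  by rewrite unitmxE det_mx00 unitr1.
have [w0 w0cyc] := separable_cyclic iota k0 sepY.
have cenH f : centralizes Y (horner_mx Y f).
  by have := congr1 (horner_mx Y) (mulrC f 'X); rewrite !rmorphM /= horner_mx_X.
exists Y, w0; split; first split=> //.
  by move=> w; have [f fw] := w0cyc w; exists (horner_mx Y f).
(* A commuting matrix is determined by its value on the cyclic vector, so the commutant of [Y]
   consists of the polynomials in [Y]. *)
have cenP b : centralizes Y b -> exists f, b = horner_mx Y f.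
  move=> bY; have [f fb] := w0cyc (b *m w0); exists f.
  apply/eqP; rewrite -subr_eq0; apply/eqP; set h := b - _.
  have hY : centralizes Y h by rewrite /centralizes mulmxBl mulmxBr bY cenH.
  have hw0 : h *m w0 = 0 by rewrite mulmxBl fb subrr.
  have h0 (w : 'cV[k]_n.+1) : h *m w = 0.
    have [f' <-] := w0cyc w; rewrite mulmxA (Ycomm _ _ hY (cenH f')) -mulmxA hw0.
    by rewrite mulmx0.
  by rewrite -[h]mulmx1; apply/matrixP => i j; have /matrixP/(_ i 0) := h0 (col j 1%:M);
    rewrite colE mulmxA -colE mxE => ->; rewrite !mxE.
have idem_sym f : horner_mx Y f *m horner_mx Y f = horner_mx Y f ->
    (horner_mx Y f)^T *m J = J *m horner_mx Y f.
  move=> ff.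
  have adjE : invmx J *m (horner_mx Y f)^T *m J = horner_mx Y (f \Po - 'X).
    by rewrite -mulmxA skew_adj_horner // mulKmx.
  have cenI h : centralizes Y h -> centralizes Y (1%:M - h).
    by move=> hY; rewrite /centralizes mulmxBl mulmxBr mul1mx mulmx1 hY.
  have cenM h h' : centralizes Y h -> centralizes Y h' -> centralizes Y (h *m h').
    by move=> hY hY'; rewrite /centralizes -mulmxA hY' !mulmxA hY.
  apply: (@elliptic_idempotent k K iota n.+1 J T (centralizes Y)) => //.
  - move=> e1 e2 a e1Y e2Y e1J e2J e11 e22 e12 e21 a0; rewrite -TE; split.
      rewrite /idem_torus_point !mulmxDl !mulmxDr -!scalemxAl -!scalemxAr -!map_mxM.
      by rewrite e1Y e2Y; congr (_ + map_mx _ _);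
        rewrite !mulmxBl !mulmxBr mul1mx mulmx1 e1Y e2Y.
    have adj : (idem_torus_point iota e1 e2 a a^-1)^T *m map_mx iota J =
        map_mx iota J *m idem_torus_point iota e1 e2 a^-1 a.
      rewrite /idem_torus_point !linearD /= !linearZ /= !mulmxDl -!scalemxAl.
      rewrite !map_trmx -!map_mxM e1J e2J [X in X + _ = _]addrC; congr (_ + map_mx _ _).
      by rewrite !linearB /= trmx1 !mulmxBl mul1mx mulmx1 e1J e2J addrAC.
    rewrite adj -mulmxA idem_torus_pointM // divff // mulVf // idem_torus_point1 mulmx1 //.
  - rewrite adjE; exact: cenM (cenH _) (cenI _ (cenH _)).
  - rewrite adjE; exact: cenM (cenH _) (cenI _ (cenH _)).
  - by rewrite adjE; apply: Ycomm.
move=> b /cenP[f ->].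
pose p := char_poly Y.
have p0 : p != 0 by rewrite monic_neq0 // char_poly_monic.
(* With [p = h * g], the element [u * h] is 1 modulo [g] and 0 modulo [h]. Hence its product with
   [f] is divisible by [p], and [f + u * h] is prime to [p], being 1 modulo [g] and equal to [f]
   modulo [h]. *)
pose g := gcdp f p; have [h pE] : exists h, p = h * g by apply/dvdpP; apply: dvdp_gcdr.
have : separable_poly (h * g) by rewrite -pE.
rewrite separable_mul => /and3P[_ _ hg].
have [[u v] /= uv] := Bezout_eq1_coprimepP _ _ hg.
have [f1 fE] : exists f1, f = f1 * g by apply/dvdpP; apply: dvdp_gcdl.
have pY0 : horner_mx Y p = 0 by apply: Cayley_Hamilton.
have phorn q : horner_mx Y (q * p) = 0 by rewrite rmorphM /= pY0 mulr0.
have ee : horner_mx Y (u * h) *m horner_mx Y (u * h) = horner_mx Y (u * h).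
  rewrite -[LHS]rmorphM /=; apply/eqP; rewrite -subr_eq0 -rmorphB /=.
  have -> : u * h * (u * h) - u * h = - (u * v) * p.
    rewrite -[X in _ - X]mulr1 -mulrBr -uv opprD addrA subrr sub0r pE.
    by rewrite !mulrN mulNr; congr (- _); rewrite -!mulrA; congr (_ * _); rewrite mulrCA.
  by rewrite phorn.
exists (horner_mx Y (u * h)); split=> //.
- exact: idem_sym.
- rewrite -[LHS]rmorphM /= {1}fE.
  have -> : f1 * g * (u * h) = f1 * u * p by rewrite pE -!mulrA; congr (_ * _); rewrite mulrCA (mulrC g).
  by rewrite phorn.
- rewrite -rmorphD /=.
  have cop : coprimep (f + u * h) p.
    rewrite coprimep_sym pE coprimepMl; apply/andP; split.
      rewrite addrC coprimep_addl_mul; apply/coprimepP => q qh qf.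
      have /coprimepP := hg; apply=> //; rewrite dvdp_gcd qf pE.
      exact: dvdp_mulr.
    have -> : f + u * h = (f1 - v) * g + 1.
      by rewrite -uv mulrBl -fE [u * h + v * g]addrC addrA subrK.
    by rewrite coprimep_addl_mul coprimep1.
  have [[u' v'] /= uv'] := Bezout_eq1_coprimepP _ _ cop.
  have : horner_mx Y (u' * (f + u * h) + v' * p) = 1 by rewrite uv' rmorph1.
  rewrite rmorphD /= phorn addr0 rmorphM /= => h1.
  exact: (proj2 (mulmx1_unit h1)).
Qed.

(** * Ultrametric norms *)

Section AbsoluteValue.
Variables (R : realType) (k : nonarchLocalFieldType R).
Local Notation av := (absv : k -> R).

Lemma absv0 : av 0 = 0.
Proof. by apply/eqP; rewrite absv_eq0. Qed.

Lemma absv1 : av 1 = 1.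
Proof.
have a1 : av 1 != 0 by rewrite absv_eq0 oner_eq0.
by apply: (mulfI a1); rewrite -absvM !mulr1.
Qed.

Lemma absvX x n : av (x ^+ n) = av x ^+ n.
Proof. by elim: n => [|n IH]; rewrite ?expr0 ?absv1 // !exprS absvM IH. Qed.

Lemma absvV x : av x^-1 = (av x)^-1.
Proof.
case: (eqVneq x 0) => [->|x0]; first by rewrite invr0 absv0 invr0.
have ax : av x != 0 by rewrite absv_eq0.
by apply: (mulfI ax); rewrite -absvM !divff // absv1.
Qed.

Lemma absvN1 : av (- 1) = 1.
Proof.
have : av (- 1) ^+ 2 = 1 by rewrite -absvX sqrrN expr1n absv1.
by move=> /eqP; rewrite sqrp_eq1 ?absv_ge0 // => /eqP.
Qed.

Lemma absvN x : av (- x) = av x.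
Proof. by rewrite -mulN1r absvM absvN1 mul1r. Qed.

Lemma absv_nat_le1 m : av m%:R <= 1.
Proof.
elim: m => [|m IH]; first by rewrite absv0 ler01.
rewrite -natr1; apply: le_trans (absvD_max _ _) _.
by rewrite ge_max IH absv1 lexx.
Qed.

Lemma absv_large M : exists2 c : k, c != 0 & M <= av c.
Proof.
have [x [x0 ax]] := @absv_nontrivial R k.
wlog x1 : x x0 ax / 1 < av x => [h|].
  case: (ltP 1 (av x)) => [/h|]; first exact.
  rewrite le_eqVlt (negbTE ax) /= => lt1; apply: (h x^-1).
  - by rewrite invr_eq0.
  - by rewrite absvV invr_eq1.
  - by rewrite absvV invf_gt1 // lt_neqAle eq_sym absv_eq0 x0 absv_ge0.
have bern m : 1 + m%:R * (av x - 1) <= av x ^+ m.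
  elim: m => [|m IH]; first by rewrite mul0r addr0 expr0.
  rewrite exprS; apply: le_trans (ler_wpM2l (absv_ge0 x) IH).
  rewrite -subr_ge0 -natr1.
  have -> : av x * (1 + m%:R * (av x - 1)) - (1 + (m%:R + 1) * (av x - 1)) =
    m%:R * (av x - 1) ^+ 2 by ring.
  by rewrite mulr_ge0 // sqr_ge0.
have d0 : 0 < av x - 1 by rewrite subr_gt0.
exists (x ^+ Num.bound (`|M| / (av x - 1))); first by rewrite expf_neq0.
rewrite absvX; apply: le_trans (bern _); apply: le_trans (ler_norm M) _.
rewrite -[X in X <= _]add0r lerD ?ler01 //.
rewrite -ler_pdivrMr //; apply/ltW/archi_boundP.
by rewrite divr_ge0 // ltW.
Qed.

Lemma absv_small e : 0 < e -> exists2 c : k, c != 0 & av c <= e.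
Proof.
move=> e0; have [c c0 ce] := absv_large e^-1; exists c^-1; first by rewrite invr_eq0.
rewrite absvV -[e]invrK lef_pV2 ?posrE ?invr_gt0 //.
by rewrite lt_neqAle eq_sym absv_eq0 c0 absv_ge0.
Qed.

End AbsoluteValue.

Section SupNorm.
Variables (R : realType) (k : nonarchLocalFieldType R).
Local Notation av := (absv : k -> R).

Definition nrm m n (A : 'M[k]_(m, n)) : R :=
  \big[Num.max/0]_(ij : 'I_m * 'I_n) av (A ij.1 ij.2).

Lemma nrm_ge0 m n (A : 'M[k]_(m, n)) : 0 <= nrm A.
Proof. by rewrite /nrm; elim/big_ind: _ => [//|x y x0 y0|ij _]; rewrite ?le_max ?x0 ?absv_ge0. Qed.

Lemma le_nrm m n (A : 'M[k]_(m, n)) i j : av (A i j) <= nrm A.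
Proof.
have : (i, j) \in index_enum _ by apply: mem_index_enum.
rewrite /nrm; elim: (index_enum _) => // a s IH; rewrite inE big_cons le_max.
by case/orP=> [/eqP<-|/IH ->]; rewrite ?lexx ?orbT.
Qed.

Lemma nrm_le m n (A : 'M[k]_(m, n)) r : 0 <= r ->
  (forall i j, av (A i j) <= r) -> nrm A <= r.
Proof.
move=> r0 Ar; rewrite /nrm; elim/big_ind: _ => // x y xr yr.
by rewrite ge_max xr yr.
Qed.

Lemma nrm_lt m n (A : 'M[k]_(m, n)) r : 0 < r ->
  (forall i j, av (A i j) < r) -> nrm A < r.
Proof.
move=> r0 Ar; rewrite /nrm; elim/big_ind: _ => // x y xr yr.
by rewrite gt_max xr yr.
Qed.

Lemma nrm_attained m n (A : 'M[k]_(m, n)) : A != 0 ->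
  exists i j, nrm A = av (A i j) /\ A i j != 0.
Proof.
move=> A0.
have : nrm A = 0 \/ exists i j, nrm A = av (A i j).
  rewrite /nrm; elim/big_ind: _ => [|x y xP yP|ij _]; first by left.
    by rewrite maxEle; case: ifP.
  by right; exists ij.1, ij.2.
have [i [j Aij]] : exists i j, A i j != 0.
  apply: contrapT => h; move/eqP: A0; apply; apply/matrixP => i j; rewrite mxE.
  by apply: contrapT => /eqP Aij; apply: h; exists i, j.
have nA : 0 < nrm A.
  by apply: lt_le_trans (le_nrm A i j); rewrite lt_neqAle eq_sym absv_eq0 Aij absv_ge0.
case=> [nA0|[a [b nE]]]; first by rewrite nA0 ltxx in nA.
by exists a, b; split=> //; rewrite -absv_eq0 -nE gt_eqF.
Qed.

Lemma nrm_eq0 m n (A : 'M[k]_(m, n)) : nrm A <= 0 -> A = 0.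
Proof.
move=> nA; apply: contrapT => /eqP /nrm_attained[i [j [nE Aij]]].
by move: nA; rewrite nE; apply/negP; rewrite -ltNge lt_neqAle eq_sym absv_eq0 Aij absv_ge0.
Qed.

Lemma nrm_gt0 m n (A : 'M[k]_(m, n)) : A != 0 -> 0 < nrm A.
Proof. by move=> A0; rewrite ltNge; apply: contra A0 => /nrm_eq0 ->. Qed.

Lemma nrm0 m n : nrm (0 : 'M[k]_(m, n)) = 0.
Proof.
by apply/le_anti; rewrite nrm_ge0 andbT; apply: nrm_le => // i j; rewrite mxE absv0.
Qed.

Lemma nrmN m n (A : 'M[k]_(m, n)) : nrm (- A) = nrm A.
Proof. by apply: eq_bigr => ij _; rewrite mxE absvN. Qed.

Lemma nrmD m n (A B : 'M[k]_(m, n)) : nrm (A + B) <= Num.max (nrm A) (nrm B).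
Proof.
apply: nrm_le => [|i j]; first by rewrite le_max nrm_ge0.
rewrite mxE; apply: le_trans (absvD_max _ _) _.
by rewrite ge_max !le_max !le_nrm orbT.
Qed.

Lemma nrmD_le m n (A B : 'M[k]_(m, n)) r : nrm A <= r -> nrm B <= r -> nrm (A + B) <= r.
Proof. by move=> Ar Br; apply: le_trans (nrmD A B) _; rewrite ge_max Ar Br. Qed.

Lemma nrmB_le m n (A B : 'M[k]_(m, n)) r : nrm A <= r -> nrm B <= r -> nrm (A - B) <= r.
Proof. by move=> Ar Br; apply: nrmD_le => //; rewrite nrmN. Qed.

Lemma nrmB_lt m n (A B : 'M[k]_(m, n)) r : nrm A < r -> nrm B < r -> nrm (A - B) < r.
Proof.
by move=> Ar Br; apply: le_lt_trans (nrmD A (- B)) _; rewrite gt_max nrmN Ar Br.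
Qed.

Lemma nrmBC m n (A B : 'M[k]_(m, n)) : nrm (A - B) = nrm (B - A).
Proof. by rewrite -nrmN opprB. Qed.

Lemma nrm_sum m n I (s : seq I) (F : I -> 'M[k]_(m, n)) r : 0 <= r ->
  (forall i, nrm (F i) <= r) -> nrm (\sum_(i <- s) F i) <= r.
Proof.
move=> r0 Fr; elim/big_ind: _ => [||//]; first by rewrite nrm0.
by move=> A B; apply: nrmD_le.
Qed.

Lemma nrmZ m n c (A : 'M[k]_(m, n)) : nrm (c *: A) <= av c * nrm A.
Proof.
apply: nrm_le => [|i j]; first by rewrite mulr_ge0 ?absv_ge0 ?nrm_ge0.
by rewrite mxE absvM ler_wpM2l ?absv_ge0 ?le_nrm.
Qed.

(** No factor [n] appears, since the ultrametric inequality bounds a sum by its largest term. *)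
Lemma nrmM m n l (A : 'M[k]_(m, n)) (B : 'M[k]_(n, l)) : nrm (A *m B) <= nrm A * nrm B.
Proof.
have r0 : 0 <= nrm A * nrm B by rewrite mulr_ge0 ?nrm_ge0.
apply: nrm_le => // i j; rewrite mxE; elim/big_ind: _ => [|x y xr yr|a _].
- by rewrite absv0.
- by apply: le_trans (absvD_max _ _) _; rewrite ge_max xr yr.
- by rewrite absvM ler_pM ?absv_ge0 ?le_nrm.
Qed.

Lemma nrmM_le m n l (A : 'M[k]_(m, n)) (B : 'M[k]_(n, l)) a b :
  nrm A <= a -> nrm B <= b -> nrm (A *m B) <= a * b.
Proof. by move=> Aa Bb; apply: le_trans (nrmM A B) _; rewrite ler_pM ?nrm_ge0. Qed.

Lemma nrm_tr m n (A : 'M[k]_(m, n)) : nrm A^T = nrm A.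
Proof.
apply/le_anti; apply/andP; split; apply: nrm_le; rewrite ?nrm_ge0 // => i j.
  by rewrite mxE le_nrm.
by have := le_nrm A^T j i; rewrite mxE.
Qed.

Lemma nrm1_le n : nrm (1%:M : 'M[k]_n) <= 1.
Proof.
apply: nrm_le => // i j; rewrite mxE; case: eqP => _; rewrite ?absv1 ?absv0 //.
Qed.

Lemma nrm_mxvec m n (A : 'M[k]_(m, n)) : nrm (mxvec A) = nrm A.
Proof.
apply/le_anti; apply/andP; split; apply: nrm_le; rewrite ?nrm_ge0 // => i j.
  by rewrite ord1; case/mxvec_indexP: j => a b; rewrite mxvecE le_nrm.
by rewrite -(mxvecE A) le_nrm.
Qed.

Lemma nbhs_nrm m n (A : 'M[k]_(m, n)) (U : set 'M[k]_(m, n)) :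
  nbhs A U <-> exists2 e, 0 < e & forall B, nrm (B - A) < e -> U B.
Proof.
split=> [[P PA PU]|[e e0 eU]].
  have /(boolp.choice) [e eP] : forall ij : 'I_m * 'I_n, exists e : R,
      0 < e /\ forall x, av (x - A ij.1 ij.2) < e -> P ij.1 ij.2 x.
    move=> [i j]; have := PA i j; rewrite nbhs_absv => -[e /= e0 eP]; exists e; split=> // x xe.
    by apply: eP; rewrite /ball_ /= -opprB absvN.
  pose e1 := \big[Num.min/1]_ij e ij.
  have e1P : 0 < e1 /\ forall ij, e1 <= e ij.
    split; first by rewrite /e1; elim/big_ind: _ => // [x y x0 y0|ij _]; [rewrite lt_min x0|have [] := eP ij].
    by move=> ij; rewrite /e1 (bigD1 ij) //= ge_min lexx.
  exists e1; first by case: e1P.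
  move=> B BA; apply: PU => i j; have [_ h] := eP (i, j); apply: h => /=.
  apply: lt_le_trans (e1P.2 (i, j)); apply: le_lt_trans BA.
  by have := le_nrm (B - A) i j; rewrite !mxE.
exists (fun i j => [set x | av (x - A i j) < e]) => [i j|B BP].
  by rewrite nbhs_absv; exists e => // x; rewrite /ball_ /= -opprB absvN.
by apply: eU; apply: nrm_lt => // i j; rewrite !mxE; exact: BP.
Qed.

End SupNorm.

Section Compactness.
Variables (R : realType) (k : nonarchLocalFieldType R).
Local Notation av := (absv : k -> R).

Definition pointed_field := (k : Type).
HB.instance Definition _ := Topological.copy pointed_field k.
HB.instance Definition _ := isPointed.Build pointed_field (0 : k).

Lemma compact_ball : exists2 r : R, 0 < r & compact [set x : k | av x <= r].
Proof.
have [U UF [Uco _]] := @absv_locally_compact R k 0 I.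
have : nbhs (0 : k) U by move: UF; rewrite /within /=; apply: filterS => x; apply.
rewrite nbhs_absv => -[e /= e0 eU]; exists (e / 2); first by rewrite divr_gt0.
apply: subclosed_compact Uco _; last first.
  move=> x /= xe; apply: eU; rewrite /ball_ /= sub0r absvN; apply: le_lt_trans xe _.
  by rewrite ltr_pdivrMr // ltr_pMr // ltr1n.
move=> x xcl /=; rewrite leNgt; apply/negP => ex.
have /xcl[y [/= ye xy]] : nbhs x [set y | av (x - y) < av x].
  by rewrite nbhs_absv; exists (av x) => //; apply: lt_trans ex; rewrite divr_gt0.
have : av x <= Num.max (av (x - y)) (av y) by rewrite -{1}(subrK y x) absvD_max.
rewrite le_max => /orP[|xy']; first by rewrite leNgt xy.
by have := le_lt_trans (le_trans xy' ye) ex; rewrite ltxx.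
Qed.

(** The form in which compactness is used: a cover by balls with radii depending on the centres has
    a finite subcover. A large ball is first scaled into a product of small compact balls. *)
Lemma rV_gauge_cover n r (g : 'rV[k]_n -> R) : (forall x, 0 < g x) ->
  exists s : seq 'rV[k]_n, forall x, nrm x <= r -> exists2 y, y \in s & nrm y <= r /\ nrm (x - y) < g y.
Proof.
move=> g0; have [r1 r10 r1co] := compact_ball.
wlog rr1 : r g g0 / r <= r1 => [h|].
  have [c c0 cr] := absv_large k (`|r| / r1).
  have ac : 0 < av c by rewrite lt_neqAle eq_sym absv_eq0 c0 absv_ge0.
  have [||s sP] := h (r / av c) (fun x => g (c *: x) / av c).
  - by move=> x; rewrite divr_gt0.
  - rewrite ler_pdivrMr //; apply: le_trans (ler_norm r) _.
    by move: cr; rewrite ler_pdivrMr // mulrC.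
  have nZ (y : 'rV[k]_n) : nrm (c *: y) = av c * nrm y.
    apply/le_anti; rewrite nrmZ /= mulrC -ler_pdivlMr //.
    by have := nrmZ c^-1 (c *: y); rewrite scalerK // absvV mulrC.
  exists [seq c *: y | y <- s] => x xr.
  have [|y ys [yr xy]] := sP (c^-1 *: x).
    by apply: le_trans (nrmZ _ _) _; rewrite absvV mulrC ler_pM2r ?invr_gt0.
  exists (c *: y); first exact: map_f.
  split; first by rewrite nZ mulrC -ler_pdivlMr.
  have -> : x - c *: y = c *: (c^-1 *: x - y) by rewrite scalerBr scalerA divff // scale1r.
  by rewrite nZ mulrC -ltr_pdivlMr.
have co : compact [set x : 'rV[k]_n | forall i, [set x : k | av x <= r1] (x ord0 i)].
  exact: (@rV_compact pointed_field n (fun=> [set x : k | av x <= r1])).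
have rco : compact [set x : 'rV[k]_n | nrm x <= r].
  apply: subclosed_compact co _; last first.
    by move=> x /= xr i; apply: le_trans (le_nrm x 0 i) _; apply: le_trans rr1.
  move=> x xcl /=; rewrite leNgt; apply/negP => rx.
  case: (ltP 0 (nrm x)) => [x0|x0]; last first.
    have /xcl[y [/= yr _]] : nbhs x setT by apply: filterT.
    by have := le_lt_trans (le_trans (nrm_ge0 y) yr) (lt_le_trans rx x0); rewrite ltxx.
  have /xcl[y [/= yr xy]] : nbhs x [set y | nrm (y - x) < nrm x].
    by apply/nbhs_nrm; exists (nrm x).
  have : nrm x <= Num.max (nrm (x - y)) (nrm y) by rewrite -{1}(subrK y x) nrmD.
  rewrite le_max nrmBC => /orP[|xy']; first by rewrite leNgt xy.
  by have := le_lt_trans (le_trans xy' yr) rx; rewrite ltxx.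
have : @compact ('rV[pointed_field]_n : ptopologicalType) [set x : 'rV[k]_n | nrm x <= r] := rco.
rewrite compact_cover => /(_ _ [set x | nrm x <= r] (fun y => [set x | nrm (x - y) < g y])).
case.
- move=> y /= yr; rewrite openE => x /= xy; apply/nbhs_nrm; exists (g y) => // z zx /=.
  have -> : z - y = (z - x) - (y - x) by rewrite opprB addrA subrK.
  by apply: nrmB_lt; rewrite // nrmBC.
- by move=> x xr; exists x => //=; rewrite subrr nrm0.
move=> D Dr Dcov; exists (finmap.enum_fset D) => x xr.
have [y /= yD xy] := Dcov x xr; exists y => //; split=> //.
by have := Dr y yD; rewrite inE.
Qed.

Lemma gauge_cover m n r (g : 'M[k]_(m, n) -> R) : (forall x, 0 < g x) ->
  exists s : seq 'M[k]_(m, n), forall x, nrm x <= r ->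
    exists2 y, y \in s & nrm y <= r /\ nrm (x - y) < g y.
Proof.
move=> g0; have [|s sP] := @rV_gauge_cover _ r (fun v => g (vec_mx v)); first by move=> x.
exists [seq vec_mx v | v <- s] => x xr.
have [|y ys [yr xy]] := sP (mxvec x); first by rewrite nrm_mxvec.
exists (vec_mx y); first exact: map_f.
by rewrite -(nrm_mxvec (vec_mx y)) -(nrm_mxvec (x - _)) linearB /= vec_mxK.
Qed.

(** This takes the place of the argument that a positive continuous function on a compact set is
    bounded below. *)
Lemma ball_uniform m n r (P : 'M[k]_(m, n) -> R -> Prop) :
    (forall y d d', P y d -> d' <= d -> P y d') ->
    (forall y, nrm y <= r -> exists e d, [/\ 0 < e, 0 < d &
       forall y', nrm y' <= r -> nrm (y' - y) < e -> P y' d]) ->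
  exists2 d, 0 < d & forall y, nrm y <= r -> P y d.
Proof.
move=> Pmono Ploc.
have /boolp.choice[f fP] : forall y, exists ed : R * R, [/\ 0 < ed.1, 0 < ed.2 &
    nrm y <= r -> forall y', nrm y' <= r -> nrm (y' - y) < ed.1 -> P y' ed.2].
  move=> y; case: (pselect (nrm y <= r)) => [yr|yr]; last by exists (1, 1).
  by have [e [d [e0 d0 h]]] := Ploc y yr; exists (e, d).
have [|s sP] := @gauge_cover m n r (fun y => (f y).1).
  by move=> y; have [] := fP y.
have [d d0 ds] : exists2 d, 0 < d & forall y, y \in s -> d <= (f y).2.
  elim: (s) => [|y s' [d d0 dP]]; first by exists 1.
  have [_ fy _] := fP y.
  exists (Num.min d (f y).2); first by rewrite lt_min d0 fy.
  move=> z; rewrite inE => /orP[/eqP->|/dP zd]; first by rewrite ge_min lexx orbT.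
  by rewrite ge_min zd.
exists d => // x xr; have [y ys [yr xy]] := sP x xr.
by have [_ _ h] := fP y; apply: Pmono (h yr x xr xy) (ds y ys).
Qed.

End Compactness.

(** * The adjoint involution *)

(* Locked, so that [mulmxA] does not unfold it. *)
HB.lock Definition adj (k : fieldType) n (J b : 'M[k]_n) : 'M[k]_n := invmx J *m b^T *m J.

Section Adjoint.
Variables (k : fieldType) (n : nat) (J : 'M[k]_n).
Hypothesis Jskew : J^T = - J.
Hypothesis Ju : J \in unitmx.

Local Notation adj := (adj J).

Lemma adjP b : b^T *m J = J *m adj b.
Proof. by rewrite unlock !mulmxA mulmxV // mul1mx. Qed.

Lemma adj_uniq b c : b^T *m J = J *m c -> adj b = c.
Proof. by rewrite adjP => /(congr1 (mulmx (invmx J))); rewrite !mulKmx. Qed.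

Lemma adjK b : adj (adj b) = b.
Proof.
apply: adj_uniq; have /(congr1 trmx) := adjP b.
by rewrite !trmx_mul trmxK Jskew mulNmx mulmxN => /oppr_inj ->.
Qed.

Lemma adjM b c : adj (b *m c) = adj c *m adj b.
Proof. by apply: adj_uniq; rewrite trmx_mul -mulmxA adjP mulmxA adjP mulmxA. Qed.

Lemma adjD b c : adj (b + c) = adj b + adj c.
Proof. by apply: adj_uniq; rewrite linearD /= mulmxDl !adjP mulmxDr. Qed.

Lemma adjN b : adj (- b) = - adj b.
Proof. by apply: adj_uniq; rewrite linearN /= mulNmx adjP mulmxN. Qed.

Lemma adjZ a b : adj (a *: b) = a *: adj b.
Proof. by apply: adj_uniq; rewrite linearZ /= -scalemxAl adjP scalemxAr. Qed.

Lemma adj1 : adj 1%:M = 1%:M.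
Proof. by apply: adj_uniq; rewrite trmx1 mul1mx mulmx1. Qed.

Lemma adj0 : adj 0 = 0.
Proof. by apply: adj_uniq; rewrite trmx0 mul0mx mulmx0. Qed.

Lemma adj_sum I (s : seq I) (F : I -> 'M[k]_n) :
  adj (\sum_(i <- s) F i) = \sum_(i <- s) adj (F i).
Proof.
elim: s => [|i s IH]; first by rewrite !big_nil adj0.
by rewrite !big_cons adjD IH.
Qed.

Lemma adjV b : b \in unitmx -> adj (invmx b) = invmx (adj b).
Proof.
move=> bu; have h : adj b *m adj (invmx b) = 1%:M by rewrite -adjM mulVmx // adj1.
have [abu _] := mulmx1_unit h.
by rewrite -[LHS](mulKmx abu) h mulmx1.
Qed.

Lemma adj_unitmx b : (adj b \in unitmx) = (b \in unitmx).
Proof. by rewrite unlock !unitmx_mul unitmx_inv Ju unitmx_tr andbT. Qed.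

Lemma symplE g : g^T *m J *m g = J <-> adj g *m g = 1%:M.
Proof.
rewrite adjP -mulmxA; split=> [gJ|->]; last by rewrite mulmx1.
by rewrite -[LHS](mulKmx Ju) gJ mulVmx.
Qed.

End Adjoint.

Section Commutant.
Variables (k : fieldType) (n : nat) (Y : 'M[k]_n).
Local Notation cen := (centralizes Y).

Lemma cenM b c : cen b -> cen c -> cen (b *m c).
Proof. by move=> bY cY; rewrite /centralizes -mulmxA cY !mulmxA bY. Qed.

Lemma cenD b c : cen b -> cen c -> cen (b + c).
Proof. by move=> bY cY; rewrite /centralizes mulmxDl mulmxDr bY cY. Qed.

Lemma cenN b : cen b -> cen (- b).
Proof. by move=> bY; rewrite /centralizes mulNmx mulmxN bY. Qed.

Lemma cenZ a b : cen b -> cen (a *: b).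
Proof. by move=> bY; rewrite /centralizes -scalemxAl -scalemxAr bY. Qed.

Lemma cen1 : cen 1%:M.
Proof. by rewrite /centralizes mul1mx mulmx1. Qed.

Lemma cen_self : cen Y. Proof. by []. Qed.

Lemma cenV b : cen b -> cen (invmx b).
Proof.
move=> bY; case: (boolP (b \in unitmx)) => bu; last by rewrite invmx_out.
by rewrite /centralizes -[LHS](mulmxK bu) -(mulmxA (invmx b)) -bY mulKmx.
Qed.

Lemma cen_sum I (s : seq I) (F : I -> 'M[k]_n) :
  (forall i, cen (F i)) -> cen (\sum_(i <- s) F i).
Proof.
move=> Fc; elim: s => [|i s IH]; rewrite ?big_nil ?big_cons; last exact: cenD.
by rewrite /centralizes mul0mx mulmx0.
Qed.

Lemma cen_adj (J b : 'M[k]_n) : J^T = - J -> J \in unitmx -> Y^T *m J = - (J *m Y) ->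
  cen b -> cen (adj J b).
Proof.
move=> Jskew Ju Yskew bY.
have aY : adj J Y = - Y by apply: adj_uniq => //; rewrite Yskew mulmxN.
have := congr1 (adj J) bY; rewrite !adjM // aY mulNmx mulmxN => /oppr_inj h.
by rewrite /centralizes h.
Qed.

End Commutant.

Section Anisotropic.
Variables (k : fieldType) (n : nat) (J Y : 'M[k]_n) (w0 : 'cV[k]_n).
Local Notation cen := (centralizes Y).
Hypothesis Jskew : J^T = - J.
Hypothesis Ju : J \in unitmx.
Hypothesis two_neq0 : 2%:R != 0 :> k.
Hypothesis Yskew : Y^T *m J = - (J *m Y).
Hypothesis Ccomm : forall b c, cen b -> cen c -> b *m c = c *m b.
Hypothesis Ccyc : forall w, exists2 b, cen b & b *m w0 = w.
Hypothesis Cidem : forall b, cen b -> exists e,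
  [/\ cen e, e *m e = e, e^T *m J = J *m e, b *m e = 0 & b + e \in unitmx].

Definition Tset : set 'M[k]_n := [set g | cen g /\ g^T *m J *m g = J].

Let Cadj b : cen b -> cen (adj J b).
Proof. exact: cen_adj. Qed.

Lemma adjY : adj J Y = - Y.
Proof. by apply: adj_uniq => //; rewrite Yskew mulmxN. Qed.

Lemma Tset1 : Tset 1%:M.
Proof. by split; [apply: cen1|rewrite trmx1 mul1mx mulmx1]. Qed.

Lemma TsetM g h : Tset g -> Tset h -> Tset (g *m h).
Proof.
move=> [gY gJ] [hY hJ]; split; first exact: cenM.
by rewrite trmx_mul !mulmxA -(mulmxA h^T) -(mulmxA h^T) gJ hJ.
Qed.

Lemma Tset_unitmx g : Tset g -> g \in unitmx.
Proof. by move=> [_ /(sympl_unitmx Ju)]. Qed.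

Lemma TsetV g : Tset g -> Tset (invmx g).
Proof. by move=> [gY gJ]; split; [apply: cenV|apply: sympl_inv]. Qed.

Lemma idem_adj b e : cen b -> cen e -> e^T *m J = J *m e -> b *m e = 0 -> adj J b *m e = 0.
Proof.
move=> bY eY eJ be; have ae : adj J e = e by apply: adj_uniq.
by rewrite -{1}ae -adjM // Ccomm // be adj0.
Qed.

(** Since [b *m adj J b = 0], the product of [b + e] and its adjoint is [e]. The idempotent [e] is
    therefore invertible, and [b *m e = 0] gives [b = 0]. *)
Lemma anisotropic b : cen b -> b *m adj J b = 0 -> b = 0.
Proof.
move=> bY bb; have [e [eY ee eJ be beu]] := Cidem bY.
have ae : adj J e = e by apply: adj_uniq.
have abe := idem_adj bY eY eJ be.
have : (b + e) *m adj J (b + e) = e.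
  rewrite adjD // ae mulmxDl !mulmxDr bb be ee add0r (Ccomm eY (Cadj bY)) abe.
  by rewrite !add0r.
move=> /(congr1 (fun A => A \in unitmx)); rewrite unitmx_mul adj_unitmx // beu /= => /esym eu.
by rewrite -[b](mulmxK eu) be mul0mx.
Qed.

Lemma cyc_inj b : cen b -> b *m w0 = 0 -> b = 0.
Proof.
move=> bY bw; have b0 w : b *m w = 0 :> 'cV_n.
  by have [c cY <-] := Ccyc w; rewrite mulmxA Ccomm // -mulmxA bw mulmx0.
rewrite -[b]mulmx1; apply/matrixP => i j; have /matrixP/(_ i 0) := b0 (col j 1%:M).
by rewrite colE mulmxA -colE mxE => ->; rewrite !mxE.
Qed.

(* The witness is [b w0 |-> b^* w0]. *)
Lemma conjugation : exists S : 'M[k]_n,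
  [/\ S *m S = 1%:M, adj J S = - S, forall b, cen b -> S *m b = adj J b *m S
    & forall w : 'cV[k]_n, exists2 g, Tset g & S *m w = g *m w].
Proof.
have /boolp.choice[c cP] : forall j : 'I_n, exists b, cen b /\ b *m w0 = delta_mx j 0.
  by move=> j; have [b] := Ccyc (delta_mx j 0); exists b.
pose S := \matrix_(i, j) (adj J (c j) *m w0) i 0.
have Sb b : cen b -> S *m (b *m w0) = adj J b *m w0.
  move=> bY; pose x := b *m w0.
  have xE : x = \sum_j x j 0 *: (c j *m w0).
    apply/matrixP => i l; rewrite ord1 summxE (bigD1 i) //= big1 ?addr0 => [|j ji].
      by have [_ ->] := cP i; rewrite !mxE !eqxx mulr1.
    by have [_ ->] := cP j; rewrite !mxE eq_sym (negbTE ji) mulr0.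
  have bE : b = \sum_j x j 0 *: c j.
    apply/eqP; rewrite -subr_eq0; apply/eqP; apply: cyc_inj.
      apply: cenD => //; apply: cenN; apply: cen_sum => j; apply: cenZ.
      by have [] := cP j.
    rewrite mulmxBl -/x mulmx_suml {1}xE -sumrB big1 // => j _.
    by rewrite scalemxAl subrr.
  rewrite -/x {1}bE adj_sum // mulmx_suml; apply/matrixP => i l; rewrite ord1 summxE [LHS]mxE.
  by apply: eq_bigr => j _; rewrite adjZ // -scalemxAl [RHS]mxE [S i j]mxE mulrC.
have mx_ext (A B : 'M[k]_n) : (forall b, cen b -> A *m (b *m w0) = B *m (b *m w0)) -> A = B.
  move=> AB; rewrite -[A]mulmx1 -[B]mulmx1; apply/matrixP => i j.
  have [b bY bE] := Ccyc (col j 1%:M); have /matrixP/(_ i 0) := AB b bY.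
  by rewrite bE !colE !mulmxA -!colE !mxE.
exists S; split.
- by apply: mx_ext => b bY; rewrite mul1mx -mulmxA !Sb ?adjK //; apply: Cadj.
- apply: adj_uniq => //; apply: mx_ext => d dY; apply/matrixP => i l; rewrite ord1.
  have [b bY bE] := Ccyc (delta_mx i 0).
  suff : (b *m w0)^T *m (S^T *m J *m (d *m w0)) = (b *m w0)^T *m (J *m - S *m (d *m w0)).
    by rewrite bE trmx_delta -!rowE => /matrixP/(_ 0 0); rewrite [LHS]mxE [RHS]mxE.
  (* Antisymmetry of the form read on the cyclic vector: the pairing of [w0] with [x *m w0] changes
     sign when [x] is replaced by its adjoint. All pairings reduce to this one. *)
  have alt x : w0^T *m J *m x *m w0 = - (w0^T *m J *m adj J x *m w0).
    have -> : w0^T *m J *m x *m w0 = (w0^T *m J *m x *m w0)^T.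
      by apply/matrixP => a c'; rewrite !ord1 [RHS]mxE.
    rewrite !trmx_mul trmxK Jskew mulNmx !mulmxN; congr (- _).
    by rewrite -(mulmxA w0^T J) -adjP // !mulmxA.
  rewrite mulmxN mulNmx mulmxN -(mulmxA J S) Sb // !mulmxA -trmx_mul Sb //.
  rewrite !trmx_mul -(mulmxA w0^T _ J) adjP // adjK // -!(mulmxA w0^T) -!mulmxA.
  have := alt (b *m d); rewrite adjM // (Ccomm (Cadj dY) (Cadj bY)) -!mulmxA => ->.
  by congr (- (_ *m _)); rewrite !mulmxA adjP.
- move=> b bY; apply: mx_ext => d dY; rewrite -mulmxA (mulmxA b) Sb; last exact: cenM.
  by rewrite -mulmxA Sb // adjM // mulmxA (Ccomm (Cadj dY) (Cadj bY)).
- move=> w; have [b bY bw] := Ccyc w; have [e [eY ee eJ be beu]] := Cidem bY.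
  have ae : adj J e = e by apply: adj_uniq.
  have abe := idem_adj bY eY eJ be.
  have beY : cen (b + e) by apply: cenD.
  (* The quotient of the adjoint of a unit by this unit has norm one. [b] need not be a unit; adding
     [e] repairs this and leaves the effect on [b = (b + e)(1 - e)] unchanged. *)
  pose g := adj J (b + e) *m invmx (b + e).
  have gY : cen g by apply: cenM; [apply: Cadj|apply: cenV].
  have gb : g *m b = adj J b.
    have -> : g *m b = g *m ((b + e) *m (1%:M - e)).
      by congr (g *m _); rewrite mulmxBr mulmx1 mulmxDl be ee add0r addrK.
    by rewrite mulmxA /g mulmxKV // adjD // ae mulmxBr mulmx1 mulmxDl abe ee add0r addrK.
  exists g; last by rewrite -bw Sb // mulmxA gb.
  split=> //; apply/symplE => //.
  rewrite /g adjM // adjK // adjV // (Ccomm (Cadj beY) (cenV beY)).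
  rewrite mulmxA -(mulmxA (invmx (adj J (b + e)))) mulmxV // mulmx1 mulVmx //.
  by rewrite adj_unitmx.
Qed.

End Anisotropic.

Section MatrixUnits.
Variables (k : fieldType) (n : nat) (J Y S : 'M[k]_n).
Local Notation cen := (centralizes Y).
Hypothesis Jskew : J^T = - J.
Hypothesis Ju : J \in unitmx.
Hypothesis two_neq0 : 2%:R != 0 :> k.
Hypothesis Yskew : Y^T *m J = - (J *m Y).
Hypothesis Yu : Y \in unitmx.
Hypothesis Ccomm : forall b c, cen b -> cen c -> b *m c = c *m b.
Hypothesis SS : S *m S = 1%:M.
Hypothesis aS : adj J S = - S.
Hypothesis Sb : forall b, cen b -> S *m b = adj J b *m S.

(** As [Y] is skew and invertible and 2 is invertible, the commutant of [Y] is free over this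
    subalgebra with basis [1, Y]. *)
Definition Fix : set 'M[k]_n := [set x | cen x /\ adj J x = x].

(** [E11] and [E22] are the projections onto the eigenspaces of [S] for 1 and -1; [Y] anticommutes
    with [S], so [Y] and its inverse exchange the two and supply the off-diagonal matrix units. *)
Definition E11 := 2%:R^-1 *: (1%:M + S).
Definition E22 := 2%:R^-1 *: (1%:M - S).
Definition E12 := invmx Y *m E22.
Definition E21 := Y *m E11.

Let SY : S *m Y = - (Y *m S).
Proof. by rewrite Sb ?cen_self // adjY // mulNmx. Qed.

Lemma E11_E22 : E11 + E22 = 1%:M.
Proof.
rewrite -scalerDr addrACA subrr addr0 -mulr2n -scaler_nat scalerA mulVf //.
by rewrite scale1r.
Qed.

Lemma E11M : E11 *m E11 = E11.
Proof.
rewrite -scalemxAl -scalemxAr scalerA mulmxDl mul1mx mulmxDr mulmx1 SS.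
rewrite [S + 1%:M]addrC -mulr2n -scaler_nat scalerA -mulrA mulVf //.
by rewrite mulr1.
Qed.

Lemma E1122 : E11 *m E22 = 0.
Proof.
by rewrite -scalemxAl -scalemxAr mulmxDl mul1mx mulmxBr mulmx1 SS addrA subrK subrr !scaler0.
Qed.

Lemma E22M : E22 *m E22 = E22.
Proof. by rewrite -[RHS]mul1mx -E11_E22 mulmxDl E1122 add0r. Qed.

Lemma E2211 : E22 *m E11 = 0.
Proof.
have : (E11 + E22) *m E11 = E11 by rewrite E11_E22 mul1mx.
by rewrite mulmxDl E11M -{3}[E11]addr0 => /addrI.
Qed.

Lemma YE11 : Y *m E11 = E22 *m Y.
Proof. by rewrite -scalemxAl -scalemxAr mulmxDr mulmx1 mulmxBl mul1mx SY opprK. Qed.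

Lemma VE22 : invmx Y *m E22 = E11 *m invmx Y.
Proof. by rewrite -[LHS](mulmxK Yu) -(mulmxA (invmx Y)) -YE11 mulKmx. Qed.

Lemma E1112 : E11 *m E12 = E12.
Proof. by rewrite /E12 VE22 mulmxA E11M. Qed.
Lemma E2212 : E22 *m E12 = 0.
Proof. by rewrite /E12 VE22 mulmxA E2211 mul0mx. Qed.
Lemma E1222 : E12 *m E22 = E12.
Proof. by rewrite /E12 -mulmxA E22M. Qed.
Lemma E1211 : E12 *m E11 = 0.
Proof. by rewrite /E12 -mulmxA E2211 mulmx0. Qed.
Lemma E2221 : E22 *m E21 = E21.
Proof. by rewrite /E21 YE11 mulmxA E22M. Qed.
Lemma E1121 : E11 *m E21 = 0.
Proof. by rewrite /E21 YE11 mulmxA E1122 mul0mx. Qed.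
Lemma E2111 : E21 *m E11 = E21.
Proof. by rewrite /E21 -mulmxA E11M. Qed.
Lemma E2122 : E21 *m E22 = 0.
Proof. by rewrite /E21 -mulmxA E1122 mulmx0. Qed.
Lemma E1212 : E12 *m E12 = 0.
Proof. by rewrite {1}/E12 -mulmxA E2212 mulmx0. Qed.
Lemma E2121 : E21 *m E21 = 0.
Proof. by rewrite {1}/E21 -mulmxA E1121 mulmx0. Qed.
Lemma E1221 : E12 *m E21 = E11.
Proof. by rewrite /E12 -mulmxA E2221 /E21 mulKmx. Qed.
Lemma E2112 : E21 *m E12 = E22.
Proof. by rewrite /E21 -mulmxA E1112 /E12 mulKVmx. Qed.

Lemma Fix_comm x : Fix x ->
  [/\ E11 *m x = x *m E11, E22 *m x = x *m E22, E12 *m x = x *m E12 & E21 *m x = x *m E21].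
Proof.
move=> [xY ax]; have Sx : S *m x = x *m S by rewrite Sb // ax.
have h1 : E11 *m x = x *m E11 by rewrite -scalemxAl -scalemxAr mulmxDl mul1mx mulmxDr mulmx1 Sx.
have h2 : E22 *m x = x *m E22 by rewrite -scalemxAl -scalemxAr mulmxBl mul1mx mulmxBr mulmx1 Sx.
split=> //; rewrite /E12 /E21 -mulmxA ?h1 ?h2 !mulmxA; congr (_ *m _); last by rewrite -xY.
by apply: Ccomm => //; apply: cenV; apply: cen_self.
Qed.

Definition Phi (a b c d : 'M[k]_n) : 'M[k]_n := a *m E11 + b *m E12 + c *m E21 + d *m E22.

Lemma PhiM a b c d a' b' c' d' : Fix a' -> Fix b' -> Fix c' -> Fix d' ->
  Phi a b c d *m Phi a' b' c' d' =
  Phi (a *m a' + b *m c') (a *m b' + b *m d') (c *m a' + d *m c') (c *m b' + d *m d').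
Proof.
move=> Fa Fb Fc Fd.
have key (u x e f : 'M[k]_n) : e *m x = x *m e -> u *m e *m (x *m f) = u *m x *m (e *m f).
  by move=> ex; rewrite !mulmxA -(mulmxA u e) ex !mulmxA.
have [a1 a2 a3 a4] := Fix_comm Fa; have [b1 b2 b3 b4] := Fix_comm Fb.
have [c1 c2 c3 c4] := Fix_comm Fc; have [d1 d2 d3 d4] := Fix_comm Fd.
have ra : a *m E11 *m Phi a' b' c' d' = a *m a' *m E11 + a *m b' *m E12.
  by rewrite /Phi !mulmxDr (key _ _ _ _ a1) (key _ _ _ _ b1) (key _ _ _ _ c1) (key _ _ _ _ d1) E11M E1112 E1121 E1122 !mulmx0 !addr0.
have rb : b *m E12 *m Phi a' b' c' d' = b *m c' *m E11 + b *m d' *m E12.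
  by rewrite /Phi !mulmxDr (key _ _ _ _ a3) (key _ _ _ _ b3) (key _ _ _ _ c3) (key _ _ _ _ d3) E1211 E1212 E1221 E1222 !mulmx0 !add0r.
have rc : c *m E21 *m Phi a' b' c' d' = c *m a' *m E21 + c *m b' *m E22.
  by rewrite /Phi !mulmxDr (key _ _ _ _ a4) (key _ _ _ _ b4) (key _ _ _ _ c4) (key _ _ _ _ d4) E2111 E2112 E2121 E2122 !mulmx0 !addr0.
have rd : d *m E22 *m Phi a' b' c' d' = d *m c' *m E21 + d *m d' *m E22.
  by rewrite /Phi !mulmxDr (key _ _ _ _ a2) (key _ _ _ _ b2) (key _ _ _ _ c2) (key _ _ _ _ d2) E2211 E2212 E2221 E22M !mulmx0 !add0r.
rewrite {1}/Phi [LHS]mulmxDl [X in X + _ = _]mulmxDl [X in X + _ + _ = _]mulmxDl ra rb rc rd.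
rewrite /Phi !mulmxDl [X in X + _ + _ = _]addrACA -[LHS]addrA [X in _ + X = _]addrACA.
by rewrite -[RHS]addrA.
Qed.

Lemma Fix1 : Fix 1%:M.
Proof. by split; [apply: cen1|apply: adj1]. Qed.
Lemma Fix0 : Fix 0.
Proof. by split; [rewrite /centralizes mul0mx mulmx0|apply: adj0]. Qed.
Lemma FixD x y : Fix x -> Fix y -> Fix (x + y).
Proof. by move=> [xY ax] [yY ay]; split; [apply: cenD|rewrite adjD // ax ay]. Qed.
Lemma FixN x : Fix x -> Fix (- x).
Proof. by move=> [xY ax]; split; [apply: cenN|rewrite adjN // ax]. Qed.
Lemma FixZ a x : Fix x -> Fix (a *: x).
Proof. by move=> [xY ax]; split; [apply: cenZ|rewrite adjZ // ax]. Qed.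
Lemma FixM x y : Fix x -> Fix y -> Fix (x *m y).
Proof. by move=> [xY ax] [yY ay]; split; [apply: cenM|rewrite adjM // ax ay Ccomm]. Qed.
Lemma FixV x : x \in unitmx -> Fix x -> Fix (invmx x).
Proof. by move=> xu [xY ax]; split; [apply: cenV|rewrite adjV // ax]. Qed.

(** On 2x2 matrices over [Fix] the symplectic adjoint is the adjugate; matrices of determinant 1 are
    therefore symplectic. *)
Lemma adj_Phi a b c d : Fix a -> Fix b -> Fix c -> Fix d ->
  adj J (Phi a b c d) = Phi d (- b) (- c) a.
Proof.
move=> Fa Fb Fc Fd.
have [a1 a2 a3 a4] := Fix_comm Fa; have [b1 b2 b3 b4] := Fix_comm Fb.
have [c1 c2 c3 c4] := Fix_comm Fc; have [d1 d2 d3 d4] := Fix_comm Fd.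
have aE11 : adj J E11 = E22 by rewrite /E11 adjZ // adjD // adj1 // aS.
have aE22 : adj J E22 = E11 by rewrite /E22 adjZ // adjD // adj1 // adjN // aS opprK.
have aY := adjY Ju Yskew.
have aE21 : adj J E21 = - E21 by rewrite /E21 adjM // aE11 aY mulmxN YE11.
have NYu : - Y \in unitmx by rewrite -scaleN1r unitmxZ ?unitrN1.
have aE12 : adj J E12 = - E12.
  rewrite /E12 adjM // aE22 adjV // aY VE22; apply: (can_inj (mulmxK NYu)).
  by rewrite mulmxKV // mulNmx mulmxN opprK mulmxKV.
case: Fa Fb Fc Fd => [_ aa] [_ ab] [_ ac] [_ ad].
rewrite /Phi !adjD // (adjM Ju a) (adjM Ju b) (adjM Ju c) (adjM Ju d).
rewrite aa ab ac ad aE11 aE12 aE21 aE22 a2 d1.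
rewrite !mulNmx b3 c4 [LHS]addrC -(addrA (a *m E22)) (addrC (a *m E22)) !addrA.
by [].
Qed.

(* The elements [Phi a b c d] form a copy of the 2x2 matrices over [Fix], and
   a torus element is the matrix of multiplication by [a + bY]. *)
Lemma Tset_Phi t : Tset J Y t ->
  let a := 2%:R^-1 *: (t + adj J t) in
  let b := 2%:R^-1 *: ((t - adj J t) *m invmx Y) in
  [/\ Fix a, Fix b, t = Phi a (b *m (Y *m Y)) b a &
      a *m a - b *m (Y *m Y) *m b = 1%:M].
Proof.
move=> [tY tJ] a b.
have aY := adjY Ju Yskew.
have tY' : centralizes Y (adj J t) by apply: cen_adj.
have VY : centralizes Y (invmx Y) by apply: cenV; apply: cen_self.
have Fa : Fix a.
  split; first by apply: cenZ; apply: cenD.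
  by rewrite adjZ // adjD // adjK // addrC.
have Fb : Fix b.
  split; first by apply: cenZ; apply: cenM => //; apply: cenD => //; apply: cenN.
  rewrite adjZ // adjM // adjD // adjN // adjK // adjV // aY.
  have NYu : - Y \in unitmx by rewrite -scaleN1r unitmxZ ?unitrN1.
  have -> : invmx (- Y) = - invmx Y.
    have h : - Y *m - invmx Y = 1%:M by rewrite mulNmx mulmxN opprK mulmxV.
    by rewrite -[RHS](mulKmx NYu) h mulmx1.
  by rewrite mulNmx -mulmxN opprD opprK addrC Ccomm //; apply: cenD => //; apply: cenN.
have bY : b *m Y = 2%:R^-1 *: (t - adj J t) by rewrite -scalemxAl mulmxKV.
have tE : t = a + b *m Y.
  rewrite bY -scalerDr addrACA subrr addr0 -mulr2n -scaler_nat scalerA mulVf // scale1r //.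
have [_ bYc] : True /\ Fix (b *m (Y *m Y)).
  split=> //; apply: FixM => //; split; first by apply: cenM; apply: cen_self.
  by rewrite adjM // aY mulNmx mulmxN opprK.
split=> //.
  have h1 : b *m (Y *m Y) *m E12 = b *m Y *m E22.
    by rewrite /E12 -!mulmxA mulKVmx.
  have h2 : b *m E21 = b *m Y *m E11 by rewrite /E21 mulmxA.
  rewrite /Phi h1 h2 -(addrA (a *m E11)) (addrC (b *m Y *m E22)) -mulmxDr E11_E22 addrAC -mulmxDr E11_E22.
  by rewrite !mulmx1.
have at' : adj J t = a - b *m Y.
  rewrite bY -scalerBr opprB addrC addrA subrK -mulr2n -scaler_nat scalerA mulVf // scale1r //.
have tt : adj J t *m t = 1%:M by apply/(symplE Ju).
have [cb ca] : centralizes Y b /\ centralizes Y a by case: Fa Fb => ? _ [].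
have : (a - b *m Y) *m (a + b *m Y) = 1%:M by rewrite -at' -tE tt.
rewrite mulmxDr !mulmxBl (Ccomm (cenM cb (cen_self Y)) ca) addrA subrK => <-.
have -> : b *m Y *m (b *m Y) = b *m Y *m (Y *m b) by congr (_ *m _).
by clearbody b; rewrite !mulmxA.
Qed.

End MatrixUnits.

(** * Compactness and square roots *)

Section SmallPerturbation.
Variables (R : realType) (k : nonarchLocalFieldType R) (n : nat).

Lemma nrm_perturb (A B : 'M[k]_n) : nrm (B - A) < nrm A -> nrm A <= nrm B.
Proof.
move=> BA; have : nrm A <= Num.max (nrm (A - B)) (nrm B) by rewrite -{1}(subrK B A) nrmD.
by rewrite le_max nrmBC leNgt BA.
Qed.

Lemma one_plus_small (v : 'M[k]_n) : nrm v < 1 ->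
  1%:M + v \in unitmx /\ nrm (invmx (1%:M + v)) <= 1.
Proof.
move=> v1; have u : 1%:M + v \in unitmx.
  rewrite unitmxE unitfE; apply/negP => /det0P[x x0]; rewrite mulmxDr mulmx1 => /eqP.
  rewrite addr_eq0 => /eqP xE; have : nrm x < nrm x; last by rewrite ltxx.
  rewrite {1}xE nrmN; apply: le_lt_trans (nrmM _ _) _.
  by rewrite gtr_pMr ?nrm_gt0.
split=> //; rewrite leNgt; apply/negP; set m := invmx _ => m1.
have mE : m = 1%:M - v *m m by rewrite -(mulmxV u) -/m mulmxDl mul1mx addrK.
have : nrm m < nrm m; last by rewrite ltxx.
rewrite {1}mE; apply: le_lt_trans (nrmD _ _) _; rewrite nrmN gt_max.
rewrite (le_lt_trans (nrm1_le _ _) m1) /=; apply: le_lt_trans (nrmM _ _) _.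
by rewrite gtr_pMl // (lt_trans ltr01).
Qed.

End SmallPerturbation.

Section LocalTorus.
Variables (R : realType) (k : nonarchLocalFieldType R) (p : nat).
Variables (n : nat) (J Y : 'M[k]_n) (w0 : 'cV[k]_n).
Local Notation av := (absv : k -> R).
Local Notation cen := (centralizes Y).
Local Notation Tset := (Tset J Y).
Hypothesis pprime : prime p.
Hypothesis pres : av p%:R < 1.
Hypothesis p_neq2 : p <> 2%N.
Hypothesis Jskew : J^T = - J.
Hypothesis Ju : J \in unitmx.
Hypothesis two_neq0 : 2%:R != 0 :> k.
Hypothesis Yskew : Y^T *m J = - (J *m Y).
Hypothesis Yu : Y \in unitmx.
Hypothesis Ccomm : forall b c, cen b -> cen c -> b *m c = c *m b.
Hypothesis Ccyc : forall w, exists2 b, cen b & b *m w0 = w.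
Hypothesis Cidem : forall b, cen b -> exists e,
  [/\ cen e, e *m e = e, e^T *m J = J *m e, b *m e = 0 & b + e \in unitmx].

Lemma p_odd : odd p.
Proof. by case/even_prime: pprime => // p2; case: p_neq2. Qed.

(** As [p] is odd, 1 is [p] minus an even number, so [|2| < 1] would give [|1| < 1]. *)
Lemma absv2 : av 2%:R = 1.
Proof.
apply/le_anti; rewrite absv_nat_le1 leNgt; apply/negP => lt2.
have : av 1 < 1; last by rewrite absv1 ltxx.
have -> : 1 = p%:R - 2%:R * (p./2)%:R :> k.
  by rewrite -natrM mul2n -{1}(odd_double_half p) p_odd natrD addrK.
apply: le_lt_trans (absvD_max _ _) _; rewrite gt_max pres /= absvN absvM.
by apply: le_lt_trans lt2; rewrite ler_piMr ?absv_ge0 ?absv_nat_le1.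
Qed.

Let AJ := nrm (invmx J) * nrm J.

Lemma nrm_adj b : nrm (adj J b) <= AJ * nrm b.
Proof.
rewrite unlock; apply: le_trans (nrmM _ _) _.
rewrite /AJ -mulrA (mulrC (nrm J)) mulrA ler_wpM2r ?nrm_ge0 //.
by apply: le_trans (nrmM _ _) _; rewrite nrm_tr.
Qed.

Let AJ_ge0 : 0 <= AJ. Proof. by rewrite mulr_ge0 ?nrm_ge0. Qed.

Lemma not_cen_near y : ~ cen y -> exists2 e, 0 < e & forall y', nrm (y' - y) < e -> ~ cen y'.
Proof.
move=> ycen; pose D := y *m Y - Y *m y.
have D0 : 0 < nrm D by apply: nrm_gt0; rewrite subr_eq0; apply/eqP.
have Y1 : 0 < nrm Y + 1 by rewrite ltr_wpDl ?nrm_ge0.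
exists (nrm D / (nrm Y + 1)); first by rewrite divr_gt0.
move=> y' yy y'cen; have : nrm D < nrm D; last by rewrite ltxx.
have DE : D = Y *m (y' - y) - (y' - y) *m Y.
  by rewrite mulmxBl mulmxBr -y'cen opprB addrC addrA addrNK.
have lt : nrm (y' - y) * nrm Y < nrm D.
  apply: le_lt_trans (_ : nrm (y' - y) * (nrm Y + 1) < _).
    by rewrite ler_wpM2l ?nrm_ge0 // lerDl.
  by rewrite -ltr_pdivlMr.
rewrite {1}DE; apply: nrmB_lt; apply: le_lt_trans (nrmM _ _) _ => //.
by rewrite mulrC.
Qed.

(** By anisotropy and compactness, [y *m adj J y] has norm at least some [d > 0] for [y] of norm 1
    in the commutant. Dividing [g] by its largest entry [a] gives such a [y] with [y *m adj J y]
    equal to the scalar [a^-2], whence [|a|^2 <= 1/d]. *)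
Lemma Tset_bounded : exists2 C : R, 1 <= C & forall g, Tset g -> nrm g <= C.
Proof.
have A1 : 0 < AJ + 1 by rewrite ltr_wpDl.
have [||d d0 dP] := @ball_uniform R k n n 1
    (fun y d => cen y -> nrm y = 1 -> d <= nrm (y *m adj J y)).
- by move=> y d d' h dd' yc y1; apply: le_trans dd' (h yc y1).
- move=> y y1; case: (pselect (cen y)) => [yc|/not_cen_near[e e0 eP]]; last first.
    by exists e, 1; split=> // y' _ /eP h /h.
  case: (eqVneq y 0) => [->|y0].
    by exists 1, 1; split=> // y' _; rewrite subr0 => lt1 _ eq1; rewrite eq1 ltxx in lt1.
  pose N := y *m adj J y.
  have N0 : 0 < nrm N.
    by apply: nrm_gt0; apply: contra y0 => /eqP/(anisotropic Jskew Ju Yskew Ccomm Cidem yc)->.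
  exists (nrm N / (AJ + 1)), (nrm N); split=> //; first by rewrite divr_gt0.
  move=> y' y'1 yy _ _; apply: nrm_perturb.
  have -> : y' *m adj J y' - N = (y' - y) *m adj J y' + y *m adj J (y' - y).
    by rewrite adjD // adjN // mulmxBl mulmxBr addrA subrK.
  have lt : nrm (y' - y) * AJ < nrm N.
    apply: le_lt_trans (_ : nrm (y' - y) * (AJ + 1) < _); last by rewrite -ltr_pdivlMr.
    by rewrite ler_wpM2l ?nrm_ge0 // lerDl.
  apply: le_lt_trans (nrmD _ _) _; rewrite gt_max; apply/andP; split.
    apply: le_lt_trans (nrmM _ _) (le_lt_trans _ lt).
    rewrite ler_wpM2l ?nrm_ge0 //; apply: le_trans (nrm_adj _) _.
    by rewrite ler_piMr.
  apply: le_lt_trans (nrmM _ _) (le_lt_trans _ lt).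
  apply: le_trans (_ : 1 * (AJ * nrm (y' - y)) <= _); last by rewrite mul1r mulrC.
  by rewrite ler_pM ?nrm_ge0 ?nrm_adj.
exists (Num.max 1 d^-1); first by rewrite le_max lexx.
move=> g Tg; case: (eqVneq g 0) => [->|g0]; first by rewrite nrm0 le_max ler01.
have [i [j [gE gij]]] := nrm_attained g0; set a := g i j in gE gij.
have a0 : 0 < av a by rewrite lt_neqAle eq_sym absv_eq0 gij absv_ge0.
rewrite le_max; case: (leP (nrm g) 1) => //= g1.
have [gc gJ] := Tg.
have nz : nrm (a^-1 *: g) = 1.
  apply/le_anti; apply/andP; split.
    by apply: le_trans (nrmZ _ _) _; rewrite gE absvV mulVf ?gt_eqF.
  apply: le_trans (le_nrm _ i j); rewrite mxE -/a mulVf // absv1 //.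
have := dP (a^-1 *: g); rewrite nz => /(_ (lexx _) (cenZ _ gc) erefl).
rewrite adjZ // -scalemxAl -scalemxAr scalerA.
have /symplE gg := gJ; rewrite (mulmx1C (gg Ju)) => dle.
have {}dle : d <= (av a ^+ 2)^-1.
  apply: le_trans dle _; apply: le_trans (nrmZ _ _) _.
  rewrite absvM absvV expr2 invfM ler_piMr ?nrm1_le //.
  by rewrite mulr_ge0 // invr_ge0 ltW.
rewrite gE; apply: le_trans (_ : av a ^+ 2 <= _).
  by rewrite expr2 ler_peMl ?(ltW a0) // -gE ltW.
by rewrite -[X in X <= _]invrK lef_pV2 ?posrE ?invr_gt0 ?exprn_gt0.
Qed.

Lemma Tset_near1M (r : R) (g h : 'M[k]_n) : 0 <= r <= 1 -> nrm (g - 1%:M) <= r -> nrm (h - 1%:M) <= r ->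
  nrm (g *m h - 1%:M) <= r.
Proof.
move=> /andP[r0 r1] gr hr.
have -> : g *m h - 1%:M = (g - 1%:M) *m h + (h - 1%:M).
  by rewrite mulmxBl mul1mx addrA subrK.
apply: nrmD_le => //; apply: le_trans (nrmM _ _) _; rewrite -[r]mulr1 ler_pM ?nrm_ge0 //.
by rewrite -[h](subrK 1%:M) nrmD_le ?nrm1_le // (le_trans hr).
Qed.

(* [t] is the limit of the squares of [t^((p^m+1)/2)], and the set of squares is
   compact. *)
Lemma Tset_sqrt r t : 0 <= r < 1 -> Tset t -> nrm (t - 1%:M) <= r ->
  exists t', [/\ Tset t', nrm (t' - 1%:M) <= r & t' *m t' = t].
Proof.
move=> /andP[r0 r1] Tt tr.
have r01 : 0 <= r <= 1 by rewrite r0 ltW.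
have TX i : Tset (t ^+ i) /\ nrm (t ^+ i - 1%:M) <= r.
  elim: i => [|i [IT IH]]; first by rewrite expr0; split; [apply: Tset1|rewrite subrr nrm0].
  rewrite exprS; split; first exact: TsetM.
  exact: Tset_near1M.
(* The factor by which taking a [p]-th power contracts the distance to 1, from [s^p - 1 = (s - 1)(p
   + sum of the s^i - 1)]. *)
pose rho := Num.max (av p%:R) r.
have rho1 : rho < 1 by rewrite gt_max pres.
have rho0 : 0 <= rho by rewrite le_max absv_ge0.
have powp m : nrm (t ^+ (p ^ m) - 1%:M) <= rho ^+ m * r.
  elim: m => [|m IH]; first by rewrite expn0 expr1 mul1r.
  set s := t ^+ (p ^ m) in IH.
  have sX i : nrm (s ^+ i - 1%:M) <= r by rewrite -exprM; apply: (TX _).2.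
  rewrite expnSr exprM -/s.
  have -> : s ^+ p - 1%:M = (s - 1%:M) *m (\sum_(i < p) s ^+ i).
    by rewrite -[1%:M]/(1 : 'M[k]_n) subrX1.
  have sumE : \sum_(i < p) s ^+ i = p%:R%:M + \sum_(i < p) (s ^+ i - 1%:M).
    by rewrite sumrB sumr_const card_ord -[1%:M]/(1 : 'M[k]_n) addrC -scaler_nat scalemx1 subrK.
  rewrite exprSr -mulrA [rho * r]mulrC mulrA.
  apply: le_trans (nrmM _ _) _; rewrite ler_pM ?nrm_ge0 //.
  rewrite sumE; apply: le_trans (nrmD _ _) _; rewrite ge_max; apply/andP; split.
    rewrite -scalemx1; apply: le_trans (nrmZ _ _) _.
    by apply: le_trans (_ : av p%:R <= _); rewrite ?ler_piMr ?absv_ge0 ?nrm1_le // le_max lexx.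
  by apply: le_trans (_ : r <= _); [apply: nrm_sum|rewrite le_max lexx orbT].
(* Without a square root, [y *m y - t] would stay away from 0 on the compact set of candidates. This
   set contains the powers of [t] with exponent [(p^m + 1)/2], an integer as [p] is odd. *)
apply: contrapT => nosqrt.
have t1 : nrm t <= 1 by rewrite -[t](subrK 1%:M) nrmD_le ?nrm1_le // (le_trans tr) // ltW.
have [||d d0 dP] := @ball_uniform R k n n 1
    (fun y d => Tset y -> nrm (y - 1%:M) <= r -> d <= nrm (y *m y - t)).
- by move=> y d d' h dd' Ty yr; apply: le_trans dd' (h Ty yr).
- move=> y y1; case: (pselect (cen y)) => [yc|/not_cen_near[e e0 eP]]; last first.
    by exists e, 1; split=> // y' _ /eP h [/h].
  case: (eqVneq (y^T *m J *m y) J) => [yJ|yJ]; last first.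
    pose D := y^T *m J *m y - J.
    have D0 : 0 < nrm D by apply: nrm_gt0; rewrite subr_eq0.
    have J1 : 0 < nrm J + 1 by rewrite ltr_wpDl ?nrm_ge0.
    exists (nrm D / (nrm J + 1)), 1; split=> //; first by rewrite divr_gt0.
    move=> y' y'1 yy [_ y'J] _; exfalso; have : nrm D < nrm D; last by rewrite ltxx.
    have DE : D = - ((y' - y)^T *m J *m y' + y^T *m J *m (y' - y)).
      by rewrite linearB /= mulmxBr !mulmxBl y'J addrA subrK opprB.
    have lt : nrm (y' - y) * nrm J < nrm D.
      apply: le_lt_trans (_ : nrm (y' - y) * (nrm J + 1) < _); last by rewrite -ltr_pdivlMr.
      by rewrite ler_wpM2l ?nrm_ge0 // lerDl.
    rewrite {1}DE nrmN; apply: le_lt_trans (nrmD _ _) (le_lt_trans _ lt).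
    rewrite ge_max; apply/andP; split.
      apply: le_trans (nrmM _ _) _; rewrite -[X in _ <= X]mulr1 ler_pM ?nrm_ge0 //.
      by apply: le_trans (nrmM _ _) _; rewrite nrm_tr.
    apply: le_trans (nrmM _ _) _; rewrite mulrC ler_wpM2l ?nrm_ge0 //.
    apply: le_trans (nrmM _ _) _; rewrite nrm_tr ler_piMl ?nrm_ge0 //.
  case: (leP (nrm (y - 1%:M)) r) => [yr|yr]; last first.
    exists (nrm (y - 1%:M)), 1; split=> //; first exact: le_lt_trans yr.
    move=> y' _ yy _ y'r; exfalso.
    have : nrm (y - 1%:M) <= nrm (y' - 1%:M).
      by apply: nrm_perturb; rewrite opprB addrA subrK.
    by rewrite leNgt (le_lt_trans y'r).
  have D0 : 0 < nrm (y *m y - t).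
    by apply: nrm_gt0; rewrite subr_eq0; apply/eqP => yt; apply: nosqrt; exists y.
  exists (nrm (y *m y - t)), (nrm (y *m y - t)); split=> // y' y'1 yy _ _.
  apply: nrm_perturb.
  have -> : y' *m y' - t - (y *m y - t) = (y' - y) *m y' + y *m (y' - y).
    by rewrite opprB addrA subrK mulmxBl mulmxBr addrA subrK.
  apply: le_lt_trans (nrmD _ _) (le_lt_trans _ yy); rewrite ge_max.
  apply/andP; split; apply: le_trans (nrmM _ _) _.
    by rewrite ler_piMr ?nrm_ge0.
  by rewrite ler_piMl ?nrm_ge0.
have [m mP] : exists m, rho ^+ m * r < d.
  have : (fun m => rho ^+ m) @ \oo --> (0 : R) by apply: cvg_expr; rewrite ger0_norm.
  move=> /cvgr0Pnorm_lt/(_ _ d0)[m _ /(_ m (leqnn m))] /= mP; exists m.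
  apply: le_lt_trans mP; rewrite ger0_norm ?exprn_ge0 // ler_piMr ?exprn_ge0 //.
  exact: ltW.
have [Ttm tmr] := TX ((p ^ m).+1./2).
have tm1 : nrm (t ^+ (p ^ m).+1./2) <= 1.
  by rewrite -[_ ^+ _](subrK 1%:M) nrmD_le ?nrm1_le // (le_trans tmr) // ltW.
have := dP _ tm1 Ttm tmr; apply/negP; rewrite -ltNge.
apply: le_lt_trans (mP); apply: le_trans (powp m).
rewrite -[_ *m _]/(_ * _) -exprD addnn.
have -> : ((p ^ m).+1./2.*2 = (p ^ m).+1)%N.
  by rewrite even_halfK //= negbK oddX p_odd orbT.
rewrite exprS -[t in _ - t]mulmx1 -[_ * _]/(_ *m _) -mulmxBr.
by apply: le_trans (nrmM _ _) _; rewrite ler_piMl ?nrm_ge0.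
Qed.

End LocalTorus.

(** * Commutators near the identity *)

Section Commutators.
Variables (R : realType) (k : nonarchLocalFieldType R).
Variables (n : nat) (J Y S : 'M[k]_n).
Local Notation av := (absv : k -> R).
Local Notation cen := (centralizes Y).
Local Notation Tset := (Tset J Y).
Hypothesis av2 : av 2%:R = 1.
Hypothesis Jskew : J^T = - J.
Hypothesis Ju : J \in unitmx.
Hypothesis two_neq0 : 2%:R != 0 :> k.
Hypothesis Yskew : Y^T *m J = - (J *m Y).
Hypothesis Yu : Y \in unitmx.
Hypothesis Ccomm : forall b c, cen b -> cen c -> b *m c = c *m b.
Hypothesis SS : S *m S = 1%:M.
Hypothesis aS : adj J S = - S.
Hypothesis Sb : forall b, cen b -> S *m b = adj J b *m S.
Local Notation Fix := (Fix J Y).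
Local Notation PHI := (Phi Y S).
Local Notation E11 := (E11 S).
Local Notation E22 := (E22 S).
Local Notation E12 := (E12 Y S).
Local Notation E21 := (E21 Y S).

Let PM := PhiM Ju two_neq0 Yskew Yu Ccomm SS Sb.
Let F1 : Fix 1%:M := Fix1 Y Ju.
Let F0 : Fix 0 := Fix0 Y Ju.
Let FixS a : Fix a%:M.
Proof. by rewrite -scalemx1; apply: FixZ. Qed.

(** With [lel] and [del], the upper and lower unipotents and the scalar diagonal elements of [SL_2]
    over [Fix]. *)
Definition uel (x : 'M[k]_n) := PHI 1%:M x 0 1%:M.
Definition lel (x : 'M[k]_n) := PHI 1%:M 0 x 1%:M.
Definition del (a : k) := PHI a%:M 0 0 a^-1%:M.

Let Phi1 : PHI 1%:M 0 0 1%:M = 1%:M.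
Proof. by rewrite /Phi !mul0mx !addr0 !mul1mx E11_E22. Qed.

Lemma uelM x y : Fix x -> Fix y -> uel x *m uel y = uel (x + y).
Proof.
move=> Fx Fy; rewrite PM // !(mul1mx, mulmx1, mul0mx, mulmx0, addr0, add0r).
by rewrite addrC.
Qed.

Lemma lelM x y : Fix x -> Fix y -> lel x *m lel y = lel (x + y).
Proof. by move=> Fx Fy; rewrite PM // !(mul1mx, mulmx1, mul0mx, mulmx0, addr0, add0r). Qed.

Lemma delM a b : del a *m del b = del (a * b).
Proof. by rewrite /del PM // !(mul0mx, mulmx0, addr0, add0r) -!scalar_mxM invfM. Qed.

Lemma del1 : del 1 = 1%:M.
Proof. by rewrite /del invr1. Qed.

(** Conjugation by [del a] scales the parameter by [a ^+ 2]; a suitable [a] near 1 thus makes every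
    small unipotent a commutator. *)
Lemma uel_comm a x : a != 0 -> Fix x ->
  del a *m uel x *m del a^-1 *m uel (- x) = uel ((a ^+ 2 - 1) *: x).
Proof.
move=> a0 Fx; have FNx : Fix (- x) by apply: FixN.
rewrite /del invrK !PM // ?FixS //; do ?[by apply: FixM].
rewrite !(mul1mx, mulmx1, mul0mx, mulmx0, addr0, add0r) -!scalar_mxM divff // mulVf //.
rewrite !(mul1mx, mulmx1, mul0mx, mulmx0, addr0, add0r) /uel; congr PHI.
by rewrite mul_scalar_mx mul_mx_scalar scalerA -expr2 scalerBl scale1r addrC.
Qed.

Lemma lel_comm a x : a != 0 -> Fix x ->
  del a *m lel x *m del a^-1 *m lel (- x) = lel ((a ^- 2 - 1) *: x).
Proof.
move=> a0 Fx; have FNx : Fix (- x) by apply: FixN.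
rewrite /del invrK !PM // ?FixS //; do ?[by apply: FixM].
rewrite !(mul1mx, mulmx1, mul0mx, mulmx0, addr0, add0r) -!scalar_mxM divff // mulVf //.
rewrite !(mul1mx, mulmx1, mul0mx, mulmx0, addr0, add0r) /lel; congr PHI.
by rewrite mul_scalar_mx mul_mx_scalar scalerA -invfM -expr2 scalerBl scale1r.
Qed.

(** The inverse is carried along because commutators contain it and because its lifts must be scalar
    as well. *)
Definition near_one_pair (eta : R) (g g' : 'M[k]_n) :=
  [/\ g^T *m J *m g = J, g'^T *m J *m g' = J, g *m g' = 1%:M,
      nrm (g - 1%:M) <= eta & nrm (g' - 1%:M) <= eta].

Let sympl_Phi a b c d : Fix a -> Fix b -> Fix c -> Fix d ->
  PHI d (- b) (- c) a *m PHI a b c d = 1%:M -> (PHI a b c d)^T *m J *m PHI a b c d = J.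
Proof. by move=> Fa Fb Fc Fd h; apply/symplE => //; rewrite adj_Phi. Qed.

Lemma uel_near x eta : Fix x -> nrm x * nrm E12 <= eta -> near_one_pair eta (uel x) (uel (- x)).
Proof.
move=> Fx xe; have FNx : Fix (- x) by apply: FixN.
have uE y : uel y - 1%:M = y *m E12.
  by apply/eqP; rewrite subr_eq /uel /Phi mul0mx addr0 !mul1mx addrAC E11_E22 // addrC.
have sy y : Fix y -> (uel y)^T *m J *m uel y = J.
  move=> Fy; apply: sympl_Phi => //; rewrite oppr0 -[PHI _ _ _ _ *m _]/(uel (- y) *m uel y).
  by rewrite uelM // ?addNr //; apply: FixN.
split; rewrite ?sy ?uE //; first by rewrite uelM // subrr.
  exact: le_trans (nrmM _ _) xe.
by apply: le_trans (nrmM _ _) _; rewrite nrmN.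
Qed.

Lemma lel_near x eta : Fix x -> nrm x * nrm E21 <= eta -> near_one_pair eta (lel x) (lel (- x)).
Proof.
move=> Fx xe; have FNx : Fix (- x) by apply: FixN.
have uE y : lel y - 1%:M = y *m E21.
  by apply/eqP; rewrite subr_eq /lel /Phi mul0mx addr0 !mul1mx addrAC E11_E22 // addrC.
have sy y : Fix y -> (lel y)^T *m J *m lel y = J.
  move=> Fy; apply: sympl_Phi => //; rewrite oppr0 -[PHI _ _ _ _ *m _]/(lel (- y) *m lel y).
  by rewrite lelM // ?addNr //; apply: FixN.
split; rewrite ?sy ?uE //; first by rewrite lelM // subrr.
  exact: le_trans (nrmM _ _) xe.
by apply: le_trans (nrmM _ _) _; rewrite nrmN.
Qed.

Lemma del_near a eta : av a = 1 -> av (a - 1) * (nrm E11 + nrm E22) <= eta ->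
  near_one_pair eta (del a) (del a^-1).
Proof.
move=> a1 ae; have a0 : a != 0 by rewrite -absv_eq0 a1 oner_eq0.
have ai : av (a^-1 - 1) = av (a - 1).
  have -> : a^-1 - 1 = - (a^-1 * (a - 1)) by rewrite mulrBr mulVf // mulr1 opprB.
  by rewrite absvN absvM absvV a1 invr1 mul1r.
have sy b : b != 0 -> (del b)^T *m J *m del b = J.
  move=> b0; apply: sympl_Phi => //; rewrite oppr0.
  have -> : PHI b^-1%:M 0 0 b%:M = del b^-1 by rewrite /del invrK.
  by rewrite delM mulVf // del1.
have dE b : av (b - 1) = av (a - 1) -> av (b^-1 - 1) = av (a - 1) -> nrm (del b - 1%:M) <= eta.
  move=> b1 b2; apply: le_trans ae.
  have -> : del b - 1%:M = (b - 1) *: E11 + (b^-1 - 1) *: E22.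
    rewrite -Phi1 /del /Phi !mul0mx !addr0 !mul_scalar_mx !scale1r opprD addrACA.
    by rewrite !scalerBl !scale1r.
  apply: le_trans (nrmD _ _) _; rewrite ge_max; apply/andP; split.
    apply: le_trans (nrmZ _ _) _; rewrite b1 ler_wpM2l ?absv_ge0 // lerDl nrm_ge0 //.
  apply: le_trans (nrmZ _ _) _; rewrite b2 ler_wpM2l ?absv_ge0 // lerDr nrm_ge0 //.
split; rewrite ?sy ?invr_eq0 //; first by rewrite delM divff // del1.
  exact: dE.
by apply: dE; rewrite ?invrK.
Qed.

(* With [c = b + delta a] invertible, the torus element [t = a + bY] factors as
   [uel x * lel c * uel z * lel (- delta)] with all parameters small. *)
Lemma near_one_commutators (eta : R) (Q : set 'M[k]_n) : 0 < eta ->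
    (forall x y, Q x -> Q y -> Q (x *m y)) ->
    (forall g g' h h', near_one_pair eta g g' -> near_one_pair eta h h' ->
       Q (g *m h *m g' *m h')) ->
  exists2 e, 0 < e & forall t, Tset t -> nrm (t - 1%:M) <= e -> Q t.
Proof.
move=> eta0 QM Qc.
pose A := 1 + nrm E11 + nrm E22 + nrm E12 + nrm E21.
have nn (m l : nat) (M : 'M[k]_(m, l)) : 0 <= nrm M by apply: nrm_ge0.
have A1 : 1 <= A by rewrite /A -!addrA lerDl !addr_ge0.
have A0 : 0 < A by apply: lt_le_trans A1.
have AE12 : nrm E12 <= A by have := nn _ _ E11; have := nn _ _ E22; have := nn _ _ E21; rewrite /A; lra.
have AE21 : nrm E21 <= A by have := nn _ _ E11; have := nn _ _ E22; have := nn _ _ E12; rewrite /A; lra.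
have AE1122 : nrm E11 + nrm E22 <= A by have := nn _ _ E12; have := nn _ _ E21; rewrite /A; lra.
(* For [a = 1 + w] the factors [a^2 - 1] and [a^-2 - 1] have the absolute value of [w], because
   [2 + w] has absolute value 1. So [w] is small enough for [del a] to be near 1, and non-zero so
   that parameters can be divided by these factors. *)
have [w wn0 wle] : exists2 w : k, w != 0 & av w <= Num.min (eta / A) 2^-1.
  by apply: absv_small; rewrite lt_min divr_gt0 //= invr_gt0.
move: wle; rewrite le_min => /andP[weta whalf].
have w0 : 0 < av w by rewrite lt_neqAle eq_sym absv_eq0 wn0 absv_ge0.
have w1 : av w < 1 by apply: le_lt_trans whalf _; rewrite invf_lt1 ?ltr1n.
have unit_pert (x : k) : av x = 1 -> av (x + w) = 1.
  move=> x1; apply/le_anti; apply/andP; split.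
    by apply: le_trans (absvD_max _ _) _; rewrite ge_max x1 lexx ltW.
  have : av x <= Num.max (av (x + w)) (av (- w)) by rewrite -{1}(addrK w x) absvD_max.
  by rewrite x1 absvN le_max => /orP[//|]; rewrite leNgt w1.
pose a := 1 + w.
have a1 : av a = 1 by apply: unit_pert; rewrite absv1.
have a0 : a != 0 by rewrite -absv_eq0 a1 oner_eq0.
have aw : a - 1 = w by rewrite /a addrAC subrr add0r.
have ka : av (a ^+ 2 - 1) = av w.
  by rewrite subr_sqr_1 absvM aw /a addrAC -mulr2n [av (2%:R + w)]unit_pert // mulr1.
have ka' : av (a ^- 2 - 1) = av w.
  have -> : a ^- 2 - 1 = - (a ^- 2 * (a ^+ 2 - 1)).
    by rewrite mulrBr mulVf ?expf_neq0 // mulr1 opprB.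
  by rewrite absvN absvM ka absvV absvX a1 expr1n invr1 mul1r.
have dnear : near_one_pair eta (del a) (del a^-1).
  apply: del_near => //; rewrite aw -(mulfVK (lt0r_neq0 A0) eta).
  by rewrite ler_pM ?absv_ge0 ?addr_ge0.
(* Dividing a parameter of norm at most [M] by a scalar with the absolute value of [w] keeps the
   unipotent within [eta] of 1. *)
pose M := eta * av w / A.
have M0 : 0 < M by rewrite !mulr_gt0 ?invr_gt0.
have bnd (x : 'M[k]_n) (c : k) (E : R) : 0 <= E -> E <= A -> av c = av w -> nrm x <= M ->
    nrm (c^-1 *: x) * E <= eta.
  move=> E0 EA cw xM; apply: le_trans (_ : M / av w * A <= _).
    rewrite ler_pM // mulrC; apply: le_trans (nrmZ _ _) _.
    by rewrite absvV cw ler_wpM2l // invr_ge0 ltW.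
  by rewrite /M mulrAC mulfVK ?mulfK ?lt0r_neq0.
have Qu x : Fix x -> nrm x <= M -> Q (uel x).
  move=> Fx xM; pose c := a ^+ 2 - 1.
  have c0 : c != 0 by rewrite -absv_eq0 ka gt_eqF.
  have Fy : Fix (c^-1 *: x) by apply: FixZ.
  have -> : uel x = del a *m uel (c^-1 *: x) *m del a^-1 *m uel (- (c^-1 *: x)).
    by rewrite uel_comm // scalerA divff // scale1r.
  by apply: Qc => //; apply: uel_near => //; apply: bnd.
have Ql x : Fix x -> nrm x <= M -> Q (lel x).
  move=> Fx xM; pose c := a ^- 2 - 1.
  have c0 : c != 0 by rewrite -absv_eq0 ka' gt_eqF.
  have Fy : Fix (c^-1 *: x) by apply: FixZ.
  have -> : lel x = del a *m lel (c^-1 *: x) *m del a^-1 *m lel (- (c^-1 *: x)).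
    by rewrite lel_comm // scalerA divff // scale1r.
  by apply: Qc => //; apply: lel_near => //; apply: bnd.
(* [be] need not be invertible and is small for [t] near 1. Fixing [de] before [t] and then taking
   [t] close enough to 1 makes [be + de *: al] a small perturbation of the scalar [de]. *)
have [de den0 dele] : exists2 de : k, de != 0 & av de <= Num.min M 1.
  by apply: absv_small; rewrite lt_min M0 ltr01.
move: dele; rewrite le_min => /andP[deM de1].
have de0 : 0 < av de by rewrite lt_neqAle eq_sym absv_eq0 den0 absv_ge0.
pose AJ := nrm (invmx J) * nrm J.
have AJ0 : 0 <= AJ by rewrite mulr_ge0.
(* A common constant bounding [al - 1], [be] and [be *m (Y *m Y)] in terms of [t - 1]. *)
pose B := (1 + AJ) * (1 + nrm (invmx Y)) * (1 + nrm (Y *m Y)).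
have B1 : 1 + AJ <= B.
  by rewrite /B -mulrA ler_peMr ?addr_ge0 // mulr_ege1 // lerDl nn.
have B2 : (1 + AJ) * nrm (invmx Y) <= B.
  apply: le_trans (_ : (1 + AJ) * (1 + nrm (invmx Y)) <= _).
    by rewrite ler_wpM2l ?addr_ge0 // lerDr.
  by rewrite ler_peMr ?mulr_ge0 ?addr_ge0 // lerDl.
have B3 : (1 + AJ) * nrm (invmx Y) * nrm (Y *m Y) <= B.
  by rewrite ler_pM ?mulr_ge0 ?addr_ge0 // ?lerDr // ler_wpM2l ?addr_ge0 // lerDr.
have B0 : 0 < B by apply: lt_le_trans B1; rewrite ltr_pwDl.
pose sm := av de * Num.min M 2^-1.
have sm0 : 0 < sm by rewrite mulr_gt0 // lt_min M0 invr_gt0 ltr0n.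
have smM : sm / av de <= M by rewrite /sm mulrC mulKf ?gt_eqF // ge_min lexx.
have smh : sm / av de < 1.
  rewrite /sm mulrC mulKf ?gt_eqF //; apply: le_lt_trans (_ : 2^-1 < _).
    by rewrite ge_min lexx orbT.
  by rewrite invf_lt1 ?ltr1n.
exists (sm / B); first by rewrite divr_gt0.
move=> t Tt tle.
have eB (x : R) (c : R) : 0 <= c -> c <= B -> x <= c * nrm (t - 1%:M) -> x <= sm.
  move=> c0 cB xc; apply: le_trans xc _; rewrite -(mulfVK (lt0r_neq0 B0) sm) mulrC.
  by rewrite ler_pM.
have [Fa Fb tE det] := Tset_Phi S Jskew Ju two_neq0 Yskew Yu Ccomm Tt.
set al := 2%:R^-1 *: _ in Fa tE det; set be := 2%:R^-1 *: _ in Fb tE det.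
have at1 : nrm (adj J t - 1%:M) <= AJ * nrm (t - 1%:M).
  have -> : adj J t - 1%:M = adj J (t - 1%:M) by rewrite adjD // adjN // adj1.
  by rewrite nrm_adj.
have sum1 : nrm (t - 1%:M) <= (1 + AJ) * nrm (t - 1%:M) by rewrite ler_peMl // lerDl.
have sum2 : nrm (adj J t - 1%:M) <= (1 + AJ) * nrm (t - 1%:M).
  by apply: le_trans at1 _; rewrite ler_wpM2r // lerDr.
have hal : av (2%:R^-1 : k) = 1 by rewrite absvV av2 invr1.
have al1 : nrm (al - 1%:M) <= (1 + AJ) * nrm (t - 1%:M).
  have -> : al - 1%:M = 2%:R^-1 *: ((t - 1%:M) + (adj J t - 1%:M)).
    rewrite addrACA scalerDr; congr (_ + _); rewrite -opprD -mulr2n -scaler_nat scalerN scalerA.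
    by rewrite mulVf // scale1r.
  by apply: le_trans (nrmZ _ _) _; rewrite hal mul1r nrmD_le.
have be1 : nrm be <= (1 + AJ) * nrm (invmx Y) * nrm (t - 1%:M).
  have -> : be = 2%:R^-1 *: (((t - 1%:M) - (adj J t - 1%:M)) *m invmx Y).
    by rewrite opprB addrA subrK.
  apply: le_trans (nrmZ _ _) _; rewrite hal mul1r mulrAC; apply: nrmM_le => //.
  exact: nrmB_le.
have beYY : nrm (be *m (Y *m Y)) <= sm.
  apply: (eB _ _ _ B3); first by rewrite !mulr_ge0 ?addr_ge0.
  by rewrite mulrAC; apply: nrmM_le.
have als : nrm (al - 1%:M) <= sm by apply: eB B1 al1; rewrite addr_ge0.
have bes : nrm be <= sm by apply: eB B2 be1; rewrite mulr_ge0 ?addr_ge0.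
clearbody al be.
have Fyy : Fix (be *m (Y *m Y)).
  apply: FixM => //; split; first by apply: cenM; apply: cen_self.
  by rewrite adjM // adjY // mulNmx mulmxN opprK.
pose v := (al - 1%:M) + de^-1 *: be.
have v1 : nrm v < 1.
  apply: le_lt_trans smh; apply: nrmD_le.
    by apply: le_trans als _; rewrite ler_peMr ?(ltW sm0) // invf_ge1.
  by apply: le_trans (nrmZ _ _) _; rewrite absvV mulrC ler_wpM2r // invr_ge0 ltW.
have [vu vinv] := one_plus_small v1.
pose c := be + de *: al.
have cE : c = de *: (1%:M + v).
  by rewrite /c /v addrA [1%:M + _]addrC subrK scalerDr scalerA divff // scale1r addrC.
have cu : c \in unitmx by rewrite cE unitmxZ ?unitfE.
have Fc : Fix c by apply: FixD => //; apply: FixZ.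
have FVc : Fix (invmx c) by apply: FixV.
have Vc : nrm (invmx c) <= (av de)^-1.
  have -> : invmx c = de^-1 *: invmx (1%:M + v) by rewrite cE invmxZ // -cE.
  apply: le_trans (nrmZ _ _) _.
  by rewrite absvV ler_piMr // invr_ge0 ltW.
have cM : nrm c <= M.
  apply: le_trans deM; rewrite cE; apply: le_trans (nrmZ _ _) _.
  by rewrite ler_piMr ?absv_ge0 // nrmD_le ?nrm1_le // ltW.
pose a' := al + de *: (be *m (Y *m Y)).
have Fa' : Fix a' by apply: FixD => //; apply: FixZ.
have a'1 : nrm (a' - 1%:M) <= sm.
  rewrite /a' addrAC; apply: nrmD_le => //; apply: le_trans (nrmZ _ _) _.
  by rewrite -[sm]mul1r ler_pM ?absv_ge0.
have FB x : Fix x -> Fix (x - 1%:M) by move=> Fx; apply: FixD => //; apply: FixN.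
pose x := (a' - 1%:M) *m invmx c; pose z := (al - 1%:M) *m invmx c.
have Fx : Fix x by apply: FixM => //; apply: FB.
have Fz : Fix z by apply: FixM => //; apply: FB.
have xM : nrm x <= M by apply: le_trans smM; apply: nrmM_le.
have zM : nrm z <= M by apply: le_trans smM; apply: nrmM_le.
have FN : Fix (- de%:M) by apply: FixN.
suff -> : t = uel x *m lel c *m uel z *m lel (- de%:M).
  apply: (QM); [apply: (QM); [apply: (QM); [exact: Qu|exact: Ql]|exact: Qu]|].
  apply: Ql => //; rewrite nrmN -scalemx1; apply: le_trans (nrmZ _ _) _.
  by apply: le_trans deM; rewrite ler_piMr ?absv_ge0 ?nrm1_le.
(* A matrix of determinant 1 with invertible lower left entry [c] is a product of an upper, a lower
   and an upper unipotent; multiplication by [lel de%:M] is what creates this entry. *)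
have key : t *m lel de%:M = uel x *m lel c *m uel z.
  have xc : x *m c = a' - 1%:M by rewrite /x mulmxKV.
  have cz : c *m z = al - 1%:M.
    by have [[cc _] [zc _]] := (Fc, Fz); rewrite (Ccomm cc zc) /z mulmxKV.
  rewrite tE !PM // !(mul1mx, mulmx1, mul0mx, mulmx0, addr0, add0r) xc.
  rewrite [1%:M + (a' - 1%:M)]addrC subrK cz subrK.
  have EE : be *m (Y *m Y) = a' *m z + x.
    rewrite /z /x mulmxA -mulmxDl mulmxBr mulmx1 addrA subrK.
    apply: (can_inj (mulmxK cu)); rewrite mulmxKV //.
    rewrite /a' /c mulmxDl -scalemxAl mulmxDr -scalemxAr -det.
    by rewrite opprB [RHS]addrC addrA subrK.
  by rewrite -EE /a' /c !mul_mx_scalar.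
have -> : t = t *m lel de%:M *m lel (- de%:M).
  by rewrite -mulmxA lelM // subrr /lel Phi1 mulmx1.
by rewrite key.
Qed.

End Commutators.

(** * Hilbert spaces *)

Section Hilbert.
Variables (R : realType) (H : completeNormedModType R[i]) (dot : {dot H for Num.conj}).
Hypothesis HH : hilbert_dot dot.
Local Notation C := R[i].

(** The norm has values in [R[i]]; its real part moves estimates to the totally ordered field
    [R]. *)
Definition rn (V : normedModType C) (v : V) : R := complex.Re `|v|.

Section RealNorm.
Variable V : normedModType C.
Implicit Types u v : V.

Lemma rnE v : ((rn v)%:C)%C = `|v|.
Proof. by rewrite /rn RRe_real // normr_real. Qed.

Lemma rn_ge0 v : 0 <= rn v.
Proof. by rewrite -ler0c rnE normr_ge0. Qed.

Lemma rnD u v : rn (u + v) <= rn u + rn v.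
Proof. by rewrite -lecR rmorphD /= !rnE ler_normD. Qed.

Lemma rnN v : rn (- v) = rn v.
Proof. by rewrite /rn normrN. Qed.

Lemma rnBC u v : rn (u - v) = rn (v - u).
Proof. by rewrite /rn distrC. Qed.

Lemma rnZ (a : C) v : rn (a *: v) = rn (a : C^o) * rn v.
Proof. by apply: complexI; rewrite rmorphM /= !rnE normrZ. Qed.

Lemma rn_eq0 v : rn v <= 0 -> v = 0.
Proof.
move=> h; apply/eqP; rewrite -normr_eq0 -rnE.
by have -> : rn v = 0 by apply/le_anti; rewrite h rn_ge0.
Qed.

Lemma posC (e : C) : 0 < e -> exists2 e' : R, 0 < e' & e = (e'%:C)%C.
Proof.
move=> e0; exists (complex.Re e); last by rewrite RRe_real // gtr0_real.
by rewrite -ltcR RRe_real // gtr0_real.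
Qed.

Lemma nbhs_rn v (A : set V) : nbhs v A <->
  exists2 e : R, 0 < e & forall u, rn (u - v) < e -> A u.
Proof.
split=> [/nbhs_ballP[e /posC[e' e0 ->] h]|[e e0 h]].
  by exists e' => // u ue; apply: h; rewrite -ball_normE /= distrC -rnE ltcR.
apply/nbhs_ballP; exists (e%:C)%C => /=; first by rewrite ltcR.
by move=> u; rewrite -ball_normE /= distrC -rnE ltcR => /h.
Qed.

End RealNorm.

Lemma dotDl u v w : dot (u + v) w = dot u w + dot v w.
Proof. exact: linearDl. Qed.
Lemma dotBl u v w : dot (u - v) w = dot u w - dot v w.
Proof. exact: linearBl. Qed.
Lemma dotZl a u v : dot (a *: u) v = a * dot u v.
Proof. by rewrite linearZl_LR. Qed.
Lemma dotZr a u v : dot u (a *: v) = a^* * dot u v.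
Proof. by rewrite linearZr_LR. Qed.
Lemma dot0l u : dot 0 u = 0.
Proof. exact: linear0l. Qed.
Lemma dot0r u : dot u 0 = 0.
Proof. exact: linear0r. Qed.
Lemma dot_suml I (s : seq I) (F : I -> H) v :
  dot (\sum_(i <- s) F i) v = \sum_(i <- s) dot (F i) v.
Proof. exact: linear_sumlz. Qed.
Lemma dot_sumr I (s : seq I) (F : I -> H) v :
  dot v (\sum_(i <- s) F i) = \sum_(i <- s) dot v (F i).
Proof. exact: linear_sumr. Qed.
Lemma dotC u v : dot u v = (dot v u)^*.
Proof. by rewrite hermC /= expr0 mul1r. Qed.
Lemma dot_eq0C u v : dot u v = 0 -> dot v u = 0.
Proof. by rewrite dotC => /eqP; rewrite conjC_eq0 => /eqP. Qed.

Lemma dotDD u v : dot u v = 0 -> dot (u + v) (u + v) = dot u u + dot v v.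
Proof. exact: hnormDd. Qed.
Lemma dotZZ a u : dot (a *: u) (a *: u) = `|a| ^+ 2 * dot u u.
Proof. by rewrite dotZl dotZr mulrA normCK. Qed.

Lemma rn_sq v : ((rn v ^+ 2)%:C)%C = dot v v.
Proof. by rewrite rmorphXn /= rnE HH. Qed.

Lemma rn_isometry u v : dot u u = dot v v -> rn u = rn v.
Proof.
move=> h; apply/eqP; rewrite -(eqrXn2 (ltn0Sn 1)) ?rn_ge0 //; apply/eqP.
by apply: complexI; rewrite !rn_sq.
Qed.

Lemma parallelogram (u v : H) :
  rn (u + v) ^+ 2 + rn (u - v) ^+ 2 = 2%:R * (rn u ^+ 2 + rn v ^+ 2).
Proof.
rewrite mulr_natl mulr2n; apply: complexI; rewrite !rmorphD /= !rn_sq dnormD dnormB; ring.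
Qed.

(** Cauchy-Schwarz, by Pythagoras for the projection of [u] onto the line of [v]. *)
Lemma dot_le u v : `|dot u v| ^+ 2 <= dot u u * dot v v.
Proof.
have [->|v0] := eqVneq v 0; first by rewrite !dot0r normr0 expr0n mulr0.
have vv : dot v v != 0 by rewrite dnorm_eq0.
set c := dot u v / dot v v.
have o : dot (u - c *: v) (c *: v) = 0.
  by rewrite dotZr dotBl dotZl /c mulfVK // subrr mulr0.
have := dotDD o; rewrite subrK => ->.
rewrite mulrDl dotZZ.
have -> : `|c| ^+ 2 * dot v v * dot v v = `|dot u v| ^+ 2.
  rewrite /c normrM exprMn -mulrA -expr2 -mulrA normfV (ger0_norm (dnorm_ge0 _ v)).
  by rewrite exprVn mulVf ?mulr1 // expf_neq0.
by rewrite lerDr mulr_ge0 ?dnorm_ge0.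
Qed.

Lemma dot_closure u y :
  (forall e : R, 0 < e -> exists2 u', dot u' y = 0 & rn (u' - u) < e) -> dot u y = 0.
Proof.
move=> h; apply: (@rn_eq0 C^o); apply/ler_addgt0Pr => e e0; rewrite add0r.
have y0 : 0 < 1 + rn y by rewrite ltr_pwDl ?rn_ge0.
have [|u' u'y u'u] := h (e / (1 + rn y)); first by rewrite divr_gt0.
rewrite -(ler_pXn2r (ltn0Sn 1)) ?nnegrE ?rn_ge0 ?(ltW e0) // -lecR rmorphXn /= rnE.
have -> : dot u y = dot (u - u') y by rewrite dotBl u'y subr0.
apply: le_trans (dot_le _ _) _; rewrite -!rn_sq -rmorphM /= lecR -exprMn.
rewrite ler_pXn2r ?nnegrE ?mulr_ge0 ?rn_ge0 ?(ltW e0) // rnBC.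
apply: le_trans (_ : e / (1 + rn y) * (1 + rn y) <= _); last by rewrite mulfVK ?gt_eqF.
by rewrite ler_pM ?rn_ge0 ?(ltW u'u) // lerDr.
Qed.

Lemma isometry_eigen_orth (U : H -> H) (a b : C) u v :
    (forall x y, dot (U x) (U y) = dot x y) -> U u = a *: u -> U v = b *: v ->
  `|b| = 1 -> a != b -> dot u v = 0.
Proof.
move=> U_iso Uu Uv b1 ab; apply/eqP; apply: contraNT ab => uv; apply/eqP.
have ab1 : a * b^* = 1 by apply: (mulIf uv); rewrite mul1r -[in RHS]U_iso Uu Uv dotZl dotZr mulrA.
have bb1 : b * b^* = 1 by rewrite -normCK b1 expr1n.
have b0 : b^* != 0 by apply: contraTneq isT => b0; move: bb1; rewrite b0 mulr0 => /esym/eqP; rewrite oner_eq0.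
by apply: (mulIf b0); rewrite ab1.
Qed.

(** Midpoints stay in [K], so by the parallelogram law vectors of nearly least norm are close to
    each other. A minimizing sequence is thus Cauchy, and the same estimate gives uniqueness. *)
Lemma min_norm (K : set H) : closed K -> K !=set0 ->
    (forall x y, K x -> K y -> K (2%:R^-1 *: (x + y))) ->
  exists2 x, K x & forall y, K y -> rn y <= rn x -> y = x.
Proof.
move=> Kc [y0 Ky0] Kmid.
pose A := [set r : R | exists2 y, K y & r = rn y].
have A0 : A (rn y0) by exists y0.
have Alb : lbound A 0 by move=> _ [y _ ->]; apply: rn_ge0.
have Ainf : has_inf A by split; [exists (rn y0)|exists 0].
pose m := inf A.
have m_le y : K y -> m <= rn y.
  by move=> Ky; apply: ge_inf; [exists 0|exists y].
have m0 : 0 <= m by apply: lb_le_inf => //; exists (rn y0).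
have far x y d : K x -> K y -> 0 <= d -> rn x <= m + d -> rn y <= m + d ->
    rn (x - y) ^+ 2 <= 4%:R * (2%:R * m * d + d ^+ 2).
  move=> Kx Ky d0 hx hy; have := parallelogram x y.
  have := m_le _ (Kmid _ _ Kx Ky); rewrite rnZ.
  have -> : rn (2%:R^-1 : C^o) = 2%:R^-1.
    by apply: complexI; rewrite rnE normfV normr_nat fmorphV rmorph_nat.
  have := rn_ge0 x; have := rn_ge0 y; have := rn_ge0 (x + y).
  set a := rn (x + y); set b := rn (x - y); set p := rn x in hx *; set q := rn y in hy * => a0 q0 p0 ma.
  have p2 : p ^+ 2 <= (m + d) ^+ 2 by rewrite ler_pXn2r ?nnegrE ?addr_ge0.
  have q2 : q ^+ 2 <= (m + d) ^+ 2 by rewrite ler_pXn2r ?nnegrE ?addr_ge0.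
  have a2 : m ^+ 2 <= (2%:R^-1 * a) ^+ 2 by rewrite ler_pXn2r ?nnegrE ?mulr_ge0 ?invr_ge0.
  have -> : 4%:R * (2%:R * m * d + d ^+ 2) = 4%:R * (m + d) ^+ 2 - 4%:R * m ^+ 2 by ring.
  have a2' : (2%:R^-1 * a) ^+ 2 = 4%:R^-1 * a ^+ 2 by rewrite exprMn exprVn -natrX.
  lra.
have near_m (d : R) : 0 < d -> exists y, K y /\ rn y <= m + d.
  move=> d0; have [_ [y Ky ->] yd] := inf_adherent d0 Ainf.
  by exists y; split=> //; apply: ltW.
have ch (j : nat) : exists y, K y /\ rn y <= m + j.+1%:R^-1.
  by apply: near_m; rewrite invr_gt0.
have [f fP] := choice ch.
have small (e : R) : 0 < e -> exists2 d, 0 < d & 4%:R * (2%:R * m * d + d ^+ 2) < e ^+ 2.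
  move=> e0; pose D := 8%:R * m + 4%:R + 4%:R.
  have D0 : 0 < D by rewrite /D; lra.
  exists (Num.min 1 (e ^+ 2 / (2%:R * D))).
    by rewrite lt_min ltr01 divr_gt0 ?exprn_gt0 ?mulr_gt0.
  set d := Num.min _ _.
  have d1 : d <= 1 by rewrite ge_min lexx.
  have dD : d <= e ^+ 2 / (2%:R * D) by rewrite ge_min lexx orbT.
  have d0 : 0 <= d by rewrite le_min ler01 divr_ge0 ?exprn_ge0 ?mulr_ge0 // ltW.
  apply: le_lt_trans (_ : d * D < _).
    have : d ^+ 2 <= d by rewrite expr2 ler_piMl.
    rewrite /D; lra.
  have : d * D <= e ^+ 2 / 2%:R.
    by move: dD; rewrite invfM mulrA -ler_pdivlMr // .
  move/le_lt_trans; apply.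
  by have := exprn_gt0 2 e0; lra.
have fcl (e : R) : 0 < e -> exists N, forall i y, (N <= i)%N -> K y -> rn y <= m + N.+1%:R^-1 ->
    rn (f i - y) < e.
  move=> e0; have [d d0 dle] := small e e0.
  have [N Nd] : exists N : nat, N.+1%:R^-1 <= d.
    exists (Num.bound d^-1); rewrite invf_ple ?posrE //.
    apply: le_trans (ltW (archi_boundP _)) _; first by rewrite invr_ge0 ltW.
    by rewrite ler_nat.
  exists N => i y Ni Ky yN.
  rewrite -(ltr_pXn2r (ltn0Sn 1)) ?nnegrE ?rn_ge0 ?ltW //.
  apply: le_lt_trans dle; apply: far => //; first exact: (fP i).1; first exact: ltW.
    apply: le_trans (fP i).2 _; rewrite lerD2l; apply: le_trans Nd.
    by rewrite lef_pV2 ?posrE // ler_nat.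
  by apply: le_trans yN _; rewrite lerD2l.
have fc : cvg (f @ \oo).
  apply: cauchy_cvg; apply: cauchy_exP => e /posC[e' e0 ->].
  have [N NP] := fcl e' e0; exists (f N); exists N => // i /= Ni.
  rewrite -ball_normE /= distrC -rnE ltcR; apply: NP => //; first exact: (fP N).1.
  exact: (fP N).2.
pose x := lim (f @ \oo).
have fx (e : R) : 0 < e -> exists N, forall i, (N <= i)%N -> rn (f i - x) < e.
  move=> e0; have : nbhs x [set u | rn (u - x) < e] by apply/nbhs_rn; exists e.
  by move/fc => [N _ NP]; exists N => i Ni; apply: NP.
have Kx : K x.
  apply: Kc => B /nbhs_rn[e e0 eB]; have [N NP] := fx e e0; exists (f N).
  by split; [exact: (fP N).1|apply: eB; apply: NP].
have xm : rn x <= m.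
  apply/ler_addgt0Pr => e e0.
  have e20 : 0 < e / 2%:R by rewrite divr_gt0.
  have [N NP] := fx _ e20.
  have [M MP] : exists M : nat, M.+1%:R^-1 <= e / 2%:R.
    exists (Num.bound (e / 2%:R)^-1); rewrite invf_ple ?posrE //.
    apply: le_trans (ltW (archi_boundP _)) _; first by rewrite invr_ge0 ltW.
    by rewrite ler_nat.
  have h1 := NP (maxn N M) (leq_maxl _ _).
  have h2 : rn (f (maxn N M)) <= m + e / 2%:R.
    apply: le_trans (fP _).2 _; rewrite lerD2l; apply: le_trans MP.
    by rewrite lef_pV2 ?posrE // ler_nat ltnS leq_maxr.
  have := rnD (x - f (maxn N M)) (f (maxn N M)); rewrite subrK rnBC; lra.
exists x => // y Ky yx.
apply/eqP; rewrite -subr_eq0; apply/eqP/rn_eq0.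
have := far y x 0 Ky Kx (lexx 0); rewrite addr0 !mulr0 expr0n addr0 mulr0 => /(_ (le_trans yx xm) xm).
by rewrite exprn_even_le0 //= => /eqP ->.
Qed.

Lemma subspace_sum (V : set H) I (s : seq I) (c : I -> C) (F : I -> H) :
  linear_subspace V -> (forall i, V (F i)) -> V (\sum_(i <- s) c i *: F i).
Proof.
move=> [V0 VL] VF; elim: s => [|i s IH]; first by rewrite big_nil.
by rewrite big_cons; apply: VL.
Qed.

Lemma subspaceD (V : set H) u v : linear_subspace V -> V u -> V v -> V (u + v).
Proof. by move=> [_ VL] Vu Vv; rewrite -[u]scale1r; apply: VL. Qed.

Lemma subspaceZ (V : set H) a v : linear_subspace V -> V v -> V (a *: v).
Proof. by move=> [V0 VL] Vv; rewrite -[_ *: v]addr0; apply: VL. Qed.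

Lemma subspaceB (V : set H) u v : linear_subspace V -> V u -> V v -> V (u - v).
Proof. by move=> SV Vu Vv; rewrite -scaleN1r; apply: subspaceD => //; apply: subspaceZ. Qed.

Definition orthofam m (e : 'I_m -> H) := forall i j, dot (e i) (e j) = (i == j)%:R.

Definition oproj m (e : 'I_m -> H) (u : H) := \sum_i dot u (e i) *: e i.

Lemma oproj_orth m (e : 'I_m -> H) u j : orthofam e -> dot (u - oproj e u) (e j) = 0.
Proof.
move=> eo; rewrite dotBl dot_suml (bigD1 j) //= dotZl eo eqxx mulr1 big1 ?addr0 ?subrr //.
by move=> i ij; rewrite dotZl eo (negPf ij) mulr0.
Qed.

Lemma oproj_orth_fix m (e : 'I_m -> H) u y : orthofam e -> oproj e y = y ->
  dot (u - oproj e u) y = 0.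
Proof.
by move=> eo <-; rewrite dot_sumr big1 // => i _; rewrite dotZr oproj_orth ?mulr0.
Qed.

Lemma gram_schmidt (V : set H) (s : seq H) : linear_subspace V ->
    (forall y, y \in s -> V y) ->
  exists m (e : 'I_m -> H), [/\ orthofam e, forall i, V (e i)
    & forall y, y \in s -> oproj e y = y].
Proof.
move=> SV; elim: s => [_|y s IH sV].
  by exists 0%N, (fun=> 0); split=> // -[].
have [z zs|m [e [eo eV es]]] := IH; first by apply: sV; rewrite inE zs orbT.
pose z := y - oproj e y.
have Vy : V y by apply: sV; rewrite inE eqxx.
have Vz : V z by apply: subspaceB => //; apply: subspace_sum.
have [z0|z0] := eqVneq z 0.
  exists m, e; split=> // x; rewrite inE => /predU1P[->|/es //].
  by apply/esym/eqP; rewrite -subr_eq0 -/z z0.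
have zz : dot z z != 0 by rewrite dnorm_eq0.
pose z1 := `|z|^-1 *: z.
have nz : `|z| != 0 by rewrite normr_eq0.
have z11 : dot z1 z1 = 1.
  rewrite /z1 dotZZ -HH normfV normr_id -exprMn mulVf // expr1n //.
have z1e i : dot z1 (e i) = 0 by rewrite /z1 dotZl oproj_orth // mulr0.
pose e' (i : 'I_m.+1) := if unlift ord_max i is Some j then e j else z1.
have e'l i : e' (widen_ord (leqnSn m) i) = e i.
  rewrite /e'; have -> : widen_ord (leqnSn m) i = lift ord_max i.
    by apply: val_inj; rewrite /= /bump leqNgt ltn_ord.
  by rewrite liftK.
have e'm : e' ord_max = z1 by rewrite /e' unlift_none.
have e'P u : oproj e' u = oproj e u + dot u z1 *: z1.
  rewrite /oproj big_ord_recr /= e'm; congr (_ + _).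
  by apply: eq_bigr => i _; rewrite e'l.
exists m.+1, e'; split.
- move=> i j; rewrite /e'; case: unliftP => [i'|] ->; case: unliftP => [j'|] ->.
  + by rewrite eo (inj_eq lift_inj).
  + by rewrite (dot_eq0C (z1e _)) eq_sym (negPf (neq_lift _ _)).
  + by rewrite z1e (negPf (neq_lift _ _)).
  + by rewrite z11 eqxx.
- by move=> i; rewrite /e'; case: unliftP => [j|] _ //; apply: subspaceZ.
- move=> x; rewrite inE e'P => /predU1P[->|xs].
    have -> : dot y z1 = dot z z1.
      rewrite -[in LHS](subrK (oproj e y) y) dotDl [X in _ + X]dot_suml big1 ?addr0 //.
      by move=> i _; rewrite dotZl (dot_eq0C (z1e _)) mulr0.
    rewrite /z1 dotZr -HH scalerA rmorphV /= ?unitfE // conj_Creal ?normr_real // expr2 mulKf //.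
    by rewrite divff // scale1r /z addrC subrK.
  rewrite es //; have -> : dot x z1 = 0; last by rewrite scale0r addr0.
  by apply: dot_eq0C; rewrite -(es x xs) dot_sumr big1 // => i _; rewrite dotZr z1e mulr0.
Qed.

End Hilbert.

(** * Vectors fixed by a lattice *)

Section Heisenberg.
Variables (R : realType) (H : completeNormedModType R[i]) (dot : {dot H for Num.conj}).
Hypothesis HH : hilbert_dot dot.
Local Notation C := R[i].
Variables (A : zmodType) (c : A -> A -> C) (om : A -> H -> H).
Hypothesis cDl : forall x y z, c (x + y) z = c x z * c y z.
Hypothesis cDr : forall x y z, c x (y + z) = c x y * c x z.
Hypothesis cxx : forall x, c x x = 1.
Hypothesis omL : forall x, linear (om x).
Hypothesis om_iso : forall x u v, dot (om x u) (om x v) = dot u v.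
Hypothesis omM : forall x y v, om x (om y v) = c x y *: om (x + y) v.
Hypothesis om0 : forall v, om 0 v = v.
Hypothesis om_irr : forall u v, v != 0 -> (forall w, dot u (om w v) = 0) -> u = 0.
Variable L : set A.
Hypothesis L0 : L 0.
Hypothesis LB : forall x y, L x -> L y -> L (x - y).
Hypothesis Lhalf : forall l, L l -> exists2 l', L l' & l = l' + l'.
Hypothesis Lc : forall x y, L x -> L y -> c x y = 1.

(** The operators [om x] and [om y] commute up to the scalar [c x y ^+ 2]. As every element of [L]
    is twice an element of [L], triviality of [c w] on [L] amounts to commutation of [om w] with all
    of [om L]. *)
Definition Lperp : set A := [set w | forall l, L l -> c w l = 1].
Definition fixedH : set H := [set v | forall l, L l -> om l v = v].

Lemma cC x y : c x y * c y x = 1.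
Proof. by have := cxx (x + y); rewrite cDl !cDr !cxx mul1r mulr1. Qed.

Lemma c_neq0 x y : c x y != 0.
Proof. by apply/eqP => h; have := cC x y; rewrite h mul0r => /esym/eqP; rewrite oner_eq0. Qed.

Lemma c0l y : c 0 y = 1.
Proof. by apply: (mulfI (c_neq0 0 y)); rewrite -cDl addr0 mulr1. Qed.

Lemma cNl x y : c (- x) y = c y x.
Proof. by apply: (mulIf (c_neq0 x y)); rewrite -cDl addNr c0l cC. Qed.

Lemma cNr x y : c x (- y) = c y x.
Proof. by apply: (mulfI (c_neq0 (- y) x)); rewrite cC cNl cC. Qed.

Lemma omD x u v : om x (u + v) = om x u + om x v.
Proof. by have := omL x 1 u v; rewrite !scale1r. Qed.

Lemma omv0 x : om x 0 = 0.
Proof. by have := omD x 0 0; rewrite addr0 => /esym/eqP; rewrite -subr_eq0 addrK => /eqP. Qed.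

Lemma omZ x a v : om x (a *: v) = a *: om x v.
Proof. by have := omL x a v 0; rewrite !addr0 omv0 addr0. Qed.

Lemma omK x v : om x (om (- x) v) = v.
Proof. by rewrite omM cNr cxx scale1r subrr om0. Qed.

Lemma om_adj x u v : dot (om x u) v = dot u (om (- x) v).
Proof. by rewrite -{1}(omK x v) om_iso. Qed.

Lemma LN x : L x -> L (- x).
Proof. by move=> Lx; rewrite -[- x]add0r; apply: LB. Qed.

Lemma LD x y : L x -> L y -> L (x + y).
Proof. by move=> Lx Ly; rewrite -[y]opprK; apply: LB => //; apply: LN. Qed.

Lemma L_Lperp x : L x -> Lperp x.
Proof. by move=> Lx l Ll; apply: Lc. Qed.

Lemma LperpD x y : Lperp x -> Lperp y -> Lperp (x + y).
Proof. by move=> Lx Ly l Ll; rewrite cDl Lx // Ly // mulr1. Qed.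

Lemma Lperp_sym x l : Lperp x -> L l -> c l x = 1.
Proof. by move=> Lx Ll; have := cC x l; rewrite Lx // mul1r. Qed.

Lemma LperpN x : Lperp x -> Lperp (- x).
Proof. by move=> Lx l Ll; rewrite cNl Lperp_sym. Qed.

Lemma LperpB x y : Lperp x -> Lperp y -> Lperp (x - y).
Proof. by move=> Lx Ly; apply: LperpD => //; apply: LperpN. Qed.

Lemma fixedH_subspace : linear_subspace fixedH.
Proof.
split=> [l Ll|a u v Fu Fv l Ll]; first by rewrite omv0.
by rewrite omD omZ Fu // Fv.
Qed.

Lemma om_period w l v : Lperp w -> L l -> fixedH v -> om (w + l) v = om w v.
Proof. by move=> Lw Ll Fv; rewrite -{2}(Fv l Ll) omM Lw // scale1r. Qed.

Lemma om_periodB x y v : Lperp y -> L (x - y) -> fixedH v -> om x v = om y v.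
Proof. by move=> Ly Lxy Fv; rewrite -(om_period Ly Lxy Fv) addrC subrK. Qed.

Lemma fixedH_om w v : Lperp w -> fixedH v -> fixedH (om w v).
Proof. by move=> Lw Fv l Ll; rewrite omM Lperp_sym // scale1r addrC om_period. Qed.

(** Some [om l'] fixes [u] and multiplies [om w v] by a scalar different from 1. *)
Lemma dot_notLperp u v w : fixedH u -> fixedH v -> ~ Lperp w -> dot u (om w v) = 0.
Proof.
move=> Fu Fv nLw.
have [l Ll lw] : exists2 l, L l & c w l != 1.
  apply: contrapT => h; apply: nLw => l Ll; apply: contrapT => /eqP hl.
  by apply: h; exists l.
have [l' Ll' le] := Lhalf Ll.
have e1 : om l' (om w v) = (c l' w * c l' w) *: om w v.
  by rewrite -{2}(Fv l' Ll') omM omM scalerA [w + l']addrC -mulrA cC mulr1.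
have e2 : dot u (om w v) = (c l' w * c l' w)^* * dot u (om w v).
  by rewrite -[in LHS](om_iso l') Fu // e1 dotZr.
apply: contrapT => /eqP d0; move/eqP: lw; apply.
have hc : (c l' w * c l' w)^* = 1 by apply: (mulIf d0); rewrite -e2 mul1r.
have h : c l' w * c l' w = 1 by rewrite -[LHS]conjCK hc rmorph1.
have : c w l * (c l' w * c l' w) = 1.
  by rewrite le cDr mulrACA cC mulr1.
by rewrite h mulr1.
Qed.

Lemma om_rn x v : rn (om x v) = rn v.
Proof. by apply: rn_isometry; [exact: HH|exact: om_iso]. Qed.

Lemma omB x u v : om x (u - v) = om x u - om x v.
Proof. by rewrite omD -scaleN1r omZ scaleN1r. Qed.

(* The closed convex set of the vectors within [e] of the whole orbit [om L v] is stable
   under [om L], so its element of least norm is fixed by [om L]. *)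
Lemma smooth_approx v (e : R) : (forall l, L l -> rn (om l v - v) <= e) ->
  exists2 u, fixedH u & rn (u - v) <= e.
Proof.
move=> Le; pose K := [set u | forall l, L l -> rn (u - om l v) <= e].
have Kc : closed K.
  move=> u cu l Ll; apply/ler_addgt0Pr => d d0.
  have [|u' [Ku' u'd]] := cu [set u' | rn (u' - u) < d]; first by apply/nbhs_rn; exists d.
  rewrite -[u - _](subrKA u'); apply: le_trans (rnD _ _) _.
  by rewrite addrC lerD ?Ku' // rnBC ltW.
have K0 : K !=set0 by exists v => l Ll; rewrite rnBC Le.
have [x y Kx Ky l Ll|x Kx xmin] := min_norm HH Kc K0.
  have -> : 2%:R^-1 *: (x + y) - om l v = 2%:R^-1 *: ((x - om l v) + (y - om l v)).
    rewrite addrACA -opprD scalerBr; congr (_ - _).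
    by rewrite -mulr2n -(scaler_nat 2 (om l v)) scalerA mulVf ?pnatr_eq0 // scale1r.
  rewrite rnZ; have -> : rn (2%:R^-1 : C^o) = 2%:R^-1.
    by apply: complexI; rewrite rnE normfV normr_nat fmorphV rmorph_nat.
  have := rnD (x - om l v) (y - om l v); have := Kx l Ll; have := Ky l Ll; lra.
exists x; last by have := Kx 0 L0; rewrite om0.
move=> l Ll; apply: xmin; last by rewrite om_rn.
move=> l' Ll'; rewrite -(om_rn (- l)) omB !omM cNl cxx cNl (Lc Ll' Ll) !scale1r addNr om0.
by apply: Kx; apply: LD => //; apply: LN.
Qed.

Variables (N : nat) (rep : 'I_N -> A).
Hypothesis rep_Lperp : forall i, Lperp (rep i).
Hypothesis rep_inj : forall i j, L (rep i - rep j) -> i = j.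
Hypothesis rep_surj : forall w, Lperp w -> exists i, L (w - rep i).

(** Sums over the quotient of [Lperp] by [L] are sums over representatives; an injective self-map of
    this finite quotient is a permutation. *)
Lemma rep_reindex (Z : nmodType) (F : A -> Z) (phi : A -> A) :
    (forall w, Lperp w -> Lperp (phi w)) ->
    (forall x y, Lperp x -> Lperp y -> L (phi x - phi y) -> L (x - y)) ->
    (forall x y, Lperp x -> Lperp y -> L (x - y) -> F x = F y) ->
  \sum_i F (phi (rep i)) = \sum_i F (rep i).
Proof.
move=> phiL phi_inj Fper.
have [s sP] := choice (fun i => rep_surj (phiL _ (rep_Lperp i))).
have s_inj : injective s.
  move=> i j sij; apply: rep_inj; apply: phi_inj => //.
  rewrite -[_ - _](subrKA (rep (s i))) {2}sij; apply: LD => //.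
  by rewrite -opprB; apply: LN.
rewrite [RHS](reindex_inj s_inj); apply: eq_bigr => i _.
by apply: Fper => //; apply: phiL.
Qed.

(** A fixed vector orthogonal to the translates of [v] by [Lperp] is orthogonal to all translates,
    the others contributing 0, so it vanishes by irreducibility. Finitely many translates therefore
    span the fixed vectors; the subspace [P] turns this into an induction principle. *)
Lemma fixedH_onb (P : set H) v : linear_subspace P -> fixedH v -> v != 0 ->
    (forall w, Lperp w -> P (om w v)) ->
  exists m (e : 'I_m -> H), [/\ orthofam dot e, forall i, P (e i), forall i, fixedH (e i)
    & forall x, fixedH x -> oproj dot e x = x].
Proof.
move=> SP Fv v0 Pv; have SF := fixedH_subspace.
pose P' := P `&` fixedH.
have SP' : linear_subspace P'.
  split=> [|a x y [Px Fx] [Py Fy]]; first by split; [case: SP|case: SF].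
  by split; [case: SP => _; apply|case: SF => _; apply].
have [y|m [e [eo eP es]]] := @gram_schmidt _ _ _ HH P' [seq om (rep i) v | i <- enum 'I_N] SP'.
  by case/mapP => i _ ->; split; [apply: Pv|apply: fixedH_om].
exists m, e; split=> // [i|i|x Fx]; [by case: (eP i)|by case: (eP i)|].
apply/esym/eqP; rewrite -subr_eq0; apply/eqP/(om_irr v0) => w.
have Fxe : fixedH (x - oproj dot e x).
  by apply: (subspaceB SF Fx); apply: (subspace_sum _ _ SF) => i; case: (eP i).
have [Lw|nLw] := pselect (Lperp w); last exact: dot_notLperp.
have [i Li] := rep_surj Lw.
rewrite (om_periodB _ Li) //; apply: oproj_orth_fix => //; apply: es.
by apply: map_f; rewrite mem_enum.
Qed.

Lemma fixedH_ind (P : set H) v : linear_subspace P -> fixedH v -> v != 0 ->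
  (forall w, Lperp w -> P (om w v)) -> fixedH `<=` P.
Proof.
move=> SP Fv v0 Pv x Fx; have [m [e [eo eP eF ex]]] := fixedH_onb SP Fv v0 Pv.
by rewrite -(ex x Fx); apply: subspace_sum.
Qed.

Lemma fixedH_basis : exists m (e : 'I_m -> H),
  [/\ orthofam dot e, forall i, fixedH (e i) & forall x, fixedH x -> oproj dot e x = x].
Proof.
have [[v [Fv v0]]|h] := pselect (exists v, fixedH v /\ v != 0).
  have [w Lw|m [e [eo _ eF ex]]] := @fixedH_onb fixedH v fixedH_subspace Fv v0.
    exact: fixedH_om.
  by exists m, e; split.
exists 0%N, (fun=> 0); split; [by case|by case|move=> x Fx].
rewrite /oproj big_ord0; apply: contrapT => x0; apply: h.
by exists x; split=> //; apply/eqP => x1; apply: x0; rewrite x1.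
Qed.

(** An eigenvector exists because the fixed vectors have finite dimension; its eigenspace is stable
    under [Lperp], hence everything by [fixedH_ind]. *)
Lemma schur (B : H -> H) : linear B -> (forall x, fixedH x -> fixedH (B x)) ->
    (forall w x, Lperp w -> fixedH x -> B (om w x) = om w (B x)) ->
  exists a, forall x, fixedH x -> B x = a *: x.
Proof.
move=> BL BF Bom.
have B0 : B 0 = 0 by have := BL (-1) 0 0; rewrite scaler0 addr0 scaleN1r addNr.
have [[v0 [Fv0 v0n]]|h] := pselect (exists v, fixedH v /\ v != 0); last first.
  exists 0 => x Fx; have -> : x = 0.
    by apply: contrapT => /eqP x0; apply: h; exists x.
  by rewrite scaler0.
have [m [e [eo eF ex]]] := fixedH_basis.
have BD x y : B (x + y) = B x + B y by have := BL 1 x y; rewrite !scale1r.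
have BZ a x : B (a *: x) = a *: B x by have := BL a x 0; rewrite !addr0 B0 addr0.
have Bsum (q : 'I_m -> C) : B (\sum_i q i *: e i) = \sum_i q i *: B (e i).
  by elim/big_rec2: _ => // i x y _ <-; rewrite BD BZ.
have m0 : (0 < m)%N.
  rewrite lt0n; apply/eqP => m0; case/eqP: v0n; rewrite -(ex v0 Fv0) /oproj.
  by apply: big1 => i; have := leq_trans (ltn_ord i) (eq_leq m0).
pose M := \matrix_(i, j) dot (B (e i)) (e j).
have [a /eigenvalueP[q qM q0]] := eigenvalue_closed M m0.
pose v := \sum_i q 0 i *: e i.
have Fv : fixedH v by apply: subspace_sum => //; apply: fixedH_subspace.
have vq j : dot v (e j) = q 0 j.
  rewrite /v dot_suml (bigD1 j) //= dotZl eo eqxx mulr1 big1 ?addr0 // => i ij.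
  by rewrite dotZl eo (negPf ij) mulr0.
have v_n0 : v != 0.
  apply: contraNneq q0 => ve; apply/eqP/rowP => j; rewrite mxE -vq ve; exact: dot0l.
have Bv : B v = a *: v.
  rewrite -(ex _ (BF _ Fv)) /oproj scaler_sumr; apply: eq_bigr => j _.
  rewrite scalerA; congr (_ *: _).
  have -> : a * q 0 j = (q *m M) 0 j by rewrite qM mxE.
  rewrite mxE Bsum dot_suml; apply: eq_bigr => i _; by rewrite dotZl mxE.
exists a; apply: (@fixedH_ind [set x | B x = a *: x] v) => //.
  split=> [|b x y /= hx hy]; first by rewrite /= B0 scaler0.
  by rewrite BD BZ hx hy scalerDr !scalerA mulrC.
by move=> w Lw /=; rewrite Bom // Bv omZ.
Qed.

(** Elements of [Lperp] congruent modulo [L] act alike on fixed vectors, so there [U] commutes with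
    the action of [Lperp] and Schur's lemma applies. *)
Lemma near_scalar (U : H -> H) (g : A -> A) : linear U ->
    (forall w v, U (om w v) = om (g w) (U v)) ->
    (forall w, Lperp w -> L (g w - w)) ->
    (forall l, L l -> exists2 l', L l' & g l' = l) ->
  exists a, forall x, fixedH x -> U x = a *: x.
Proof.
move=> UL Uom gL gsurj.
have UF x : fixedH x -> fixedH (U x).
  by move=> Fx l /gsurj[l' Ll' <-]; rewrite -Uom Fx.
apply: schur => // w x Lw Fx.
by rewrite Uom; apply: om_periodB; [|apply: gL|apply: UF].
Qed.

(** The sum of products of matrix coefficients, one of them at the inverse element, in the Schur
    orthogonality relations for the action of [Lperp] modulo [L]. *)
Definition rep_form a b x y := \sum_i dot (om (rep i) a) b * dot (om (- rep i) x) y.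

Lemma rep_form_period a b x y w w' : fixedH a -> fixedH x -> Lperp w -> Lperp w' -> L (w - w') ->
  dot (om w a) b * dot (om (- w) x) y = dot (om w' a) b * dot (om (- w') x) y.
Proof.
move=> Fa Fx Lw Lw' Lww; rewrite (om_periodB Lw' Lww) //; congr (_ * dot _ _).
by apply: om_periodB => //; [apply: LperpN|rewrite -opprD; apply: LN].
Qed.

(** [B] is the sum of the conjugates of a rank one operator under [Lperp] modulo [L]; it commutes
    with [Lperp], hence is scalar. *)
Lemma rep_form_scalar a y : fixedH a -> fixedH y ->
  exists d, forall x b, fixedH x -> rep_form a b x y = d * dot x b.
Proof.
move=> Fa Fy.
pose B x := \sum_i dot (om (- rep i) x) y *: om (rep i) a.
have BL : linear B.
  move=> t u v; rewrite /B scaler_sumr -big_split; apply: eq_bigr => i _ /=.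
  by rewrite omL dotDl dotZl scalerDl scalerA.
have [x _|u x Lu Fx|d dP] := schur BL.
- apply: subspace_sum; first exact: fixedH_subspace.
  by move=> i; apply: fixedH_om.
- pose F w := dot (om (- w) x) y *: om w a.
  have shift (w : A) : dot (om (- w) (om u x)) y *: om w a = om u (F (w - u)).
    rewrite /F omZ omM [om u (om _ _)]omM addrC [u + (w - u)]addrC subrK opprB scalerA dotZl.
    congr (_ *: _); rewrite [RHS]mulrC; congr (_ * _).
    by rewrite cDr cNr cxx mulr1 cNl.
  rewrite /B; under eq_bigr do rewrite shift.
  rewrite -(big_morph (om u) (omD u) (omv0 u)) (@rep_reindex _ F (fun w => w - u)) //.
  + by move=> w Lw; apply: LperpB.
  + by move=> w w' _ _; rewrite opprB addrA subrK.
  + move=> w w' Lw Lw' Lww; rewrite /F (om_periodB Lw' Lww) //; congr (dot _ _ *: _).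
    by apply: om_periodB => //; [apply: LperpN|rewrite -opprD; apply: LN].
exists d => x b Fx; rewrite -dotZl -dP // dot_suml; apply: eq_bigr => i _.
by rewrite dotZl mulrC.
Qed.

Lemma rep_form_sym a b x y : fixedH a -> fixedH x -> rep_form a b x y = rep_form x y a b.
Proof.
move=> Fa Fx; rewrite /rep_form.
rewrite -(@rep_reindex _ (fun w => dot (om w a) b * dot (om (- w) x) y) (fun w => - w)).
- by apply: eq_bigr => i _; rewrite opprK mulrC.
- exact: LperpN.
- by move=> w w' _ _; rewrite -opprD => /LN; rewrite opprK.
- by move=> w w' Lw Lw' Lww; apply: rep_form_period.
Qed.

(** The scalar depends on [a] and [y] only, and the symmetry of the form in its two pairs makes it
    proportional to [dot a y]. At [v] the terms are squares of absolute values and the class of 0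
    contributes a positive one, whence [K != 0]. *)
Lemma rep_formE v : fixedH v -> v != 0 -> exists2 K, K != 0 &
  forall a b x y, fixedH a -> fixedH b -> fixedH x -> fixedH y ->
    rep_form a b x y = K * dot a y * dot x b.
Proof.
move=> Fv v0; have vv : dot v v != 0 by rewrite dnorm_eq0.
have [d dP] := rep_form_scalar Fv Fv.
exists (d / dot v v).
  suff : d * dot v v != 0 by rewrite !mulf_eq0 invr_eq0.
  rewrite -(dP v v) // gt_eqF //.
  have [i Li] := rep_surj (L_Lperp L0).
  have pos j : 0 <= dot (om (rep j) v) v * dot (om (- rep j) v) v.
    rewrite (om_adj (- rep j)) opprK [X in _ * X]dotC -normCK exprn_ge0 //.
  rewrite /rep_form (bigD1 i) //= ltr_pwDl ?sumr_ge0 // lt_neqAle pos andbT eq_sym.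
  have -> : om (rep i) v = v.
    by rewrite -(om_periodB (rep_Lperp i) Li Fv) om0.
  rewrite om_adj opprK -(om_periodB (rep_Lperp i) Li Fv) om0 mulf_neq0 //.
move=> a b x y Fa Fb Fx Fy.
have [d' d'P] := rep_form_scalar Fa Fy.
rewrite d'P //; congr (_ * _); apply: (mulIf vv).
by rewrite -d'P // rep_form_sym // dP // mulrAC mulfVK.
Qed.

Variable S : A -> A.
Hypothesis SB : forall x y, S (x - y) = S x - S y.
Hypothesis SS : forall x, S (S x) = x.
Hypothesis Sc : forall x y, c (S x) (S y) = c y x.
Hypothesis SL : forall x, L x -> L (S x).

(* The substitution [w -> S w] reverses the order of multiplication in the twisted
   convolution of the matrix coefficients; this is Gelfand's trick. *)
Lemma gelfand_trick v v' : fixedH v -> fixedH v' -> v != 0 -> dot v v' = 0 ->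
    (forall w, dot (om (S w) v) v' = dot (om w v) v') ->
    (forall w, dot (om (S w) v') v' = dot (om w v') v') ->
  v' = 0.
Proof.
move=> Fv Fv' v0 vv' inv1 inv2.
have [//|v'0] := eqVneq v' 0; exfalso; move/eqP: (v'0); apply.
have [K K0 KP] := rep_formE Fv v0.
have LpS w : Lperp w -> Lperp (S w).
  by move=> Lw l Ll; rewrite -(SS l) Sc; apply: Lperp_sym => //; apply: SL.
(* Once the coefficients between [v] and [v'] vanish on [Lperp], [v'] is orthogonal to every
   translate of [v]. *)
suff f0 w : Lperp w -> dot (om w v) v' = 0.
  apply: (om_irr v0) => w; have [Lw|nLw] := pselect (Lperp w).
    exact/dot_eq0C/f0.
  exact: dot_notLperp.
move=> Lw.
have twist u z : dot (om (- u) (om z v)) v' = c z u * dot (om (z - u) v) v'.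
  by rewrite omM dotZl cNl addrC.
have twist' u z : dot (om (- u) (om z v')) v' = c z u * dot (om (z - u) v') v'.
  by rewrite omM dotZl cNl addrC.
(* By orthogonality, one sum is a non-zero multiple of the coefficient at [w] and the other carries
   the factor [dot v v' = 0]. The substitutions [u -> S u] and [u -> w - u] identify the two
   sums. *)
have e1 : rep_form v' v' (om (S w) v) v' = K * dot v' v' * dot (om w v) v'.
  by rewrite KP // ?inv1 //; apply: fixedH_om => //; apply: LpS.
have e2 : rep_form v v' (om w v') v' = 0.
  by rewrite KP // ?vv' ?mulr0 ?mul0r //; apply: fixedH_om.
have e3 : rep_form v' v' (om (S w) v) v' = rep_form v v' (om w v') v'.
  have FSw : fixedH (om (S w) v) by apply: fixedH_om => //; apply: LpS.
  have Fw : fixedH (om w v') by apply: fixedH_om.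
  rewrite /rep_form -(@rep_reindex _ (fun u => dot (om u v') v' * dot (om (- u) (om (S w) v)) v') S) //.
  - rewrite -[RHS](@rep_reindex _ (fun u => dot (om u v) v' * dot (om (- u) (om w v')) v') (fun u => w - u)).
    + apply: eq_bigr => i _; rewrite inv2 twist twist' -SB inv1 Sc.
      have -> : c w (w - rep i) = c (rep i) w by rewrite cDr cxx mul1r cNr.
      rewrite subKr; ring.
    + by move=> u Lu; apply: LperpB.
    + by move=> u u' _ _; rewrite opprB addrC subrKA => /LN; rewrite opprB.
    + by move=> u u' Lu Lu' Luu; apply: rep_form_period.
  - by move=> u u' _ _; rewrite -SB => /SL; rewrite SS.
  - by move=> u u' Lu Lu' Luu; apply: rep_form_period.
have v'v' : dot v' v' != 0 by rewrite dnorm_eq0.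
by apply/eqP; have /eqP := e1; rewrite e3 e2 eq_sym !mulf_eq0 (negPf K0) (negPf v'v').
Qed.

End Heisenberg.

(** * Simultaneous eigenvectors of finitely many commuting isometries *)

Section Codiagonalization.
Variables (R : realType) (H : completeNormedModType R[i]) (dot : {dot H for Num.conj}).
Local Notation C := R[i].
Variables (m : nat) (e : 'I_m -> H) (I : eqType) (ts : seq I) (U : I -> H -> H).
Hypothesis eo : orthofam dot e.
Hypothesis UL : forall t, t \in ts -> linear (U t).
Hypothesis U_iso : forall t u v, t \in ts -> dot (U t u) (U t v) = dot u v.
Hypothesis Ue : forall t i, t \in ts -> oproj dot e (U t (e i)) = U t (e i).
Hypothesis Ucomm : forall t t' v, t \in ts -> t' \in ts -> U t (U t' v) = U t' (U t v).

Let M t := \matrix_(i, j) dot (U t (e i)) (e j).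

Let U0 t : t \in ts -> U t 0 = 0.
Proof. by move=> tt; have := UL tt (-1) 0 0; rewrite scaler0 addr0 scaleN1r addNr. Qed.
Let UD t (tt : t \in ts) x y : U t (x + y) = U t x + U t y.
Proof. by have := UL tt 1 x y; rewrite !scale1r. Qed.
Let UZ t a x : t \in ts -> U t (a *: x) = a *: U t x.
Proof. by move=> tt; have := UL tt a x 0; rewrite !addr0 U0 // addr0. Qed.

Let lc (q : 'rV[C]_m) := \sum_i q 0 i *: e i.

Let lc_dot q j : dot (lc q) (e j) = q 0 j.
Proof.
rewrite dot_suml (bigD1 j) //= dotZl eo eqxx mulr1 big1 ?addr0 // => i ij.
by rewrite dotZl eo (negPf ij) mulr0.
Qed.

Let U_lc t q : t \in ts -> U t (lc q) = lc (q *m M t).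
Proof.
move=> tt; rewrite /lc (big_morph (U t) (UD tt) (U0 tt)).
under eq_bigr => i _ do rewrite UZ // -(Ue i tt) /oproj scaler_sumr.
rewrite exchange_big /=; apply: eq_bigr => j _.
by rewrite mxE scaler_suml; apply: eq_bigr => i _; rewrite scalerA mxE.
Qed.

Let lc_delta i : lc (delta_mx 0 i) = e i.
Proof.
rewrite /lc (bigD1 i) //= mxE !eqxx scale1r big1 ?addr0 // => j ji.
by rewrite mxE (negPf ji) andbF scale0r.
Qed.

Let lc_inj q q' : lc q = lc q' -> q = q'.
Proof. by move=> h; apply/rowP => j; rewrite -!lc_dot h. Qed.

Let M_normal t : t \in ts -> M t \is normalmx.
Proof.
move=> tt; have Mu : M t \is unitarymx.
  apply/unitarymxP/matrixP => i j; rewrite !mxE -(eo i j) -(U_iso _ _ tt).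
  rewrite -[in RHS](Ue i tt) dot_suml; apply: eq_bigr => l _.
  by rewrite dotZl !mxE [dot (e l) _]dotC.
apply/normalmxP; rewrite (unitarymxP Mu) -(invmx_unitary Mu) mulVmx //.
exact: unitarymx_unit.
Qed.

(** On the span of the orthonormal family the operators have unitary matrices, which are normal and
    hence diagonalizable; commutation makes the diagonalization simultaneous. *)
Lemma unitary_codiagonalization : exists f : 'I_m -> H,
  [/\ forall i, exists q : 'rV[C]_m, f i = \sum_j q 0 j *: e j, forall i, f i != 0,
      forall i, exists q : 'rV[C]_m, e i = \sum_j q 0 j *: f j
    & forall i t, t \in ts -> exists a, U t (f i) = a *: f i].
Proof.
have [P Pu /allP PD] : codiagonalizable [seq M t | t <- ts].
  apply/codiagonalizableP; split=> [_ _ /mapP[t tt ->] /mapP[t' tt' ->]|_ /mapP[t tt ->]].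
    apply/row_matrixP => i; rewrite !rowE !mulmxA; apply: lc_inj.
    by rewrite -!U_lc // Ucomm.
  have /orthomx_spectralP ME := M_normal tt.
  have Su := unitarymx_unit (spectral_unitarymx (M t)).
  exists (spectralmx (M t)) => //; apply/diagonalizable_forPex.
  exists (spectral_diag (M t)); apply/(simmxP Su).
  by rewrite [X in _ *m X = _]ME !mulmxA mulmxV // mul1mx.
exists (fun i => lc (row i P)); split=> [i|i|i|i t tt].
- by exists (row i P).
- apply/eqP => h; have : row i P = 0 by apply: lc_inj; rewrite h /lc big1 // => j _; rewrite mxE scale0r.
  move=> ri0; have : row i 1%:M = 0 :> 'rV[C]_m by rewrite -(mulmxV Pu) row_mul ri0 mul0mx.
  by move/rowP/(_ i); rewrite !mxE eqxx => /eqP; rewrite oner_eq0.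
- exists (row i (invmx P)); rewrite -lc_delta /lc.
  under [RHS]eq_bigr do rewrite scaler_sumr.
  rewrite exchange_big /=; apply: eq_bigr => j _.
  under eq_bigr do rewrite scalerA.
  rewrite -scaler_suml; congr (_ *: _).
  have -> : delta_mx 0 i = row i (invmx P *m P) :> 'rV[C]_m by rewrite mulVmx // row1.
  by rewrite mxE mxE; apply: eq_bigr => l _; rewrite !mxE.
- have := PD (M t) (map_f _ tt) => /= /diagonalizable_forPex[D /(simmxP Pu) PM].
  exists (D 0 i); rewrite U_lc // -row_mul PM row_mul row_diag_mx -scalemxAl -rowE /lc scaler_sumr.
  by apply: eq_bigr => j _; rewrite scalerA !mxE.
Qed.

End Codiagonalization.

(** * Lattices and additive characters *)

Section LocalCharacter.
Variables (R : realType) (k : nonarchLocalFieldType R) (psi : k -> R[i]^o).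
Local Notation av := (absv : k -> R).
Hypothesis psi_char : unitary_character psi.

Lemma psiD x y : psi (x + y) = psi x * psi y.
Proof. by case: psi_char. Qed.

Lemma psi0 : psi 0 = 1.
Proof.
have [_ n1 _] := psi_char.
have p0 : psi 0 != 0 by rewrite -normr_eq0 n1 oner_eq0.
by apply: (mulfI p0); rewrite -psiD addr0 mulr1.
Qed.

(* No small subgroups: squaring expands distances to 1 near 1 by a factor 3/2. *)
Lemma psi_trivial_near0 : exists2 r, 0 < r & forall x, av x <= r -> psi x = 1.
Proof.
have [_ _ psi_cont] := psi_char.
have : nbhs (psi 0) [set z : R[i]^o | rn (z - 1) < 2%:R^-1].
  by rewrite psi0; apply/nbhs_rn; exists 2%:R^-1; rewrite ?invr_gt0.
move/(psi_cont 0); rewrite /= nbhs_simpl nbhs_absv => -[e /= e0 eP].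
have near x : av x < e -> rn (psi x - 1) < 2%:R^-1.
  by move=> xe; apply: eP; rewrite /ball_ /= sub0r absvN.
exists (e / 2%:R); first by rewrite divr_gt0.
move=> x xe; apply: contrapT => /eqP px.
have {}xe : av x < e by apply: le_lt_trans xe _; rewrite ltr_pdivrMr // ltr_pMr // ltr1n.
have small j : av (2%:R ^+ j * x) < e.
  apply: le_lt_trans xe; rewrite absvM ler_piMl ?absv_ge0 // absvX exprn_ile1 ?absv_ge0 //.
  exact: absv_nat_le1.
set d := rn (psi x - 1).
have d0 : 0 < d.
  rewrite lt_neqAle rn_ge0 andbT eq_sym; apply: contra px => /eqP d0.
  by rewrite -subr_eq0; apply/eqP/rn_eq0; rewrite -/d d0.
(* Linear growth is weaker than a factor 3/2 at each step, but already contradicts the bound 1/2 for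
   large [j]. *)
have grow j : d * (1 + j%:R / 2%:R) <= rn (psi (2%:R ^+ j * x) - 1).
  elim: j => [|j IH]; first by rewrite expr0 mul1r mul0r addr0 mulr1.
  have -> : psi (2%:R ^+ j.+1 * x) - 1 = (psi (2%:R ^+ j * x) + 1) *: (psi (2%:R ^+ j * x) - 1).
    have -> : 2%:R ^+ j.+1 * x = 2%:R ^+ j * x + 2%:R ^+ j * x.
      by rewrite exprS -mulrA mulr_natl mulr2n.
    rewrite psiD /GRing.scale /=; ring.
  rewrite rnZ; set z := psi _ in IH *.
  have zs : rn (z - 1) < 2%:R^-1 by apply: near.
  have zp : 3%:R / 2%:R <= rn (z + 1 : R[i]^o).
    have := rnD (z + 1) (- (z - 1)); rewrite rnN.
    have -> : z + 1 - (z - 1) = 2%:R by ring.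
    have -> : rn (2%:R : R[i]^o) = 2%:R.
      by apply: complexI; rewrite rnE normr_nat rmorph_nat.
    lra.
  apply: le_trans (_ : 3%:R / 2%:R * (d * (1 + j%:R / 2%:R)) <= _).
    have : 0 <= d * j%:R by rewrite mulr_ge0 // ltW.
    rewrite -natr1 => h; have -> : d * (1 + (j%:R + 1) / 2%:R) = d + d * j%:R / 2%:R + d / 2%:R by field.
    have -> : 3%:R / 2%:R * (d * (1 + j%:R / 2%:R)) = 3%:R / 2%:R * d + 3%:R / 4%:R * (d * j%:R) by field.
    lra.
  apply: ler_pM => //; first by rewrite divr_ge0.
  by rewrite mulr_ge0 ?(ltW d0) // addr_ge0 // divr_ge0.
have := archi_boundP (ltW (_ : 0 < d^-1)); rewrite invr_gt0 => /(_ d0).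
set j := Num.bound _ => dj.
have := le_lt_trans (grow j) (near _ (small j)).
have : 1 < d * j%:R by rewrite mulrC -ltr_pdivrMr // mul1r.
have -> : d * (1 + j%:R / 2%:R) = d + d * j%:R / 2%:R by field.
lra.
Qed.

End LocalCharacter.

Section CosetRepresentatives.
Variables (R : realType) (k : nonarchLocalFieldType R) (n : nat) (L P : set 'cV[k]_n) (d rho : R).
Hypothesis d0 : 0 < d.
Hypothesis Ld : forall x, nrm x < d -> L x.
Hypothesis LB : forall x y, L x -> L y -> L (x - y).
Hypothesis Prho : forall x, P x -> nrm x <= rho.

(** Finitely many balls of radius [d] cover [P], and each lies in a single coset of [L]. The balls
    are treated one after another, a representative being added only if the ball contains a point of
    [P] outside the cosets already met. *)
Lemma coset_representatives : exists N (rep : 'I_N -> 'cV[k]_n),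
  [/\ forall i, P (rep i), forall i j, L (rep i - rep j) -> i = j
    & forall w, P w -> exists i, L (w - rep i)].
Proof.
have [s sP] := @gauge_cover _ _ _ _ rho (fun _ : 'cV[k]_n => d) (fun=> d0).
have LD x y : L x -> L y -> L (x + y).
  move=> Lx Ly; rewrite -[y]opprK; apply: LB => //; rewrite -sub0r; apply: LB => //.
  by apply: Ld; rewrite nrm0.
suff [N [rep [rP ri rs]]] : exists N (rep : 'I_N -> 'cV[k]_n),
  [/\ forall i, P (rep i), forall i j, L (rep i - rep j) -> i = j
    & forall w y, P w -> y \in s -> nrm (w - y) < d -> exists i, L (w - rep i)].
  exists N, rep; split=> // w Pw; have [y ys [_ wy]] := sP w (Prho Pw).
  exact: rs wy.
elim: s {sP} => [|y s [N [rep [rP ri rs]]]].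
  by exists 0%N, (fun=> 0); split=> [[]|[]|].
have near u w : nrm (u - y) < d -> nrm (w - y) < d -> L (w - u).
  by move=> uy wy; apply: Ld; rewrite -[w - u](subrKA y) -[y - u]opprB nrmB_lt.
have [[u [Pu uy un]]|h] := pselect (exists u, [/\ P u, nrm (u - y) < d & forall i, ~ L (u - rep i)]).
  pose rep' (i : 'I_N.+1) := if unlift ord_max i is Some j then rep j else u.
  exists N.+1, rep'; split=> [i|i j|w z Pw].
  - by rewrite /rep'; case: unliftP.
  - rewrite /rep'; case: unliftP => [i'|] ->; case: unliftP => [j'|] -> //.
    + by move/ri ->.
    + move=> h; case: (un i'); rewrite -opprB -sub0r; apply: LB => //.
      by apply: Ld; rewrite nrm0.
    + by move=> h; case: (un j').
  - rewrite inE => /predU1P[->|zs] wz.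
      by exists ord_max; rewrite /rep' unlift_none; apply: near.
    by have [i Li] := rs w z Pw zs wz; exists (lift ord_max i); rewrite /rep' liftK.
exists N, rep; split=> // w z Pw; rewrite inE => /predU1P[->|zs] wz; last exact: rs wz.
by apply: contrapT => h'; apply: h; exists w; split=> // i Li; apply: h'; exists i.
Qed.

End CosetRepresentatives.

Section Lattices.
Variables (R : realType) (k : nonarchLocalFieldType R) (n : nat) (J : 'M[k]_n) (G : set 'M[k]_n).
Local Notation av := (absv : k -> R).
Variable psi : k -> R[i]^o.
Hypothesis psi_char : unitary_character psi.
Hypothesis av2 : av 2%:R = 1.
Hypothesis two_neq0 : 2%:R != 0 :> k.
Hypothesis Jskew : J^T = - J.
Hypothesis Ju : J \in unitmx.
Implicit Types x y z : 'cV[k]_n.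

Definition bf x y : k := (x^T *m J *m y) 0 0.

Lemma bfDl x y z : bf (x + y) z = bf x z + bf y z.
Proof. by rewrite /bf linearD /= !mulmxDl mxE. Qed.

Lemma bfDr x y z : bf x (y + z) = bf x y + bf x z.
Proof. by rewrite /bf mulmxDr mxE. Qed.

Lemma bfC x y : bf x y = - bf y x.
Proof.
have -> : bf x y = ((x^T *m J *m y)^T) 0 0 by rewrite mxE.
by rewrite !trmx_mul trmxK Jskew mulNmx mulmxN mxE mulmxA.
Qed.

Lemma bfxx x : bf x x = 0.
Proof.
have : 2%:R * bf x x = 0 by rewrite mulr_natl mulr2n {2}bfC subrr.
by move/eqP; rewrite mulf_eq0 (negPf two_neq0) => /eqP.
Qed.

Lemma bf_mulmx g x y : bf (g *m x) (g *m y) = (x^T *m (g^T *m J *m g) *m y) 0 0.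
Proof. by rewrite /bf trmx_mul !mulmxA. Qed.

Lemma bf_antisympl S x y : S *m S = 1%:M -> adj J S = - S ->
  bf (S *m x) (S *m y) = - bf x y.
Proof.
move=> SS aS; rewrite bf_mulmx.
have -> : S^T *m J *m S = - J by rewrite adjP // aS mulmxN mulNmx -mulmxA SS mulmx1.
by rewrite mulmxN mulNmx mxE.
Qed.

Lemma bf_le x y : av (bf x y) <= nrm x * nrm J * nrm y.
Proof.
apply: le_trans (le_nrm _ _ _) _; apply: le_trans (nrmM _ _) _.
by rewrite ler_wpM2r ?nrm_ge0 //; apply: le_trans (nrmM _ _) _; rewrite nrm_tr.
Qed.

Definition hc x y : R[i] := psi (2%:R^-1 * bf x y).

Lemma hcDl x y z : hc (x + y) z = hc x z * hc y z.
Proof. by rewrite /hc bfDl mulrDr psiD. Qed.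

Lemma hcDr x y z : hc x (y + z) = hc x y * hc x z.
Proof. by rewrite /hc bfDr mulrDr psiD. Qed.

Lemma hcxx x : hc x x = 1.
Proof. by rewrite /hc bfxx mulr0 psi0. Qed.

(** The largest [G]-stable part of a ball, for a group [G]; boundedness of [G] makes it contain a
    smaller ball. *)
Definition lat (r : R) : set 'cV[k]_n := [set x | forall g, G g -> nrm (g *m x) <= r].

Variable C : R.
Hypothesis C1 : 1 <= C.
Hypothesis GC : forall g, G g -> nrm g <= C.
Hypothesis G1 : G 1%:M.
Hypothesis GM : forall g h, G g -> G h -> G (g *m h).

Let C0 : 0 < C. Proof. exact: lt_le_trans C1. Qed.

Lemma lat_nrm r x : lat r x -> nrm x <= r.
Proof. by move/(_ _ G1); rewrite mul1mx. Qed.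

Lemma nrm_lat r x : nrm x <= r / C -> lat r x.
Proof.
move=> xr g Gg; apply: le_trans (nrmM _ _) _; rewrite -(mulfVK (lt0r_neq0 C0) r) mulrC.
by rewrite ler_pM ?nrm_ge0 // GC.
Qed.

Lemma lat_le r r' : r <= r' -> lat r `<=` lat r'.
Proof. by move=> rr x Lx g Gg; apply: le_trans rr; apply: Lx. Qed.

Lemma lat0 r : 0 <= r -> lat r 0.
Proof. by move=> r0 g _; rewrite mulmx0 nrm0. Qed.

Lemma latB r x y : lat r x -> lat r y -> lat r (x - y).
Proof. by move=> Lx Ly g Gg; rewrite mulmxBr nrmB_le // ?Lx ?Ly. Qed.

Lemma lat_half r l : lat r l -> exists2 l', lat r l' & l = l' + l'.
Proof.
move=> Ll; exists (2%:R^-1 *: l).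
  move=> g Gg; rewrite -scalemxAr; apply: le_trans (nrmZ _ _) _.
  by rewrite absvV av2 invr1 mul1r Ll.
have h : 2%:R^-1 + 2%:R^-1 = 1 :> k by rewrite -mulr2n -(mulr_natl 2%:R^-1 2) divff.
by rewrite -scalerDl h scale1r.
Qed.

Lemma lat_act r g x : G g -> lat r x -> lat r (g *m x).
Proof. by move=> Gg Lx h Gh; rewrite mulmxA; apply: Lx; apply: GM. Qed.

Lemma lat_hc r r0 x y : 0 <= r -> r * nrm J * r <= r0 ->
  (forall t, av t <= r0 -> psi t = 1) -> lat r x -> lat r y -> hc x y = 1.
Proof.
move=> rge rr0 psi1 /lat_nrm xr /lat_nrm yr; apply: psi1.
rewrite absvM absvV av2 invr1 mul1r; apply: le_trans (bf_le _ _) _; apply: le_trans rr0.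
by rewrite !ler_pM ?mulr_ge0 ?nrm_ge0.
Qed.

(** If an entry [u] of the row of [w] against [J] exceeded [D], some multiple of a basis vector
    would lie in the lattice and pair with [w] to the value [psi z0], which is not 1. *)
Lemma lat_perp_bounded r (z0 : k) : 0 < r -> psi z0 <> 1 ->
  exists rho, forall w, (forall l, lat r l -> hc w l = 1) -> nrm w <= rho.
Proof.
move=> r0 z01; pose D := C * av z0 / r.
have D0 : 0 <= D by rewrite divr_ge0 ?mulr_ge0 ?absv_ge0 // ltW.
exists (D * nrm (invmx J)) => w wL.
have u_le : nrm (w^T *m J) <= D.
  apply: nrm_le => // i j; rewrite ord1 leNgt; apply/negP => Du.
  set u := (w^T *m J) 0 j in Du.
  have u0 : 0 < av u by apply: le_lt_trans Du.
  have un0 : u != 0 by rewrite -absv_eq0 gt_eqF.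
  (* The factor 2 cancels the half in [hc]. *)
  pose l : 'cV[k]_n := (2%:R * z0 / u) *: delta_mx j 0.
  have Ll : lat r l.
    apply: nrm_lat; apply: le_trans (nrmZ _ _) _.
    apply: le_trans (_ : av (2%:R * z0 / u) * 1 <= _).
      rewrite ler_wpM2l ?absv_ge0 //; apply: nrm_le => // i' j'; rewrite mxE.
      exact: absv_nat_le1.
    rewrite mulr1 !absvM av2 mul1r absvV ler_pdivrMr // mulrAC ler_pdivlMr //.
    by move: Du; rewrite /D ltr_pdivrMr // mulrC [X in _ < X]mulrC => /ltW.
  apply: z01; rewrite -(wL l Ll) /hc; congr psi.
  rewrite /bf /l -scalemxAr mxE -colE mxE -/u mulfVK // mulKf //.
rewrite -nrm_tr -[w^T](mulmxK Ju); apply: nrmM_le => //.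
Qed.

End Lattices.

Section Coordinates.
Variables (k : fieldType) (W : vectType k).
Local Notation n := (\dim {:W}).
Local Notation bas := (vbasis {:W}).

Definition vec_of (x : 'cV[k]_n) : W := passmx.vecof bas x^T.

Lemma vec_ofD (x y : 'cV[k]_n) : vec_of (x + y) = vec_of x + vec_of y.
Proof.
by have := passmx.vecof_linear bas 1 x^T y^T; rewrite !scale1r /vec_of [(x + y)^T]raddfD.
Qed.

Lemma vec_of0 : vec_of 0 = 0.
Proof. by rewrite /vec_of /passmx.vecof big1 // => i _; rewrite !mxE scale0r. Qed.

Lemma vec_of_surj w : exists x, vec_of x = w.
Proof.
exists (passmx.rVof bas w)^T; rewrite /vec_of trmxK.
by rewrite passmx.rVofK // vbasisP.
Qed.

Lemma vec_of_inj x y : vec_of x = vec_of y -> x = y.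
Proof.
move/(congr1 (passmx.rVof bas)); rewrite !passmx.vecofK ?vbasisP //.
exact: trmx_inj.
Qed.

Lemma end_vec_of (g : 'End(W)) x : g (vec_of x) = vec_of (mx_of_end g *m x).
Proof.
rewrite /vec_of (passmx.hom_vecof bas (vbasisP _)) /mx_of_end.
by rewrite trmx_mul trmxK.
Qed.

Lemma mx_of_endK (g : 'End(W)) : end_of_mx (mx_of_end g) = g.
Proof. by rewrite /end_of_mx /mx_of_end trmxK passmx.mxofK ?vbasisP. Qed.

Lemma end_of_mxK A : mx_of_end (end_of_mx A : 'End(W)) = A.
Proof. by rewrite /end_of_mx /mx_of_end passmx.hommxK ?vbasisP ?trmxK. Qed.

Lemma mx_of_end_inj (A B : 'M[k]_n) : (forall x : 'cV[k]_n, A *m x = B *m x) -> A = B.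
Proof. 
move=> h; apply/matrixP => i j.
by have := congr1 (fun M : 'cV[k]_n => M i 0) (h (delta_mx j 0)); rewrite -!colE !mxE.
 Qed.

Lemma mx_of_end_comp (g h : 'End(W)) : mx_of_end (g \o h)%VF = mx_of_end g *m mx_of_end h.
Proof.
apply: mx_of_end_inj => x; apply: vec_of_inj.
by rewrite -end_vec_of comp_lfunE !end_vec_of mulmxA.
Qed.

Lemma mx_of_end1 : mx_of_end (\1%VF : 'End(W)) = 1%:M.
Proof. by apply: mx_of_end_inj => x; apply: vec_of_inj; rewrite -end_vec_of id_lfunE mul1mx. Qed.

End Coordinates.

Section Gram.
Variables (k : fieldType) (W : vectType k) (beta : {skew_symmetric W}).
Local Notation n := (\dim {:W}).
Local Notation J := (gram beta).

Lemma gramE x y : beta (vec_of x) (vec_of y) = (x^T *m J *m y) 0 0.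
Proof.
rewrite /vec_of /passmx.vecof linear_sumlz mxE.
under [RHS]eq_bigr => j _ do rewrite mxE mulr_suml.
rewrite exchange_big /=; apply: eq_bigr => i _.
rewrite linear_sumr; apply: eq_bigr => j _.
by rewrite linearZl_LR linearZr_LR /= !mxE mulrA mulrAC.
Qed.

Lemma gram_skew : J^T = - J.
Proof.
by apply/matrixP => i j; rewrite !mxE [LHS]hermC /= expr1 mulN1r.
Qed.

Lemma gram_unitmx : is_psymplectic beta -> J \in unitmx.
Proof.
case=> nd _ _; rewrite -row_free_unit -kermx_eq0; apply/eqP/row_matrixP => i.
rewrite row0; apply/trmx_inj; rewrite trmx0; set u := (row i _)^T.
have uJ : u^T *m J = 0 by rewrite /u trmxK; apply/sub_kermxP/row_sub.
apply: vec_of_inj; rewrite vec_of0; apply/eqP; rewrite -memv0 -(eqP nd).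
apply/mem_orthovP => v _; have [y <-] := vec_of_surj v.
by rewrite gramE uJ mul0mx mxE.
Qed.

Lemma Sp_gram g : Sp beta g <-> (mx_of_end g)^T *m J *m mx_of_end g = J.
Proof.
split=> [gS|gJ w w'].
  apply/matrixP => i j.
  have eqE (A : 'M[k]_n) : A i j = ((delta_mx i (0 : 'I_1))^T *m A *m (delta_mx j (0 : 'I_1))) 0 0 :> k.
    by rewrite trmx_delta -rowE -colE !mxE.
  rewrite eqE [RHS]eqE -[RHS]gramE -gS !end_vec_of gramE trmx_mul !mulmxA //.
have [x <-] := vec_of_surj w; have [y <-] := vec_of_surj w'.
by rewrite !end_vec_of !gramE -[in RHS]gJ trmx_mul !mulmxA.
Qed.

End Gram.

(** * The torus in the Weil representation *)

Section WeilTorus.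
Variables (R : realType) (k : nonarchLocalFieldType R) (p n : nat) (J Y S : 'M[k]_n).
Variables (psi : k -> R[i]^o) (H : completeNormedModType R[i]) (dot : {dot H for Num.conj}).
Variable om : 'cV[k]_n -> H -> H.
Local Notation av := (absv : k -> R).
Local Notation C := R[i].
Local Notation cen := (centralizes Y).
Local Notation T := (Tset J Y).
Local Notation hcJ := (hc J psi).
Hypothesis pprime : prime p.
Hypothesis pres : av p%:R < 1.
Hypothesis p_neq2 : p <> 2%N.
Hypothesis two_neq0 : 2%:R != 0 :> k.
Hypothesis psi_char : unitary_character psi.
Hypothesis psi_nontrivial : exists x, psi x <> 1.
Hypothesis Jskew : J^T = - J.
Hypothesis Ju : J \in unitmx.
Hypothesis Yskew : Y^T *m J = - (J *m Y).
Hypothesis Yu : Y \in unitmx.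
Hypothesis Ccomm : forall b c, cen b -> cen c -> b *m c = c *m b.
Hypothesis Cidem : forall b, cen b -> exists e,
  [/\ cen e, e *m e = e, e^T *m J = J *m e, b *m e = 0 & b + e \in unitmx].
Hypothesis SS : S *m S = 1%:M.
Hypothesis aS : adj J S = - S.
Hypothesis Sb : forall b, cen b -> S *m b = adj J b *m S.
Hypothesis ST : forall w : 'cV[k]_n, exists2 g, T g & S *m w = g *m w.
Hypothesis HH : hilbert_dot dot.
Hypothesis omL : forall x, linear (om x).
Hypothesis om_iso : forall x u v, dot (om x u) (om x v) = dot u v.
Hypothesis omM : forall x y v, om x (om y v) = hcJ x y *: om (x + y) v.
Hypothesis om0 : forall v, om 0 v = v.
Hypothesis om_irr : forall u v, v != 0 -> (forall w, dot u (om w v) = 0) -> u = 0.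
Hypothesis om_cont : forall v (e : R), 0 < e ->
  exists2 r, 0 < r & forall x, nrm x <= r -> rn (om x v - v) <= e.
Variables (Mp : set ('M[k]_n * (H -> H))) (s : 'M[k]_n -> H -> H).
Hypothesis Mp_linear : forall g U, Mp (g, U) -> linear U.
Hypothesis Mp_iso : forall g U u v, Mp (g, U) -> dot (U u) (U v) = dot u v.
Hypothesis Mp_om : forall g U w v, Mp (g, U) -> U (om w v) = om (g *m w) (U v).
Hypothesis MpM : forall g h U V, Mp (g, U) -> Mp (h, V) -> Mp (g *m h, U \o V).
Hypothesis Mp_inv : forall g U, Mp (g, U) -> exists g' U',
  [/\ Mp (g', U'), g *m g' = 1%:M & forall v, U (U' v) = v].
Hypothesis Mp_surj : forall g, g^T *m J *m g = J -> exists U, Mp (g, U).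
Hypothesis Mp_ker : forall U, Mp (1%:M, U) -> forall v, U (U v) = v.
Hypothesis s_Mp : forall t, T t -> Mp (t, s t).
Hypothesis sM : forall t t' v, T t -> T t' -> s (t *m t') v = s t (s t' v).

Let av2 : av 2%:R = 1 := absv2 pprime pres p_neq2.
Let T1 : T 1%:M := Tset1 J Y.
Let TM := @TsetM k n J Y.
Let cDl := hcDl J psi_char.
Let cDr := hcDr J psi_char.
Let cxx := hcxx psi_char two_neq0 Jskew.

Definition smooth (r : R) : set H := fixedH om (lat T r).

Definition admissible (r : R) :=
  0 < r /\ forall x y, lat T r x -> lat T r y -> hcJ x y = 1.

Lemma admissible_le r r' : admissible r -> 0 < r' <= r -> admissible r'.
Proof.
by move=> [_ h] /andP[r'0 r'r]; split=> // x y Lx Ly; apply: h; apply: lat_le r'r _ _.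
Qed.

Lemma exists_admissible : exists r, admissible r.
Proof.
have [r0 r00 psi1] := psi_trivial_near0 psi_char.
have J1 : 0 < 1 + nrm J by rewrite ltr_pwDl ?nrm_ge0.
exists (Num.min 1 (r0 / (1 + nrm J))).
have r'0 : 0 < Num.min 1 (r0 / (1 + nrm J)) by rewrite lt_min ltr01 divr_gt0.
split=> // x y; apply: (lat_hc av2 T1 (ltW r'0) _ psi1).
set r := Num.min _ _ in r'0 *.
have r1 : r <= 1 by rewrite ge_min lexx.
have rr0 : r <= r0 / (1 + nrm J) by rewrite ge_min lexx orbT.
apply: le_trans (_ : r * (1 + nrm J) <= _); last by rewrite -ler_pdivlMr.
rewrite -mulrA ler_wpM2l ?(ltW r'0) //.
apply: le_trans (_ : nrm J * 1 <= _); first by rewrite ler_wpM2l ?nrm_ge0.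
by rewrite mulr1 lerDr.
Qed.

Lemma smooth_mono r r' : r' <= r -> smooth r `<=` smooth r'.
Proof. by move=> rr v Fv l Ll; apply: Fv; apply: lat_le rr _ Ll. Qed.

Lemma smooth_dense v (e : R) : 0 < e -> exists r u, [/\ admissible r, smooth r u & rn (u - v) <= e].
Proof.
move=> e0; have [r1 adm] := exists_admissible; have [r2 r20 r2P] := om_cont v e0.
have r10 := adm.1; pose r := Num.min r1 r2.
have r0 : 0 < r by rewrite lt_min r10 r20.
have ar : admissible r by apply: admissible_le adm _; rewrite r0 ge_min lexx.
have l0 : lat T r 0 by apply: lat0; apply: ltW.
have lB x y : lat T r x -> lat T r y -> lat T r (x - y) by apply: latB.
have [l Ll|u Fu ue] := smooth_approx (L := lat T r) HH cDl cDr cxx omL om_iso omM om0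
   l0 lB ar.2 (v := v) (e := e); last by exists r, u.
by apply: r2P; apply: le_trans (lat_nrm T1 Ll) _; rewrite ge_min lexx orbT.
Qed.

Lemma smooth_act r t v : T t -> smooth r v -> smooth r (s t v).
Proof.
move=> Tt Fv l Ll.
have {1}-> : l = t *m (invmx t *m l) by rewrite mulKVmx // (Tset_unitmx Ju Tt).
rewrite -(Mp_om _ _ (s_Mp Tt)) Fv //; apply: (lat_act TM) Ll.
exact: TsetV.
Qed.

Lemma lat_data r : admissible r -> exists rho C0, [/\ 0 <= rho, 1 <= C0,
  forall g, T g -> nrm g <= C0 & forall w, Lperp hcJ (lat T r) w -> nrm w <= rho].
Proof.
move=> ar; have [C0 C01 TC0] := Tset_bounded Jskew Ju Yskew Ccomm Cidem.
have [z0 z01] := psi_nontrivial.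
have [rho rhoP] := lat_perp_bounded av2 two_neq0 Ju C01 TC0 ar.1 z01.
exists (Num.max rho 0), C0; split=> //; first by rewrite le_max lexx orbT.
by move=> w Lw; rewrite le_max rhoP.
Qed.

Lemma lat_reps r : admissible r -> exists N (rep : 'I_N -> 'cV[k]_n),
  [/\ forall i, Lperp hcJ (lat T r) (rep i), forall i j, lat T r (rep i - rep j) -> i = j
    & forall w, Lperp hcJ (lat T r) w -> exists i, lat T r (w - rep i)].
Proof.
move=> ar; have [rho [C0 [_ C01 TC0 rhoP]]] := lat_data ar.
have C00 : 0 < C0 by apply: lt_le_trans C01.
apply: (@coset_representatives _ _ _ _ _ (r / C0) rho) => //.
- by rewrite divr_gt0 // ar.1.
- by move=> x /ltW xr; apply: nrm_lat xr.
- exact: latB.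
Qed.

Lemma torus_trivial_near1 r : admissible r ->
  exists2 e, 0 < e & forall t, T t -> nrm (t - 1%:M) <= e -> forall x, smooth r x -> s t x = x.
Proof.
move=> ar; have [rho [C0 [rho0 C01 TC0 rhoP]]] := lat_data ar.
have [N [rep [rL ri rs]]] := lat_reps ar.
have C00 : 0 < C0 by apply: lt_le_trans C01.
have r0 := ar.1.
have rho1 : 0 < 1 + rho by rewrite ltr_pwDl.
(* An element within [eta] of 1 moves every vector of the dual lattice, whose norm is at most [rho],
   by an element of the lattice; this is the condition of [near_scalar]. *)
pose eta := r / C0 / (1 + rho).
have eta0 : 0 < eta by rewrite !divr_gt0.
have move_small (g : 'M[k]_n) w : nrm (g - 1%:M) <= eta -> Lperp hcJ (lat T r) w -> lat T r (g *m w - w).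
  move=> ge /rhoP wr; have -> : g *m w - w = (g - 1%:M) *m w by rewrite mulmxBl mul1mx.
  apply: (nrm_lat C01 TC0); apply: le_trans (nrmM _ _) _.
  apply: le_trans (_ : eta * (1 + rho) <= _); last by rewrite /eta mulfVK ?gt_eqF.
  by rewrite ler_pM ?nrm_ge0 //; apply: le_trans wr _; rewrite lerDr.
have scal g g' U : near_one_pair J eta g g' -> Mp (g, U) -> exists a, forall x, smooth r x -> U x = a *: x.
  move=> [gJ g'J gg' g1 g'1] MU.
  apply: (near_scalar HH cDl cDr cxx omL om_iso omM om_irr (@lat_half _ _ _ T av2 two_neq0 r)
    rL rs (g := fun w => g *m w)).
  - exact: Mp_linear MU.
  - by move=> w v; apply: Mp_om MU.
  - by move=> w Lw; apply: move_small.
  - move=> l Ll; exists (g' *m l); last by rewrite mulmxA gg' mul1mx.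
    have g'l : lat T r (g' *m l - l) by apply: move_small => // l' Ll'; apply: ar.2.
    have lB x y : lat T r x -> lat T r y -> lat T r (x - y) by apply: latB.
    have l0 : lat T r 0 by apply: lat0; apply: ltW.
    by have := LD (L := lat T r) l0 lB g'l Ll; rewrite subrK.
(* Being closed under products, this condition can be fed with the factorization of torus elements
   into commutators. *)
pose Q t := exists2 U, Mp (t, U) & forall x, smooth r x -> U x = x.
have QM x y : Q x -> Q y -> Q (x *m y).
  by move=> [U MU Ux] [V MV Vy]; exists (U \o V); [apply: MpM|move=> z sz /=; rewrite Vy // Ux].
have Qc g g' h h' : near_one_pair J eta g g' -> near_one_pair J eta h h' -> Q (g *m h *m g' *m h').
  move=> ng nh; have [gJ g'J gg' _ _] := ng; have [hJ h'J hh' _ _] := nh.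
  have [U MU] := Mp_surj gJ; have [V MV] := Mp_surj hJ.
  have [g1 [U' [MU' gg1 UU']]] := Mp_inv MU; have [h1 [V' [MV' hh1 VV']]] := Mp_inv MV.
  have un (A B B' : 'M[k]_n) : A *m B = 1%:M -> A *m B' = 1%:M -> B = B'.
    by move=> AB AB'; rewrite -[B]mulmx1 -AB' mulmxA (mulmx1C AB) mul1mx.
  have eg : g1 = g' by apply: un gg1 gg'.
  have eh : h1 = h' by apply: un hh1 hh'.
  rewrite {}eg in MU' gg1; rewrite {}eh in MV' hh1.
  have ng' : near_one_pair J eta g' g by case: ng => *; split=> //; apply: mulmx1C.
  have nh' : near_one_pair J eta h' h by case: nh => *; split=> //; apply: mulmx1C.
  have [a aP] := scal _ _ _ ng MU; have [a' a'P] := scal _ _ _ ng' MU'.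
  have [b bP] := scal _ _ _ nh MV; have [b' b'P] := scal _ _ _ nh' MV'.
  exists (U \o V \o U' \o V'); first by do !apply: MpM => //.
  (* The scalars of a lift and of its inverse cancel, so the commutator of the lifts acts
     trivially. *)
  move=> x sx /=; have SF := fixedH_subspace omL (lat T r).
  have sZ c : smooth r (c *: x) by apply: (subspaceZ _ SF).
  rewrite b'P // a'P // scalerA bP // scalerA aP // scalerA.
  have aa : (a * a') *: x = x by rewrite -[RHS]UU' a'P // aP // scalerA.
  have bb : (b * b') *: x = x by rewrite -[RHS]VV' b'P // bP // scalerA.
  have -> : a * (b * (a' * b')) = a * a' * (b * b') by ring.
  by rewrite -scalerA bb aa.
have [e e0 eP] := near_one_commutators av2 Jskew Ju two_neq0 Yskew Yu Ccomm SS aS Sb eta0 QM Qc.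
(* [s t] and the trivial lift [U] differ by an element of the kernel, whose square is 1. *)
have square_trivial t : T t -> nrm (t - 1%:M) <= e -> forall x, smooth r x -> s t (s t x) = x.
  move=> Tt te x sx; have [U MU Ux] := eP t Tt te.
  have [t1 [U1 [MU1 tt1 UU1]]] := Mp_inv MU.
  have U1x y : smooth r y -> U1 y = y.
    move=> sy; apply/eqP; rewrite -subr_eq0 -(dnorm_eq0 dot) -(Mp_iso _ _ MU); apply/eqP.
    have -> : U (U1 y - y) = 0; last exact: dot0l.
    by rewrite -scaleN1r addrC (Mp_linear MU) UU1 Ux // scaleN1r addNr.
  have := MpM (s_Mp Tt) MU1; rewrite tt1 => /Mp_ker/(_ x) /=.
  by rewrite (U1x x sx) U1x //; apply: smooth_act.
pose e' : R := Num.min e 2%:R^-1.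
have e'0 : 0 < e' by rewrite lt_min e0 invr_gt0 ltr0n.
exists e' => // t Tt te x sx.
have e'1 : 0 <= e' < 1.
  rewrite (ltW e'0) /=; apply: le_lt_trans (_ : 2%:R^-1 < _); first by rewrite ge_min lexx orbT.
  by rewrite invf_lt1 ?ltr1n.
have [t' [Tt' t'e <-]] := Tset_sqrt pprime pres p_neq2 e'1 Tt te.
by rewrite sM // square_trivial //; apply: le_trans t'e _; rewrite ge_min lexx.
Qed.

Lemma torus_locally_constant r : admissible r -> exists2 d, 0 < d & forall t t', T t -> T t' ->
  nrm (t' - t) < d -> forall x, smooth r x -> s t' x = s t x.
Proof.
move=> ar; have [e e0 eP] := torus_trivial_near1 ar.
have [C0 C01 TC0] := Tset_bounded Jskew Ju Yskew Ccomm Cidem.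
have C00 : 0 < C0 by apply: lt_le_trans C01.
exists (e / C0); first by rewrite divr_gt0.
move=> t t' Tt Tt' /ltW tt x sx.
have tu := Tset_unitmx Ju Tt; have TV : T (invmx t) by apply: TsetV.
have -> : t' = t *m (invmx t *m t') by rewrite mulKVmx.
rewrite sM //; last exact: TM.
congr (s t _); apply: eP => //; first exact: TM.
have -> : invmx t *m t' - 1%:M = invmx t *m (t' - t) by rewrite mulmxBr mulVmx.
rewrite -(mulfVK (lt0r_neq0 C00) e) mulrC; apply: nrmM_le => //; exact: TC0.
Qed.

Lemma torus_finite_image r : admissible r -> exists2 ts : seq 'M[k]_n,
  (forall t, t \in ts -> T t) &
  forall t, T t -> exists2 t', t' \in ts & forall x, smooth r x -> s t x = s t' x.
Proof.
move=> ar; have [d d0 dP] := torus_locally_constant ar.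
have [C0 C01 TC0] := Tset_bounded Jskew Ju Yskew Ccomm Cidem.
have [l lP] := @gauge_cover _ _ _ _ C0 (fun _ : 'M[k]_n => d) (fun=> d0).
(* In each ball of the cover a point of the torus is chosen if there is one, and 1 otherwise. *)
have ch (y : 'M[k]_n) : exists t, T t /\ ((exists2 t0, T t0 & nrm (t0 - y) < d) -> nrm (t - y) < d).
  have [[t0 Tt0 ty]|h] := pselect (exists2 t0, T t0 & nrm (t0 - y) < d); first by exists t0.
  by exists 1%:M.
have [f fP] := choice ch.
exists [seq f y | y <- l] => [_ /mapP[y _ ->]|t Tt]; first by case: (fP y).
have [y yl [_ ty]] := lP t (TC0 _ Tt).
have [Tf fy] := fP y.
exists (f y); first exact: map_f.
apply: dP => //; rewrite -[t - f y](subrKA y) -[y - f y]opprB nrmB_lt //.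
by apply: fy; exists t.
Qed.

Lemma smooth_eigenvectors r x : admissible r -> smooth r x ->
  exists m (f : 'I_m -> H) (q : 'I_m -> C), [/\ x = \sum_i q i *: f i,
    forall i, smooth r (f i), forall i, f i != 0
    & forall i t, T t -> exists a, s t (f i) = a *: f i].
Proof.
move=> ar sx; have [N [rep [rL ri rs]]] := lat_reps ar.
have r0 := ar.1; have SF := fixedH_subspace omL (lat T r).
have [m [e [eo eF ex]]] := fixedH_basis HH cDl cDr cxx omL om_iso omM om_irr
  (@lat_half _ _ _ T av2 two_neq0 r) rL rs.
have [ts tsT tsP] := torus_finite_image ar.
have [t /tsT/s_Mp/Mp_linear //|t u v /tsT/s_Mp tM|t i tt|t t' v tt tt'|f [fe f0 ef feig]] :=
    @unitary_codiagonalization _ _ _ m e _ ts s eo.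
- exact: Mp_iso tM.
- exact: ex (smooth_act (tsT _ tt) (eF i)).
- have [Tt Tt'] := (tsT _ tt, tsT _ tt').
  by rewrite -(sM v Tt Tt') -(sM v Tt' Tt) (Ccomm Tt.1 Tt'.1).
have sf i : smooth r (f i) by have [q ->] := fe i; apply: (subspace_sum _ _ SF).
have [q qP] := choice ef.
exists m, f, (fun j => \sum_i dot x (e i) * q i 0 j); split=> // [|i t Tt].
  rewrite -[LHS](ex x sx) /oproj.
  under eq_bigr => i _ do rewrite [X in _ *: X]qP scaler_sumr.
  rewrite exchange_big /=; apply: eq_bigr => j _.
  by rewrite scaler_suml; apply: eq_bigr => i _; rewrite scalerA.
have [t' tt' tE] := tsP t Tt; rewrite tE //; exact: feig.
Qed.

Definition isoM (chi : 'M[k]_n -> C) (v : H) := forall t, T t -> s t v = chi t *: v.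

Lemma isoM_norm chi v t : isoM chi v -> v != 0 -> T t -> `|chi t| = 1.
Proof.
move=> cv v0 Tt; have := Mp_iso v v (s_Mp Tt); rewrite cv // dotZZ => /eqP.
rewrite -[X in _ == X]mul1r (inj_eq (mulIf _)) ?dnorm_eq0 // sqrf_eq1 => /orP[/eqP //|/eqP h].
by have := normr_ge0 (chi t); rewrite h oppr_ge0 ler10.
Qed.

Lemma isoM_dot chi chi' u v t : isoM chi u -> isoM chi' v -> u != 0 -> v != 0 -> T t ->
  chi t != chi' t -> dot u v = 0.
Proof.
move=> cu cv u0 v0 Tt ne; apply: (isometry_eigen_orth (U := s t)) ne => //.
- by move=> x y; apply: Mp_iso (s_Mp Tt).
- exact: cu.
- exact: cv.
- exact: isoM_norm cv v0 Tt.
Qed.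

Lemma isoM_unique r chi v v' : admissible r -> smooth r v -> smooth r v' ->
  isoM chi v -> isoM chi v' -> v != 0 -> dot v v' = 0 -> v' = 0.
Proof.
move=> ar sv sv' cv cv' v0 vv'; have [N [rep [rL ri rs]]] := lat_reps ar.
have r0 := ar.1.
have inv a b w : isoM chi a -> isoM chi b -> dot (om (S *m w) a) b = dot (om w a) b.
  move=> ca cb; have [g Tg ->] := ST w.
  have n1 := isoM_norm cv v0 Tg.
  rewrite -[RHS](Mp_iso _ _ (s_Mp Tg)) (Mp_om _ _ (s_Mp Tg)) ca // cb //.
  by rewrite (omZ omL) dotZl dotZr mulrA -normCK n1 expr1n mul1r.
have lB x y : lat T r x -> lat T r y -> lat T r (x - y) by apply: latB.
have l0 : lat T r 0 by apply: lat0; apply: ltW.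
apply: (gelfand_trick (L := lat T r) HH cDl cDr cxx omL om_iso omM om0 om_irr
   l0 lB (@lat_half _ _ _ T av2 two_neq0 r) ar.2 rL ri rs
   (S := fun w => S *m w) _ _ _ _ sv sv' v0 vv').
- by move=> x y; rewrite mulmxBr.
- by move=> x; rewrite mulmxA SS mul1mx.
- move=> x y; rewrite /hc (bf_antisympl Ju _ _ SS aS) [in RHS](bfC Jskew) //.
- by move=> x Lx; have [g Tg ->] := ST x; apply: (lat_act TM).
- by move=> w; apply: inv.
- by move=> w; apply: inv.
Qed.

(** The value 0 outside [T] makes characters that agree on [T] equal as functions, so that distinct
    indices are separated by an element of [T]. *)
Definition occurs (chi : 'M[k]_n -> C) :=
  (exists r v, [/\ admissible r, smooth r v, dot v v = 1 & isoM chi v]) /\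
  forall t, ~ T t -> chi t = 0.

Lemma eigenvector_occurs r v : admissible r -> smooth r v -> v != 0 ->
    (forall t, T t -> exists a, s t v = a *: v) ->
  exists2 chi, occurs chi & isoM chi v.
Proof.
move=> ar sv v0 vE.
have ch t : exists a, (T t -> s t v = a *: v) /\ (~ T t -> a = 0).
  have [Tt|nT] := pselect (T t); last by exists 0; split.
  by have [a aE] := vE t Tt; exists a; split.
have [chi chiP] := choice ch; exists chi; last by move=> t Tt; apply: (chiP t).1.
split=> [|t]; last exact: (chiP t).2.
exists r, (`|v|^-1 *: v); split=> //.
- by apply: (subspaceZ _ (fixedH_subspace omL _)).
- by rewrite dotZZ -HH normfV normr_id -exprMn mulVf ?expr1n // normr_eq0.
- move=> t Tt; have := Mp_linear (s_Mp Tt) `|v|^-1 v 0.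
  have s0 : s t 0 = 0.
    by have := Mp_linear (s_Mp Tt) (-1) 0 0; rewrite scaler0 addr0 scaleN1r addNr.
  by rewrite !addr0 s0 addr0 (chiP t).1 // => ->; rewrite !scalerA mulrC.
Qed.

(** The index set consists of the characters occurring on smooth vectors, with a single unit vector
    for each; that these vectors suffice is where multiplicity one enters. The last clause allows
    multiplicity one to be extended to vectors that are not smooth. *)
Theorem weil_torus_decomposition : exists (I : Type) (chi : I -> 'M[k]_n -> C) (e : I -> H),
  [/\ forall i t t', T t -> T t' -> chi i (t *m t') = chi i t * chi i t',
      forall i t, T t -> `|chi i t| = 1,
      forall i, exists2 d : R, 0 < d & forall t t', T t -> T t' -> nrm (t' - t) < d -> chi i t' = chi i t
    & orthonormal_basis dot e] /\
  [/\ forall i, isoM (chi i) (e i),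
      forall i j, i <> j -> exists2 t, T t & chi i t != chi j t
    & forall u, (forall i, dot u (e i) = 0) -> u = 0].
Proof.
pose I := {chi | occurs chi}.
have ch (i : I) : exists v, dot v v = 1 /\ isoM (sval i) v /\ exists r, admissible r /\ smooth r v.
  have [[r [v [ar sv v1 cv]]] _] := svalP i.
  by exists v; split=> //; split=> //; exists r.
have [e eP] := choice ch.
have e1 i : dot (e i) (e i) = 1 := (eP i).1.
have ei i : isoM (sval i) (e i) := (eP i).2.1.
have e0 i : e i != 0.
  by apply/eqP => h; have := e1 i; rewrite h dot0l => /esym/eqP; rewrite oner_eq0.
have sep (i j : I) : i <> j -> exists2 t, T t & sval i t != sval j t.
  case: i j => [ci oi] [cj oj] ij; apply: contrapT => h; apply: ij; apply: eq_exist.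
  apply: funext => t; have [Tt|nT] := pselect (T t).
    by apply: contrapT => /eqP ne; apply: h; exists t.
  by rewrite (oi.2 t nT) (oj.2 t nT).
have eo i j : i <> j -> dot (e i) (e j) = 0.
  by move=> /sep[t Tt ne]; apply: isoM_dot (ei i) (ei j) (e0 i) (e0 j) Tt ne.
have span r u : admissible r -> smooth r u ->
    exists (l : seq I) (c : I -> C), u = \sum_(i <- l) c i *: e i.
  move=> ar su; have [m [f [q [uE sf f0 fE]]]] := smooth_eigenvectors ar su.
  have fi j : exists i : I, f j = dot (f j) (e i) *: e i.
    have [chi och cf] := eigenvector_occurs ar (sf j) (f0 j) (fE j).
    pose i : I := exist _ chi och; exists i.
    have [r' [ar' sr']] := (eP i).2.2.
    (* The two vectors may be fixed by different lattices; both are fixed by the smaller one, where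
       uniqueness applies. *)
    pose r2 := Num.min r r'.
    have r20 : 0 < r2 by rewrite lt_min ar.1 ar'.1.
    have ar2 : admissible r2 by apply: admissible_le ar _; rewrite r20 ge_min lexx.
    have sf2 : smooth r2 (f j) by apply: smooth_mono (sf j); rewrite ge_min lexx.
    have se2 : smooth r2 (e i) by apply: smooth_mono sr'; rewrite ge_min lexx orbT.
    have SF := fixedH_subspace omL (lat T r2).
    apply/eqP; rewrite -subr_eq0; apply/eqP.
    apply: (isoM_unique (chi := chi) ar2 se2 _ (ei i) _ (e0 i)).
    - by apply: (subspaceB SF) => //; apply: (subspaceZ _ SF).
    - move=> t Tt; rewrite -scaleNr addrC (Mp_linear (s_Mp Tt)) cf // (ei i) //.
      by rewrite scalerDr !scalerA mulrC.
    - by apply: dot_eq0C; rewrite dotBl dotZl e1 mulr1 subrr.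
  have [g gP] := choice fi.
  (* Several of the eigenvectors may have the same character, hence the removal of duplicates. *)
  pose l := undup [seq g j : {classic I} | j <- enum 'I_m].
  exists l, (fun i => dot u (e i)).
  have fl j : f j = \sum_(i <- l) dot (f j) (e i) *: e i.
    rewrite (bigD1_seq (g j : {classic I})) ?undup_uniq //=; last by rewrite mem_undup map_f ?mem_enum.
    rewrite -gP big1 ?addr0 // => i /eqP ij.
    by rewrite (gP j) dotZl eo ?mulr0 ?scale0r // => h; apply: ij.
  rewrite {1}uE; under eq_bigr => j _ do rewrite fl scaler_sumr.
  rewrite exchange_big /=; apply: eq_bigr => i _.
  rewrite uE dot_suml scaler_suml; apply: eq_bigr => j _.
  by rewrite dotZl scalerA.
exists I, sval, e; split; split=> //.
- move=> i t t' Tt Tt'; have := ei i _ (TM Tt Tt').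
  rewrite sM // (ei i) //; have := Mp_linear (s_Mp Tt) (sval i t') (e i) 0.
  have s0 : s t 0 = 0.
    by have := Mp_linear (s_Mp Tt) (-1) 0 0; rewrite scaler0 addr0 scaleN1r addNr.
  rewrite !addr0 s0 addr0 => ->; rewrite (ei i) // scalerA => h.
  by have := congr1 (fun v => dot v (e i)) h; rewrite !dotZl e1 !mulr1 mulrC => ->.
- by move=> i t Tt; apply: isoM_norm (ei i) (e0 i) Tt.
- move=> i; have [r [ar sr]] := (eP i).2.2.
  have [d d0 dP] := torus_locally_constant ar; exists d => // t t' Tt Tt' tt.
  have := dP t t' Tt Tt' tt _ sr; rewrite !(ei i) // => h.
  by have := congr1 (fun v => dot v (e i)) h; rewrite !dotZl e1 !mulr1.
- split=> // O [v Ov] Oo.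
  have /nbhs_rn[d d0 dO] : nbhs v O by apply: open_nbhs_nbhs.
  have [|r [u [ar su ud]]] := @smooth_dense v (d / 2%:R); first by rewrite divr_gt0.
  exists u; split; last exact: span ar su.
  by apply: dO; apply: le_lt_trans ud _; rewrite ltr_pdivrMr // ltr_pMr // ltr1n.
- move=> u ue; apply/rn_eq0/ler_addgt0Pr => d d0; rewrite add0r.
  have [r [u' [ar su' u'd]]] := smooth_dense u d0.
  apply: le_trans u'd; have [l [c u'E]] := span r u' ar su'.
  (* As [u'] is orthogonal to [u], the norm of [u] is at most the distance from [u] to [u']. *)
  have o : dot u' (- u) = 0.
    rewrite -scaleN1r dotZr; have -> : dot u' u = 0; last by rewrite mulr0.
    by apply: dot_eq0C; rewrite u'E dot_sumr big1 // => i _; rewrite dotZr ue mulr0.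
  rewrite -(ler_pXn2r (ltn0Sn 1)) ?nnegrE ?rn_ge0 // -lecR !(rn_sq HH) (dotDD o) -[X in _ + X]opprK.
  by rewrite -[dot u u](_ : dot (- u) (- u) = _) ?opprK ?lerDr ?dnorm_ge0 //; apply: hnormN.
Qed.

End WeilTorus.

Lemma order2_pigeonhole (T : Type) (A : set T) (a b c : T) : (A #= `I_2)%card ->
  A a -> A b -> A c -> a = b \/ b = c \/ a = c.
Proof.
move=> /card_eqPle[/card_leP[f] _] Aa Ab Ac.
pose el x (Ax : A x) : A := exist _ x (mem_set Ax).
have f_inj x y (Ax : A x) (Ay : A y) : f (el x Ax) = f (el y Ay) -> x = y.
  by move/(@inj _ _ _ f _ _ (mem_setT _) (mem_setT _))/(congr1 val).
have lt2 (z : `I_2) : val z = 0%N \/ val z = 1%N.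
  by have := set_mem (valP z); case: (val z) => [|[|//]]; [left|right].
have fval x y (Ax : A x) (Ay : A y) : val (f (el x Ax)) = val (f (el y Ay)) -> x = y.
  by move/val_inj/f_inj.
have [ha|ha] := lt2 (f (el a Aa)); have [hb|hb] := lt2 (f (el b Ab));
  have [hc|hc] := lt2 (f (el c Ac)).
- by left; apply: fval; rewrite ha hb.
- by left; apply: fval; rewrite ha hb.
- by right; right; apply: fval; rewrite ha hc.
- by right; left; apply: fval; rewrite hb hc.
- by right; left; apply: fval; rewrite hb hc.
- by right; right; apply: fval; rewrite ha hc.
- by left; apply: fval; rewrite ha hb.
- by left; apply: fval; rewrite ha hb.
Qed.

Section HeisenbergOperators.
Variables (R : realType) (k : nonarchLocalFieldType R) (psi : k -> R[i]^o) (W : vectType k).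
Variables (beta : {skew_symmetric W}) (H : completeNormedModType R[i]) (dot : {dot H for Num.conj}).
Variable rho : W * k -> H -> H.
Hypothesis psi_char : unitary_character psi.
Hypothesis HH : hilbert_dot dot.
Hypothesis rho_unitary : heis_unitary_rep beta dot rho.
Hypothesis rho_irr : heis_irreducible rho.
Hypothesis rho_central : central_character rho psi.
Local Notation n := (\dim {:W}).

Definition heis_op (x : 'cV[k]_n) : H -> H := rho (vec_of x, 0).

Lemma heis_op_linear x : linear (heis_op x).
Proof. by have [/(_ (vec_of x, 0))[]] := rho_unitary. Qed.

Lemma heis_op_iso x u v : dot (heis_op x u) (heis_op x v) = dot u v.
Proof. by have [/(_ (vec_of x, 0))[_ _ ->]] := rho_unitary. Qed.

Lemma rho_heis_op x t v : rho (vec_of x, t) v = psi t *: heis_op x v.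
Proof.
have [_ hom _] := rho_unitary; rewrite -rho_central -hom /heis_mul /=.
by rewrite linear0l mulr0 add0r !addr0.
Qed.

Lemma heis_opM x y v :
  heis_op x (heis_op y v) = hc (gram beta) psi x y *: heis_op (x + y) v.
Proof.
have [_ hom _] := rho_unitary; rewrite {1 2}/heis_op -hom /heis_mul /= !add0r -vec_ofD rho_heis_op.
by rewrite /hc /bf gramE.
Qed.

Lemma heis_op0 v : heis_op 0 v = v.
Proof. by rewrite /heis_op vec_of0 rho_central (psi0 psi_char) scale1r. Qed.

(** The vectors orthogonal to the orbit of [v] form a closed invariant subspace, which is not
    everything as it does not contain [v]. *)
Lemma heis_op_irr u v : v != 0 -> (forall w, dot u (heis_op w v) = 0) -> u = 0.
Proof.
move=> v0 uv; pose V := [set u | forall w, dot u (heis_op w v) = 0].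
have [_ /(_ V)[]] := rho_irr.
- by split=> [w|a x y Vx Vy w]; rewrite ?dot0l // dotDl dotZl Vx Vy mulr0 addr0.
- move=> x cx w; apply: (dot_closure HH) => e e0.
  have [|x' [Vx' xe]] := cx [set x' | rn (x' - x) < e]; first by apply/nbhs_rn; exists e.
  by exists x'.
- move=> [w t] x Vx y; have [z <-] := vec_of_surj w.
  rewrite rho_heis_op dotZl -(heis_op_iso (- z)) !heis_opM addNr heis_op0 dotZl dotZr Vx.
  by rewrite !mulr0.
- by move=> VE; have : V u by []; rewrite VE.
- move=> VE; have : V v by rewrite VE.
  by move/(_ 0); rewrite heis_op0 => /eqP; rewrite dnorm_eq0 (negPf v0).
Qed.

Lemma heis_op_continuous v (e : R) : 0 < e ->
  exists2 r, 0 < r & forall x, nrm x <= r -> rn (heis_op x v - v) <= e.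
Proof.
move=> e0; have [_ _ cont] := rho_unitary.
have z0 : rho (passmx.vecof (vbasis {:W}) 0, 0) v = v.
  by rewrite -[RHS]heis_op0 /heis_op /vec_of trmx0.
have : nbhs v [set u | rn (u - v) < e] by apply/nbhs_rn; exists e.
rewrite -{1}z0 => /(cont v (0, 0)) [[A B] /= [/nbhs_nrm[d d0 dA] /nbhs_singleton B0] AB].
exists (d / 2%:R); first by rewrite divr_gt0.
move=> x xd; apply: ltW; apply: (AB (x^T, 0)); split=> //=; apply: dA.
by rewrite subr0 nrm_tr; apply: le_lt_trans xd _; rewrite ltr_pdivrMr // ltr_pMr // ltr1n.
Qed.

End HeisenbergOperators.

Theorem mainTheorem11 (R : realType) (k : nonarchLocalFieldType R)
    (k_char0 : [pchar k] =i pred0)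
    (p : nat) (k_res : residue_char k p) (p_neq2 : p <> 2%N)
    (psi : k -> R[i]^o) (psi_char : unitary_character psi)
    (psi_nontrivial : exists x, psi x <> 1)
    (W : vectType k) (W_neq0 : (0 < \dim {:W})%N)
    (beta : {skew_symmetric W}) (beta_sympl : is_psymplectic beta)
    (H : completeNormedModType R[i]) (dot : {dot H for Num.conj})
    (H_hilbert : hilbert_dot dot)
    (rho : W * k -> H -> H)
    (rho_unitary : heis_unitary_rep beta dot rho)
    (rho_irr : heis_irreducible rho)
    (rho_central : central_character rho psi)
    (Mp : set ('End(W) * (H -> H))) (MpP : is_Mp beta dot rho Mp)
    (K : closedFieldType) (iota : {rmorphism k -> K})
    (K_closure : algebraic_closure iota)
    (T : set 'M[K]_(\dim {:W}))
    (T_max : maximal_torus iota beta T)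
    (T_elliptic : elliptic_torus iota beta T)
    (s : 'End(W) -> 'End(W) * (H -> H))
    (s_section : mp_section Mp (kpoints iota T) s) :
  direct_sum_of_characters dot (kpoints iota T) (fun t => weil_rep (s t)) /\
  multiplicity_one (kpoints iota T) (fun t => weil_rep (s t)).
Proof.
have two_neq0 : 2%:R != 0 :> k by rewrite ((pcharf0P k).1 k_char0).
have [pprime pres] := k_res.
pose J := gram beta.
have Jskew : J^T = - J := gram_skew beta.
have Ju : J \in unitmx := gram_unitmx beta_sympl.
have [[Ttorus TSp] Tmax] := T_max.
have [||Y [w0 [[Yskew Yu Ccomm Ccyc TP] Cidem]]] :=
  elliptic_torus_structure k_char0 K_closure Jskew Ju Ttorus TSp.
- by move=> T' T't T'S; apply: Tmax.
- exact: T_elliptic.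
have [S [SS aS Sb ST]] := conjugation Jskew Ju Yskew Ccomm Ccyc Cidem.
have [MpS [Mp1 MpM MpV] Mpsurj Mpcard] := MpP.
have [sMp sM] := s_section.
have endM (g h : 'M[k]_(\dim {:W})) : end_of_mx (g *m h) = (end_of_mx g \o end_of_mx h)%VF.
  by rewrite -[RHS]mx_of_endK mx_of_end_comp !end_of_mxK.
have end1 : end_of_mx 1%:M = \1%VF :> 'End(W) by rewrite -(mx_of_end1 W) mx_of_endK.
have kP g : kpoints iota T g <-> Tset J Y (mx_of_end g) by apply: TP.
have kE t : kpoints iota T (end_of_mx t) <-> Tset J Y t.
  by split=> [/kP|h]; rewrite ?end_of_mxK //; apply/kP; rewrite end_of_mxK.
pose Mp' := [set x : 'M[k]_(\dim {:W}) * (H -> H) | Mp (end_of_mx x.1, x.2)].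
pose s' t := weil_rep (s (end_of_mx t)).
have s'E g : kpoints iota T g -> s' (mx_of_end g) = weil_rep (s g) by rewrite /s' mx_of_endK.
have Mp'_linear g U : Mp' (g, U) -> linear U by move=> /MpS[_ []].
have Mp'_iso g U u v : Mp' (g, U) -> dot (U u) (U v) = dot u v by move=> /MpS[_ [_ _ h] _].
have Mp'_om g U w v : Mp' (g, U) -> U (heis_op rho w v) = heis_op rho (g *m w) (U v).
  by move=> /MpS[_ _ h]; rewrite /heis_op [LHS]h /= end_vec_of end_of_mxK.
have Mp'M g h U V : Mp' (g, U) -> Mp' (h, V) -> Mp' (g *m h, U \o V).
  by move=> MU MV; have := MpM _ _ MU MV; rewrite /mp_mul /= -endM.
have Mp'V g U : Mp' (g, U) -> exists g' U',
    [/\ Mp' (g', U'), g *m g' = 1%:M & forall v, U (U' v) = v].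
  move=> MU; have [[g' U'] MU' [e1 e2]] := MpV _ MU; exists (mx_of_end g'), U'; split.
  - by rewrite /Mp' /= mx_of_endK.
  - by rewrite -[g in LHS]end_of_mxK -mx_of_end_comp e1 mx_of_end1.
  - by move=> v; have := congr1 (fun f => f v) e2.
have Mp'_surj g : g^T *m J *m g = J -> exists U, Mp' (g, U).
  by move=> gJ; apply: (Mpsurj (end_of_mx g)); apply/Sp_gram; rewrite end_of_mxK.
(* Two of the three kernel elements 1, [U] and [U \o U] coincide, and each coincidence gives that
   the square of [U] is 1. *)
have Mp'_ker U : Mp' (1%:M, U) -> forall v, U (U v) = v.
  rewrite /Mp' /= end1 => MU v.
  have [_ [_ /bij_inj U_inj _] _] := MpS _ MU.
  have c2 : (mp_mul (\1%VF, U) (\1%VF, U)).1 = \1%VF :> 'End(W) by rewrite /= comp_lfun1l.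
  have [[e1]|[[_ e2]|[_ e3]]] := order2_pigeonhole Mpcard (conj Mp1 erefl) (conj MU erefl)
    (conj (MpM _ _ MU MU) c2).
  - by rewrite -e1.
  - by have := congr1 (fun f => f v) e2 => /= /esym/U_inj ->; apply: U_inj; have := congr1 (fun f => f v) e2.
  - by have := congr1 (fun f => f v) e3.
have s'_Mp' t : Tset J Y t -> Mp' (t, s' t).
  by move=> /kE/sMp[]; rewrite /Mp' /= /s' /weil_rep; case: (s _) => a V /= MV <-.
have s'M t t' v : Tset J Y t -> Tset J Y t' -> s' (t *m t') v = s' t (s' t' v).
  by move=> /kE kt /kE kt'; rewrite /s' endM sM.
have [I [chi [e [[chiM chi1 loc e_onb] [e_iso chi_sep e_total]]]]] :=
  weil_torus_decomposition pprime pres p_neq2 two_neq0 psi_char psi_nontrivial Jskew Ju Yskew Yu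
    Ccomm Cidem SS aS Sb ST H_hilbert (heis_op_linear rho_unitary) (heis_op_iso rho_unitary)
    (heis_opM rho_unitary rho_central) (heis_op0 psi_char rho_central)
    (heis_op_irr psi_char H_hilbert rho_unitary rho_irr rho_central)
    (heis_op_continuous psi_char rho_unitary rho_central)
    Mp'_linear Mp'_iso Mp'_om Mp'M Mp'V Mp'_surj Mp'_ker s'_Mp' s'M.
have [e1 e_orth _] := e_onb.
have s_iso g : kpoints iota T g -> forall u v, dot (weil_rep (s g) u) (weil_rep (s g) v) = dot u v.
  by move=> /sMp[/MpS[_ [_ _ h] _] _].
have s_lin g : kpoints iota T g -> linear (weil_rep (s g)).
  by move=> /sMp[/MpS[_ [h _ _] _] _].
have e_isotypic i g : kpoints iota T g -> weil_rep (s g) (e i) = chi i (mx_of_end g) *: e i.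
  by move=> kg; rewrite -s'E // e_iso //; apply/kP.
split.
  exists I, (fun i g => chi i (mx_of_end g)), e; split=> // i; split.
  - by move=> g h /kP kg /kP kh; rewrite mx_of_end_comp chiM.
  - by move=> g /kP kg; apply: chi1.
  - have -> : (fun A => chi i (mx_of_end (end_of_mx A : 'End(W)))) = chi i.
      by apply: funext => A; rewrite end_of_mxK.
    apply/subspace_continuousP => A kA U /nbhs_singleton UA.
    have [d d0 dP] := loc i; apply/nbhs_nrm; exists d => // B BA kB.
    by rewrite /= /from_subspace (dP A) //; apply/kE.
(* Some [e i] is not orthogonal to [v]; since eigenvectors with distinct characters are orthogonal,
   [c] agrees with [chi i] on the torus. Any vector with this character is then orthogonal to all
   other [e j], hence a multiple of [e i]. *)
move=> c [cM c1 _] [v cv v0].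
have [i vi] : exists i, dot v (e i) != 0.
  apply: contrapT => h; case/eqP: v0; apply: e_total => i.
  by apply: contrapT => /eqP vi; apply: h; exists i.
have ci t : Tset J Y t -> c (end_of_mx t) = chi i t.
  move=> Tt; apply: contrapT => /eqP ne; case/eqP: vi; have kt := (kE t).2 Tt.
  apply: (isometry_eigen_orth (s_iso _ kt) (cv _ kt) (e_isotypic i _ kt)); rewrite end_of_mxK //.
  exact: chi1.
exists (e i); first by apply/eqP => h; have := e1 i; rewrite h dot0l => /esym/eqP; rewrite oner_eq0.
apply/seteqP; split=> [w cw|_ [a ->] g kg] /=; last first.
  have s0 : weil_rep (s g) 0 = 0.
    by have := s_lin g kg (-1) 0 0; rewrite scaler0 addr0 scaleN1r addNr.
  have := s_lin g kg a (e i) 0; rewrite !addr0 s0 addr0 => ->.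
  by rewrite e_isotypic // -ci ?mx_of_endK ?scalerA 1?mulrC //; apply/kP.
exists (dot w (e i)); apply/eqP; rewrite -subr_eq0; apply/eqP; apply: e_total => j.
rewrite dotBl dotZl; have [<-|ij] := pselect (i = j); first by rewrite e1 mulr1 subrr.
rewrite e_orth // mulr0 subr0; have [t Tt ne] := chi_sep _ _ ij.
have kt := (kE t).2 Tt.
apply: (isometry_eigen_orth (s_iso _ kt) (cw _ kt) (e_isotypic j _ kt)); rewrite end_of_mxK ?ci //.
exact: chi1.
Qed.
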